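(* Let $S$ be an affine rotation surface (a real irreducible algebraic surface in $\mathbb{R}^3$) whose Gaussian curvature is not identically zero. If $S$ has more than one axis of affine rotation (possibly of different types), then: (1) All the axes of affine rotation of $S$ intersect at a single point $P$. (2) The surface $S$ is an affine sphere centered at $P$. (3) If $S$ is not a quadric, then $S$ is an affine sphere of hyperbolic type.
   Context: Surfaces: $S$ is the zero set in $\mathbb{R}^3$ of an irreducible polynomial $F(x,y,z)$ with real coefficients, and the real part of $S$ is 2-dimensional. Canonical affine rotation groups about the $z$-axis (parameter $\alpha\in\mathbb{R}$): elliptic $\begin{pmatrix}\cos\alpha&-\sin\alpha&0\\ \sin\alpha&\cos\alpha&0\\0&0&1\end{pmatrix}$, hyperbolic $\begin{pmatrix}\cosh\alpha&\sinh\alpha&0\\ \sinh\alpha&\cosh\alpha&0\\0&0&1\end{pmatrix}$, parabolic $\begin{pmatrix}1&0&0\\ \alpha&1&0\\ \alpha^2/2&\alpha&1\end{pmatrix}$. A surface $S$ is an affine rotation surface of elliptic (hyperbolic, parabolic) type about a line $\mathcal{A}$, called an axis of affine rotation of $S$, if there is a rigid motion $T$ of $\mathbb{R}^3$ carrying $\mathcal{A}$ to the $z$-axis such that $T(S)$ is invariant under the corresponding canonical group for all $\alpha$. It is an affine rotation surface if it is one of some type about some line. Affine normals: for a local parametrization $\mathbf{x}(u,v)$ of $S$ with unit Euclidean normal $\mathbf{N}$ and Gaussian curvature $K$, the affine co-normal vector is $\nu=|K|^{-1/4}\mathbf{N}$ (where $K\neq0$), and the affine normal vector is $\xi=[\nu,\nu_u,\nu_v]^{-1}(\nu_u\times\nu_v)$,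 where $[\cdot,\cdot,\cdot]$ is the determinant. The affine normal line at $p\in S$ is the line through $p$ parallel to $\xi(p)$. $S$ is an affine sphere if all its affine normal lines intersect at a single point, the center (possibly at infinity). It is elliptic if the center is an affine (finite) point lying on the convex side of $S$, hyperbolic if the center is an affine point lying on the concave side of $S$, and parabolic if the center is a point at infinity (all affine normals are parallel). *)

(* Defs.v *)
(* Libraries: MathComp and MathComp-Analysis.  The notations of mpoly clash with
   those of MathComp-Analysis, hence the filtered import. *)
From mathcomp Require Import all_boot all_order all_algebra.
From mathcomp Require Import all_classical all_reals all_analysis.
From mathcomp Require Import -(notations) mpoly.

Set Implicit Arguments.
Unset Strict Implicit.
Unset Printing Implicit Defensive.

Import Order.TTheory GRing.Theory Num.Theory.
Import numFieldNormedType.Exports.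

Local Open Scope classical_set_scope.
Local Open Scope ring_scope.

Section Euclidean_space.
Variable R : realType.

(* Points and vectors of R^3 are columns, so that matrices act on the left.
   The norm `|.| that MathComp-Analysis puts on this type is the max norm;
   the Euclidean norm is [enorm]. *)
Definition space3 := 'cV[R]_3.

Definition i0 : 'I_3 := inord 0.
Definition i1 : 'I_3 := inord 1.
Definition i2 : 'I_3 := inord 2.

Definition vec (a b c : R) : space3 :=
  \col_(i < 3) nth 0 [:: a; b; c] i.

Definition mat (rows : seq (seq R)) : 'M[R]_3 :=
  \matrix_(i < 3, j < 3) nth 0 (nth [::] rows i) j.

Definition dot (a b : space3) : R := \sum_(i < 3) a i 0 * b i 0.

Definition enorm (a : space3) : R := Num.sqrt (dot a a).

Definition cross (a b : space3) : space3 :=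
  vec (a i1 0 * b i2 0 - a i2 0 * b i1 0)
      (a i2 0 * b i0 0 - a i0 0 * b i2 0)
      (a i0 0 * b i1 0 - a i1 0 * b i0 0).

Definition det3 (a b c : space3) : R :=
  \det (\matrix_(i < 3, j < 3) (nth 0 [:: a; b; c] j) i 0).

End Euclidean_space.

Section Algebraic_surfaces.
Variable R : realType.

Definition poly3 := mpoly.mpoly 3 R.

(* [mpoly.msize F] is 1 + the total degree of F, and 0 for F = 0. *)
Definition irreducible3 (F : poly3) : Prop :=
  (1 < mpoly.msize F)%N /\
  forall G H : poly3, F = G * H ->
    (mpoly.msize G <= 1)%N \/ (mpoly.msize H <= 1)%N.

Definition zeros (F : poly3) : set (space3 R) :=
  [set p | mpoly.meval (fun i => p i 0) F = 0].

(* For F irreducible. *)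
Definition quadric (F : poly3) : Prop := mpoly.msize F = 3%N.

End Algebraic_surfaces.

Section Affine_rotations.
Variable R : realType.

Inductive rotation_type := Elliptic | Hyperbolic | Parabolic.

Definition cosh (a : R) : R := (expR a + expR (- a)) / 2.
Definition sinh (a : R) : R := (expR a - expR (- a)) / 2.

Definition canonical_rotation (k : rotation_type) (a : R) : 'M[R]_3 :=
  match k with
  | Elliptic => mat [:: [:: cos a; - sin a; 0];
                        [:: sin a;   cos a; 0];
                        [::     0;       0; 1]]
  | Hyperbolic => mat [:: [:: cosh a; sinh a; 0];
                          [:: sinh a; cosh a; 0];
                          [::      0;      0; 1]]
  | Parabolic => mat [:: [::          1; 0; 0];
                         [::          a; 1; 0];
                         [:: a ^+ 2 / 2; a; 1]]
  end.

Definition z_axis : set (space3 R) := [set vec 0 0 t | t in [set: R]].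

Definition rigid_motion (T : space3 R -> space3 R) : Prop :=
  exists (Q : 'M[R]_3) (b : space3 R),
    [/\ Q^T *m Q = 1%:M, \det Q = 1 & forall p, T p = Q *m p + b].

Definition axis_of_type (k : rotation_type) (S A : set (space3 R)) : Prop :=
  exists T : space3 R -> space3 R,
    [/\ rigid_motion T, T @` A = z_axis &
        forall a : R,
          (fun p => canonical_rotation k a *m p) @` (T @` S) = T @` S].

Definition axis_of_rotation (S A : set (space3 R)) : Prop :=
  exists k : rotation_type, axis_of_type k S A.

Definition affine_rotation_surface (S : set (space3 R)) : Prop :=
  exists A, axis_of_rotation S A.

End Affine_rotations.

Section Local_parametrizations.
Variable R : realType.

Definition du {V : normedModType R} (f : R * R -> V) : R * R -> V :=
  'D_((1, 0) : R * R) f.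
Definition dv {V : normedModType R} (f : R * R -> V) : R * R -> V :=
  'D_((0, 1) : R * R) f.

Fixpoint C_on {V : normedModType R} (n : nat) (U : set (R * R))
    (f : R * R -> V) : Prop :=
  (forall w, U w -> {for w, continuous f}) /\
  match n with
  | 0 => True
  | m.+1 =>
      [/\ forall w, U w -> derivable f w ((1, 0) : R * R),
          forall w, U w -> derivable f w ((0, 1) : R * R),
          C_on m U (du f) & C_on m U (dv f)]
  end.

Definition smooth_on {V : normedModType R} (U : set (R * R))
  (f : R * R -> V) : Prop := forall n, C_on n U f.

(* The last clause says that x is an open map from U to S: thus x @` U is
   relatively open in S and x is a homeomorphism from U onto it. *)
Definition local_parametrization (S : set (space3 R)) (U : set (R * R))
    (x : R * R -> space3 R) : Prop :=
  [/\ open U /\ smooth_on U x,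
      forall w, U w -> cross (du x w) (dv x w) != 0,
      {in U &, injective x} &
      forall W, open W -> W `<=` U ->
        exists2 V : set (space3 R), open V & x @` W = S `&` V].

(* For the zero set S of a nonzero polynomial the dimension is at most 2, and
   it is 2 exactly when S contains a piece of a smooth surface. *)
Definition two_dimensional (S : set (space3 R)) : Prop :=
  exists U x, local_parametrization S U x /\ U !=set0.

Definition unit_normal (x : R * R -> space3 R) (w : R * R) : space3 R :=
  let n := cross (du x w) (dv x w) in (enorm n)^-1 *: n.

Definition gauss_curvature (x : R * R -> space3 R) (w : R * R) : R :=
  let N := unit_normal x w in
  let E := dot (du x w) (du x w) in
  let F := dot (du x w) (dv x w) in
  let G := dot (dv x w) (dv x w) in
  let L := dot (du (du x) w) N in
  let M := dot (dv (du x) w) N in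
  let P := dot (dv (dv x) w) N in
  (L * P - M ^+ 2) / (E * G - F ^+ 2).

(* The chart (x, U) of S and the parameter w are admissible for the affine
   normal: the curvature does not vanish at x w. *)
Definition curved_point (S : set (space3 R)) (U : set (R * R))
    (x : R * R -> space3 R) (w : R * R) : Prop :=
  [/\ local_parametrization S U x, U w & gauss_curvature x w != 0].

Definition gauss_curvature_identically_zero (S : set (space3 R)) : Prop :=
  forall U x w, local_parametrization S U x -> U w -> gauss_curvature x w = 0.

Definition affine_conormal (x : R * R -> space3 R) (w : R * R) : space3 R :=
  `|gauss_curvature x w| `^ (- 4^-1) *: unit_normal x w.

Definition affine_normal (x : R * R -> space3 R) (w : R * R) : space3 R :=
  let nu := affine_conormal x in
  (det3 (nu w) (du nu w) (dv nu w))^-1 *: cross (du nu w) (dv nu w).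

Definition affine_normal_line (x : R * R -> space3 R) (w : R * R) :
    set (space3 R) :=
  [set x w + t *: affine_normal x w | t in [set: R]].

Definition affine_normal_lines (S : set (space3 R)) : set (set (space3 R)) :=
  [set L | exists U x w, curved_point S U x w /\ L = affine_normal_line x w].

(* Affine spheres with center at a finite point C. *)
Definition affine_sphere_centered_at (S : set (space3 R)) (C : space3 R) : Prop :=
  \bigcap_(L in affine_normal_lines S) L = [set C].

(* The convex side of S at x w is the half-space3, bounded by the tangent plane
   at x w, that contains S near x w; n is the unit normal pointing into it.
   There is no convex side where K < 0. *)
Definition inner_normal (x : R * R -> space3 R) (w : R * R) (n : space3 R) :
    Prop :=
  (n = unit_normal x w \/ n = - unit_normal x w) /\
  \forall q \near w, 0 <= dot n (x q - x w).

Definition on_concave_side (S : set (space3 R)) (C : space3 R) : Prop :=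
  forall U x w, curved_point S U x w ->
    exists n, inner_normal x w n /\ dot n (C - x w) < 0.

Definition hyperbolic_affine_sphere (S : set (space3 R)) : Prop :=
  exists C, affine_sphere_centered_at S C /\ on_concave_side S C.

End Local_parametrizations.

(* Main.v *)
From HB Require Import structures.
Require Import Defs.
From mathcomp Require Import all_boot all_order all_algebra.
From mathcomp Require Import all_classical all_reals all_analysis.
From mathcomp Require Import -(notations) mpoly.
From mathcomp Require Import ring lra zify.

Set Implicit Arguments.
Unset Strict Implicit.
Unset Printing Implicit Defensive.

Import Order.TTheory GRing.Theory Num.Theory.
Import numFieldNormedType.Exports.

Local Open Scope classical_set_scope.
Local Open Scope ring_scope.


(** Infinitesimally, an axis of affine rotation is an affine vector field
   X : p |-> M p + v with zero set the axis, M being conjugate by an isometry to one of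
   three explicit matrices. As X is tangent to the surface, the derivative of F along X
   vanishes on the surface, and the real Nullstellensatz for a surface that contains a
   smooth piece ([divides_of_vanish]) makes it a constant multiple of F. For each of the
   three types this constant is zero, so that X kills F ([axis_frame]).

   The affine fields that kill F form a Lie algebra. Since the surface is curved
   somewhere, it is neither a cylinder nor a plane; hence three such fields are
   linearly dependent at every point, and such a field of constant direction is zero.
   Written in an orthonormal frame in which the first of two given rotations is
   canonical, these closure properties leave few possibilities for the second one
   ([elliptic_pair], [hyperbolic_pair], [parabolic_pair]): the two fields have a common
   zero P, and they either preserve a nondegenerate quadratic form centered at P, or are
   the boost and another diagonal field of trace 0 in the frame. In particular the axes
   meet at P, and nowhere else as they are distinct lines ([axes_meet]).

   In the coordinates y of the frame with origin P, the two fields have as common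
   invariants only the functions of G, where G is the quadratic form in the first case
   and y0 y1 y2 in the second. So G is constant on the surface, F divides G - c, and the
   degrees give F = k (G - c) ([surface_equation]). Hence S is a quadric or
   y0 y1 y2 = c, with c <> 0 because a cone has no curvature. Homogeneity of G yields
   hess F (p - P) = m grad F, with det (hess F) and grad F . (p - P) constant on the
   surface ([tzitzeica_level]). It follows that the conormal is locally a constant
   multiple of grad F and that the affine normal at p is a multiple of p - P: the
   surface is an affine sphere centered at P ([tzitzeica_affine_sphere]). Another pair
   of axes gives another such center, which must be P, so that every axis contains P.

   On y0 y1 y2 = c the inequality between arithmetic and geometric means says that near
   each of its points the surface lies on the side of the tangent plane that does not
   contain P ([torus_concave]).

   The Nullstellensatz rests on the fact that an irreducible F is prime, that is, on
   Gauss's lemma: if F does not divide G, then elimination of one variable gives a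
   nonzero polynomial in the other two that vanishes with F and G. *)

(** * Factorial rings *)

Section Divisibility.
Variable A : idomainType.

Definition divides (a b : A) := exists c, b = c * a.

Definition prime_element (p : A) :=
  [/\ p != 0, p \isn't a GRing.unit &
      forall a b, divides p (a * b) -> divides p a \/ divides p b].

Inductive prime_product : nat -> A -> Prop :=
| prime_product_unit u : u \is a GRing.unit -> prime_product 0 u
| prime_product_mul n p a :
    prime_element p -> prime_product n a -> prime_product n.+1 (p * a).

(** The factors are required to be prime and not only irreducible, which makes the
   uniqueness of the factorization automatic. *)
Definition factorial_ring := forall a, a != 0 -> exists n, prime_product n a.

Lemma divides_mull a b c : divides a b -> divides a (c * b).
Proof. by case=> d ->; exists (c * d); rewrite mulrA. Qed.

Lemma divides_mulr a b c : divides a b -> divides a (b * c).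
Proof. by rewrite mulrC; apply: divides_mull. Qed.

Lemma dividesD a b c : divides a b -> divides a c -> divides a (b + c).
Proof. by move=> [x ->] [y ->]; exists (x + y); rewrite mulrDl. Qed.

Lemma divides_unit a u : u \is a GRing.unit -> divides a u ->
  a \is a GRing.unit.
Proof. by move=> Uu [c uE]; move: Uu; rewrite uE unitrM => /andP[]. Qed.

Lemma prime_productM m n a b : prime_product m a -> prime_product n b ->
  prime_product (m + n) (a * b).
Proof.
elim=> [u Uu|k p a' pp _ IH].
  elim=> [v Uv|k p b' pp _ IH].
    by apply: prime_product_unit; rewrite unitrM Uu.
  by rewrite mulrCA; exact: prime_product_mul.
by move=> /IH; rewrite addSn -mulrA; apply: prime_product_mul.
Qed.

(** The number of prime factors is an invariant, hence a measure that decreases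
   when a prime factor is removed. *)
Lemma prime_product_cancel p b n : prime_element p ->
  prime_product n (p * b) -> exists2 m, n = m.+1 & prime_product m b.
Proof.
move=> pp.
suff H a : prime_product n a -> forall b, a = p * b ->
    exists2 m, n = m.+1 & prime_product m b by move=> /H/(_ b erefl).
elim=> {n a b} [u Uu|k q c pq kc IH] b aE.
  case: pp => _ /negP + _; case.
  by apply: (divides_unit Uu); exists b; rewrite aE mulrC.
have [p0 pNu pP] := pp; have [q0 qNu qP] := pq.
have : divides q (p * b) by exists c; rewrite -aE mulrC.
case/qP=> -[d dE]; last first.
  have cE : c = p * d by apply: (mulfI q0); rewrite aE dE; ring.
  have [m km mb] := IH _ cE.
  by exists k => //; rewrite km dE mulrC; apply: prime_product_mul.
exists k => //.
have Ud : d \is a GRing.unit.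
  have : divides p (d * q) by exists 1; rewrite mul1r.
  case/pP=> -[e eE]; last first.
    apply/unitrP; exists e.
    have ed1 : e * d = 1.
      by apply: (mulfI q0); rewrite mulr1 [RHS]eE dE; ring.
    by rewrite [d * e]mulrC.
  case/negP: qNu; apply/unitrP; exists e.
  have eq1 : e * q = 1 by apply: (mulfI p0); rewrite mulr1 [RHS]dE eE; ring.
  by rewrite [q * e]mulrC.
have cE : c = d * b by apply: (mulfI q0); rewrite aE dE; ring.
have -> : b = d^-1 * c by rewrite cE mulKr.
by apply: (@prime_productM 0) => //; apply: prime_product_unit; rewrite unitrV.
Qed.

End Divisibility.

Section Gauss.
Variable A : idomainType.
Hypothesis factA : factorial_ring A.
Implicit Types f g h : {poly A}.

Lemma divides_coef (p : A) f : divides p%:P f -> forall i, divides p f`_i.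
Proof. by move=> [g ->] i; exists g`_i; rewrite coefMC. Qed.

(** Induction on the degrees: if p divides the leading coefficient of a factor,
   then this term may be dropped. *)
Lemma prime_polyC (p : A) : prime_element p -> prime_element p%:P.
Proof.
move=> [p0 pNu pP]; split; first by rewrite polyC_eq0.
  by rewrite poly_unitE coefC /= (negPf pNu) andbF.
suff H : forall n f g, (size f + size g < n)%N -> divides p%:P (f * g) ->
    divides p%:P f \/ divides p%:P g.
  by move=> f g; apply: (H (size f + size g).+1).
elim=> [//|n IH] f g; rewrite ltnS => szle dfg.
have [->|f0] := eqVneq f 0; first by left; exists 0; rewrite mul0r.
have [->|g0] := eqVneq g 0; first by right; exists 0; rewrite mul0r.
have drop f' g' : f' != 0 -> (size f' + size g' <= n)%N ->
    divides p%:P (f' * g') ->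
    divides p (lead_coef f') -> divides p%:P f' \/ divides p%:P g'.
  move=> f'0 sz dfg' [c cE].
  pose t : {poly A} := (c *: 'X^((size f').-1)) * p%:P.
  have tE : t = lead_coef f' *: 'X^((size f').-1).
    by rewrite /t mulrC mul_polyC scalerA [p * c]mulrC -cE.
  have dt : divides p%:P t by exists (c *: 'X^((size f').-1)).
  have sz1 : (size (f' - t)%R < size f')%N.
    rewrite (polySpred f'0) ltnS; apply/leq_sizeP => j hj.
    rewrite coefB tE coefZ coefXn; case: eqP => [->|/eqP jn].
      by rewrite mulr1 subrr.
    rewrite mulr0 subr0 nth_default // (polySpred f'0) ltn_neqAle eq_sym jn.
    by rewrite hj.
  case: (IH (f' - t) g') => //.
  - by apply: leq_trans sz; rewrite ltn_add2r.
  - rewrite mulrBl -mulNr; apply: dividesD => //.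
    by apply: divides_mulr; case: dt => d ->; exists (- d); rewrite mulNr.
  - by move=> d1; left; rewrite -[f'](subrK t); apply: dividesD.
  - by right.
have : divides p (lead_coef f * lead_coef g).
  by rewrite -lead_coefM; exact: divides_coef.
case/pP=> [/(drop _ _ f0 szle dfg)//|].
rewrite mulrC in dfg; rewrite addnC in szle.
by move=> /(drop _ _ g0 szle dfg) []; [right|left].
Qed.

(** Gauss's lemma: a constant on the left is absorbed into the two factors on
   the right, one prime at a time. *)
Lemma cancel_constant (c : A) f g h : c != 0 -> c%:P * f = g * h ->
  exists a b g1 h1, [/\ g = a%:P * g1, h = b%:P * h1, f = g1 * h1,
                        a != 0 & b != 0].
Proof.
move=> /factA[n nc]; elim: nc f g h => [u Uu|k p a pp _ IH] f g h E.
  exists u, 1, (u^-1%:P * g), h; split; rewrite ?mul1r ?oner_eq0 //.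
  - by rewrite mulrA -polyCM mulrV // mul1r.
  - by rewrite -mulrA -E mulrA -polyCM mulVr // mul1r.
  - by apply: contraTneq Uu => ->; rewrite unitr0.
have [p0P _ pP] := prime_polyC pp; have [p0 _ _] := pp.
have E' : p%:P * (a%:P * f) = g * h by rewrite -E polyCM mulrA.
have : divides p%:P (g * h) by exists (a%:P * f); rewrite -E' mulrC.
case/pP=> -[d dE].
  have : a%:P * f = d * h.
    by apply: (mulfI p0P); rewrite E' dE; ring.
  case/IH=> [a1 [b1 [g1 [h1 [d1 -> -> a10 b10]]]]].
  exists (p * a1), b1, g1, h1; split; rewrite ?mulf_neq0 //.
  by rewrite dE d1 polyCM; ring.
have : a%:P * f = g * d.
  by apply: (mulfI p0P); rewrite E' dE; ring.
case/IH=> [a1 [b1 [g1 [h1 [-> d1 -> a10 b10]]]]].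
exists a1, (p * b1), g1, h1; split; rewrite ?mulf_neq0 //.
by rewrite dE d1 polyCM; ring.
Qed.

Definition primitive f := forall p : A, prime_element p -> ~ divides p%:P f.

(** Prime constants can be divided out of f only as often as its leading
   coefficient has prime factors. *)
Lemma content f : f != 0 ->
  exists c f0, [/\ c != 0, f = c%:P * f0 & primitive f0].
Proof.
move=> f0; have lf0 : lead_coef f != 0 by rewrite lead_coef_eq0.
have [n {lf0}] := factA lf0.
elim: n f f0 => [|n IH] f f0 nf.
  exists 1, f; rewrite oner_eq0 mul1r; split=> // p pp [g gE].
  have [|m //] := @prime_product_cancel _ p (lead_coef g) 0 pp.
  by move: nf; rewrite gE lead_coefM lead_coefC mulrC.
have [[p pp [g gE]]|np] := pselect (exists2 p, prime_element p & divides p%:P f);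
  last first.
  exists 1, f; rewrite oner_eq0 mul1r; split=> // p pp dpf.
  by apply: np; exists p.
have g0 : g != 0 by apply: contraNneq f0 => g0; rewrite gE g0 mul0r.
have [|m [<-] mg] := @prime_product_cancel _ p (lead_coef g) n.+1 pp.
  by move: nf; rewrite gE lead_coefM lead_coefC mulrC.
have [c [h [c0 gh hp]]] := IH _ g0 mg.
exists (p * c), h; split=> //; first by case: pp => ? _ _; rewrite mulf_neq0.
by rewrite gE gh polyCM; ring.
Qed.

Lemma prime_product_primitive b g h n : primitive (g * b%:P * h) ->
  prime_product n b -> b \is a GRing.unit.
Proof.
move=> prim nb; case: nb prim => // {n}n p a pp _ prim; case: (prim p pp).
by exists (g * a%:P * h); rewrite polyCM; ring.
Qed.

Lemma primitive_cancel (c : A) f g : c != 0 -> primitive f ->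
  divides f (c%:P * g) -> divides f g.
Proof.
move=> c0 prim [h E].
have [a [b [h1 [f1 [hE fE gE a0 b0]]]]] := cancel_constant c0 E.
have [n nb] := factA b0.
have Ub : b \is a GRing.unit.
  by apply: (@prime_product_primitive b 1 f1) nb; rewrite mul1r -fE.
have f1E : f1 = b^-1%:P * f by rewrite fE mulrA -polyCM mulVr // mul1r.
by exists (h1 * b^-1%:P); rewrite gE f1E mulrA.
Qed.

(** Let m be the gcd of f and g up to constants. By irreducibility either f is m
   up to a constant, and then f divides g; or m is a constant, and the Bezout
   relation for f and g, times h, shows that f divides a constant multiple of h,
   hence h. *)
Lemma primitive_irreducible_prime f : primitive f -> (1 < size f)%N ->
  (forall g h, f = g * h -> (size g <= 1)%N \/ (size h <= 1)%N) ->
  prime_element f.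
Proof.
move=> prim szf irr.
have f0 : f != 0 by rewrite -size_poly_gt0; apply: ltnW.
split=> //.
  by rewrite poly_unitE; apply/negP => /andP[/eqP szf1]; rewrite szf1 in szf.
move=> g h dfgh.
pose m := gcdp f g.
have [[u v] /= ] := Pdiv.Idomain.Bezoutp f g.
move/Pdiv.Idomain.eqpP=> [[c1 c2] /andP /= [c10 c20] bez].
have /Pdiv.Idomain.dvdpP [[c q] /= c0 cE] := Pdiv.Idomain.dvdp_gcdl f g.
have /Pdiv.Idomain.dvdpP [[c' q'] /= c'0 c'E] := Pdiv.Idomain.dvdp_gcdr f g.
rewrite -!mul_polyC -/m in bez cE c'E.
have [a [b [q1 [m1 [qE mE fE a0 b0]]]]] := cancel_constant c0 cE.
have [n nb] := factA b0.
case: (irr _ _ fE) => [/size1_polyC q1E|/size1_polyC m1E].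
  left; apply: (primitive_cancel c'0 prim).
  rewrite c'E mE; apply: divides_mull; apply: divides_mull.
  have q10 : q1`_0 != 0.
    by apply: contraNneq f0 => q10; rewrite fE q1E q10 mul0r.
  have [k kq] := factA q10.
  have Uq : q1`_0 \is a GRing.unit.
    by apply: (@prime_product_primitive _ 1 m1) kq; rewrite mul1r -q1E -fE.
  exists (q1`_0)^-1%:P.
  have {}fE : f = (q1`_0)%:P * m1 by rewrite fE {1}q1E.
  by rewrite fE mulrA -polyCM mulVr // mul1r.
right.
have m10 : m1`_0 != 0.
  by apply: contraNneq f0 => m10; rewrite fE m1E m10 mulr0.
apply: (@primitive_cancel (c2 * (b * m1`_0))) => //.
  by rewrite !mulf_neq0.
rewrite !polyCM -m1E -mE -bez.
rewrite (_ : _ * h = c1%:P * (u * h) * f + c1%:P * v * (g * h)); last by ring.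
apply: dividesD; first by exists (c1%:P * (u * h)).
exact: divides_mull.
Qed.

Lemma prime_product_polyC n (a : A) : prime_product n a ->
  prime_product n a%:P.
Proof.
elim=> [u Uu|k p b pp _ IH].
  have u0 : u != 0 by apply: contraTneq Uu => ->; rewrite unitr0.
  by apply: prime_product_unit; rewrite poly_unitE size_polyC coefC u0.
by rewrite polyCM; apply: prime_product_mul => //; apply: prime_polyC.
Qed.

(** A primitive polynomial is prime or splits into two of smaller degree. *)
Lemma factorial_poly : factorial_ring {poly A}.
Proof.
suff H n f : (size f <= n)%N -> f != 0 -> exists k, prime_product k f.
  by move=> f; apply: H.
elim: n f => [|n IH] f szf f0.
  by move: f0; rewrite -size_poly_leq0 szf.
have [c [g [c0 fE prim]]] := content f0.
have [k kc] := factA c0.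
suff [l lg] : exists l, prime_product l g.
  by exists (k + l)%N; rewrite fE; apply: prime_productM => //;
     apply: prime_product_polyC.
have g0 : g != 0 by apply: contraNneq f0 => g0; rewrite fE g0 mulr0.
have szg : (size g <= n.+1)%N by move: szf; rewrite fE mul_polyC size_scale.
have [szg1|szg1] := leqP (size g) 1.
  have gE := size1_polyC szg1.
  have : g`_0 != 0 by rewrite -polyC_eq0 -gE.
  by case/factA=> l lg; exists l; rewrite gE; apply: prime_product_polyC.
have [irr|] := pselect (forall p q, g = p * q ->
                          (size p <= 1)%N \/ (size q <= 1)%N).
  exists 1%N; rewrite -[g]mulr1; apply: prime_product_mul.
    exact: primitive_irreducible_prime.
  by apply: prime_product_unit; rewrite unitr1.
move=> /existsNP[p] /existsNP[q] /not_implyP[gE] /not_orP[/negP szp /negP szq].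
rewrite -!ltnNge in szp szq.
have p0 : p != 0 by rewrite -size_poly_gt0; apply: ltnW.
have q0 : q != 0 by rewrite -size_poly_gt0; apply: ltnW.
have szE := size_mul p0 q0; rewrite -gE in szE.
have [||i ip] := IH p => //; first by move: szE szp szq szg; lia.
have [||j jq] := IH q => //; first by move: szE szp szq szg; lia.
by exists (i + j)%N; rewrite gE; apply: prime_productM.
Qed.

(** Over the fraction field of A the greatest common divisor of f and g is a constant,
   for f is prime and does not divide g; c is the denominator of a Bezout relation. *)
Lemma prime_elimination f g : prime_element f -> (1 < size f)%N ->
  ~ divides f g -> exists u v c, c != 0 /\ u * f + v * g = c%:P.
Proof.
move=> [f0 _ fP] szf ndfg; pose m := gcdp f g.
have [[u v] /= ] := Pdiv.Idomain.Bezoutp f g.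
move/Pdiv.Idomain.eqpP=> [[c1 c2] /andP /= [c10 c20] bez].
have /Pdiv.Idomain.dvdpP [[c q] /= c0 cE] := Pdiv.Idomain.dvdp_gcdl f g.
have /Pdiv.Idomain.dvdpP [[c' q'] /= c'0 c'E] := Pdiv.Idomain.dvdp_gcdr f g.
rewrite -!mul_polyC -/m in bez cE c'E.
have notconst d : d != 0 -> ~ divides f d%:P.
  move=> d0 [e eE].
  have e0 : e != 0.
    by apply: contraNneq d0 => e0; rewrite -polyC_eq0 eE e0 mul0r.
  have := size_mul e0 f0; rewrite -eE size_polyC d0.
  by move: szf; rewrite -size_poly_gt0 in e0; lia.
have : divides f (q * m) by exists c%:P.
case/fP=> [[q2 q2E]|[m2 m2E]]; last first.
  have : divides f (c'%:P * g) by rewrite c'E m2E; exists (q' * m2); ring.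
  by case/fP=> // /(notconst _ c'0).
have szm : (size m <= 1)%N.
  have E : c%:P = q2 * m by apply: (mulIf f0); rewrite cE q2E; ring.
  have q20 : q2 != 0.
    by apply: contraNneq c0 => e0; rewrite -polyC_eq0 E e0 mul0r.
  have m0 : m != 0.
    by apply: contraNneq c0 => e0; rewrite -polyC_eq0 E e0 mulr0.
  have := size_mul q20 m0; rewrite -E size_polyC c0.
  by rewrite -size_poly_gt0 in q20; lia.
have m0 : m != 0 by rewrite gcdp_eq0 negb_and f0.
exists (c1%:P * u), (c1%:P * v), (c2 * m`_0); split.
  by rewrite mulf_neq0 // -polyC_eq0 -(size1_polyC szm).
rewrite polyCM -(size1_polyC szm) -bez; ring.
Qed.

End Gauss.

(** * Polynomials in several variables *)

Section Transport.
Variables (A B : idomainType).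
Variables (f : {rmorphism A -> B}) (g : {rmorphism B -> A}).
Hypotheses (fK : cancel f g) (gK : cancel g f).

Lemma prime_element_iso p : prime_element p -> prime_element (f p).
Proof.
move=> [p0 pNu pP]; split.
- by apply: contraNneq p0 => fp0; rewrite -(fK p) fp0 rmorph0.
- by apply: contra pNu => fpu; rewrite -(fK p) rmorph_unit.
- move=> a b [c cE].
  have : divides p (g a * g b).
    by exists (g c); rewrite -rmorphM cE rmorphM fK.
  case/pP=> -[d dE]; [left|right]; exists (f d); rewrite -rmorphM -dE gK //.
Qed.

Lemma factorial_ring_iso : factorial_ring A -> factorial_ring B.
Proof.
move=> factA b b0.
have [n ng] : exists n, prime_product n (g b).
  by apply: factA; apply: contraNneq b0 => gb0; rewrite -(gK b) gb0 rmorph0.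
exists n; rewrite -(gK b); elim: ng => [u Uu|k p a pp _ IH].
  by apply: prime_product_unit; rewrite rmorph_unit.
by rewrite rmorphM; apply: prime_product_mul => //; apply: prime_element_iso.
Qed.

End Transport.

Section One_variable_apart.
Variables (R : fieldType) (n : nat).

Lemma mpoly_morph_ext (B : comNzRingType) (f g : {rmorphism mpoly n R -> B}) :
  (forall c, f (mpolyC n c) = g (mpolyC n c)) ->
  (forall i, f (mpolyX R (mnm1 i)) = g (mpolyX R (mnm1 i))) -> f =1 g.
Proof.
move=> fgC fgX; elim/mpolyind=> [|c m p _ _ IH]; first by rewrite !rmorph0.
rewrite !rmorphD IH -mul_mpolyC !rmorphM fgC; congr (_ * _ + _).
rewrite mpolyXE_id !rmorph_prod; apply: eq_bigr => i _.
by rewrite !rmorphXn /= fgX.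
Qed.

End One_variable_apart.

Section Elimination.
Variables (R : fieldType) (n : nat) (i : 'I_n.+1).

(** The variable i becomes the variable of a polynomial whose coefficients are
   polynomials in the other ones. *)
Definition isolate : mpoly n.+1 R -> {poly (mpoly n R)} :=
  mmap (polyC \o @mpolyC n R)
    (fun j => if unlift i j is Some k then (mpolyX R (mnm1 k))%:P else 'X).

Definition insert_var : mpoly n R -> mpoly n.+1 R :=
  mmap (@mpolyC n.+1 R) (fun k => mpolyX R (mnm1 (lift i k))).

HB.instance Definition _ := GRing.RMorphism.on insert_var.
HB.instance Definition _ := GRing.RMorphism.on isolate.

Lemma insert_var_comm : commr_rmorph insert_var (mpolyX R (mnm1 i)).
Proof. by move=> x; apply: mulrC. Qed.

Definition merge : {poly (mpoly n R)} -> mpoly n.+1 R :=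
  horner_morph insert_var_comm.

HB.instance Definition _ := GRing.RMorphism.on merge.

Lemma isolateC c : isolate (mpolyC n.+1 c) = (mpolyC n c)%:P.
Proof. by rewrite /isolate mmapC. Qed.

Lemma isolateX j : isolate (mpolyX R (mnm1 j)) =
  if unlift i j is Some k then (mpolyX R (mnm1 k))%:P else 'X.
Proof. by rewrite /isolate mmapX mmap1U. Qed.

Lemma mergeC p : merge p%:P = insert_var p.
Proof. by rewrite /merge horner_morphC. Qed.

Lemma isolateK : cancel isolate merge.
Proof.
move=> p; rewrite -[RHS]/(idfun p).
apply: (mpoly_morph_ext (f := merge \o isolate) (g := idfun)) => [c|j] /=.
  by rewrite isolateC mergeC /insert_var mmapC.
rewrite isolateX; case: unliftP => [k ->|->].
  by rewrite mergeC /insert_var mmapX mmap1U.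
by rewrite /merge horner_morphX.
Qed.

Lemma isolate_insert p : isolate (insert_var p) = p%:P.
Proof.
apply: (mpoly_morph_ext (f := isolate \o insert_var) (g := polyC)) => [c|j] /=.
  by rewrite /insert_var mmapC isolateC.
by rewrite /insert_var mmapX mmap1U isolateX liftK.
Qed.

Lemma mergeK : cancel merge isolate.
Proof.
elim/poly_ind => [|p c IH]; first by rewrite !rmorph0.
rewrite !rmorphD !rmorphM /= IH mergeC isolate_insert.
by rewrite /merge horner_morphX isolateX unlift_none.
Qed.

Lemma merge_combination u v (f g : mpoly n.+1 R) :
  merge (u * isolate f + v * isolate g) = merge u * f + merge v * g.
Proof.
have mE w (h : mpoly n.+1 R) : merge (w * isolate h) = merge w * h.
  by rewrite rmorphM /= isolateK.
by rewrite rmorphD; congr (_ + _); apply: mE.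
Qed.

Lemma mderiv_insert p : mderiv i (insert_var p) = 0.
Proof.
elim/mpolyind: p => [|c m p _ _ IH]; first by rewrite rmorph0 mderiv0.
rewrite rmorphD mderivD IH addr0 -mul_mpolyC rmorphM /=.
rewrite {1}/insert_var mmapC mderiv_mulC /insert_var mmapX /mmap1.
apply/eqP; rewrite mulf_eq0; apply/orP; right; apply/eqP.
apply: (big_ind (fun q => mderiv i q = 0)).
- by rewrite -mpolyC1 mderivC.
- by move=> x y hx hy; rewrite mderivM hx hy mulr0 mul0r addr0.
move=> k _; elim: (m k) => [|e IHe]; first by rewrite expr0 -mpolyC1 mderivC.
rewrite exprS mderivM IHe mulr0 addr0 mderivX mnm1E.
by rewrite eq_sym (negPf (neq_lift _ _)) scale0r mul0r.
Qed.

End Elimination.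

Lemma factorial_mpoly (R : fieldType) n : factorial_ring (mpoly n R).
Proof.
elim: n => [|n IH].
  move=> p p0; exists 0%N; apply: prime_product_unit.
  have pE : p = mpolyC 0 (mcoeff mnm0 p).
    apply: msize1_polyC; rewrite msizeE.
    by apply/bigmax_leqP_seq => m _ _; rewrite mdegE big_ord0.
  rewrite pE; apply: rmorph_unit; rewrite unitfE.
  by apply: contraNneq p0 => c0; rewrite pE c0 mpolyC0.
apply: (factorial_ring_iso (@mergeK R n ord0) (@isolateK R n ord0)).
exact: factorial_poly.
Qed.

(** * Irreducible polynomials in three variables *)

Section Prime_surfaces.
Variable R : realType.
Implicit Types F G H : poly3 R.

Lemma msize_le1P F : (msize F <= 1)%N -> F = mpolyC 3 (mcoeff mnm0 F).
Proof. exact: msize1_polyC. Qed.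

Lemma irreducible3_neq0 F : irreducible3 F -> F != 0.
Proof. by case=> szF _; apply: contraTneq szF => ->; rewrite msize0. Qed.

Lemma msize_le1_unit F : F != 0 -> (msize F <= 1)%N -> F \is a GRing.unit.
Proof.
move=> F0 /msize_le1P FE; rewrite FE; apply: rmorph_unit; rewrite unitfE.
by apply: contraNneq F0 => c0; rewrite FE c0 mpolyC0.
Qed.

Lemma unit_msize_le1 F : F \is a GRing.unit -> (msize F <= 1)%N.
Proof. by move=> /andP[/eqP-> _]; rewrite msizeC; case: eqP. Qed.

(** An irreducible product of primes has a single factor. *)
Lemma irreducible3_prime F : irreducible3 F -> prime_element F.
Proof.
move=> irrF; have F0 := irreducible3_neq0 irrF; have [szF irr] := irrF.
have [n nF] := factorial_mpoly F0.
case: nF irr szF {irrF F0} => [u uU|m p a pp ma] irr szF.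
  by move: (unit_msize_le1 uU); rewrite leqNgt szF.
have [p0 pNu pP] := pp.
have a0 : a != 0 by apply: contraTneq szF => ->; rewrite mulr0 msize0.
have [sz1|sz1] := irr _ _ erefl.
  by case/negP: pNu; apply: msize_le1_unit.
have Ua := msize_le1_unit a0 sz1.
split; first by rewrite mulf_neq0.
  by rewrite unitrM negb_and pNu.
have dpa b : divides p b -> divides (p * a) b.
  by case=> c ->; exists (c * a^-1); rewrite mulrACA mulVr // mulr1.
move=> b c [d dE].
have /pP[/dpa pb|/dpa pc] : divides p (b * c) by exists (d * a); rewrite dE; ring.
  by left.
by right.
Qed.

(** F depends on the variable i and is prime, so that F and G are coprime over the
   field of rational functions of the other variables; r is the denominator of a
   Bezout relation. *)
Lemma eliminate F G i : prime_element F -> mderiv i F != 0 ->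
  ~ divides F G ->
  exists u v r, [/\ r != 0, mderiv i r = 0 & u * F + v * G = r].
Proof.
move=> Fprime dF nFG.
have isoK := @isolateK R 2 i.
have merK := @mergeK R 2 i.
have isoprime : prime_element (isolate i F) by apply: (prime_element_iso isoK merK).
have szF : (1 < size (isolate i F))%N.
  rewrite ltnNge; apply: contraNN dF => /size1_polyC isoFE.
  by rewrite -(isoK F) isoFE mergeC mderiv_insert.
have nisoFG : ~ divides (isolate i F) (isolate i G).
  case=> c cE; apply: nFG; exists (merge i c).
  by rewrite -(isoK G) cE rmorphM /= isoK.
have [u [v [c [c0 uvc]]]] :=
  prime_elimination isoprime szF nisoFG.
exists (merge i u), (merge i v), (insert_var i c); split.
- apply: contraNneq c0 => ic0.
  by rewrite -polyC_eq0 -(isolate_insert i) ic0 rmorph0.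
- exact: mderiv_insert.
have -> : insert_var i c = merge i (u * isolate i F + v * isolate i G).
  by rewrite uvc mergeC.
exact: esym (merge_combination i u v F G).
Qed.

Lemma mderiv_const F : (forall i, mderiv i F = 0) -> (msize F <= 1)%N.
Proof.
move=> dF; suff -> : F = mpolyC 3 (mcoeff mnm0 F) by rewrite msizeC; case: eqP.
apply/mpolyP => m; rewrite mcoeffC.
have [->|m0] := eqVneq m mnm0; first by rewrite mulr1.
rewrite mulr0.
have [i mi] : exists i, m i != 0%N.
  apply/existsP; apply: contraR m0; rewrite negb_exists => /forallP m0.
  by apply/eqP/mnmP => i; rewrite mnm0E; apply/eqP; have := m0 i; rewrite negbK.
have := mcoeff_mderiv i F (mnm_sub m (mnm1 i)).
rewrite dF mcoeff0 submK; last first.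
  by apply/mnm_lepP => j; rewrite mnm1E; case: eqP => // <-; rewrite lt0n.
move/esym/eqP; rewrite mulrn_eq0 => /orP[//|/eqP //].
Qed.

Lemma nonconst_mderiv F : (1 < msize F)%N -> exists i, mderiv i F != 0.
Proof.
move=> szF; apply: contrapT => nex; move: szF; rewrite ltnNge mderiv_const // => i.
by apply/eqP; apply: contrapT => /negP ne; apply: nex; exists i.
Qed.

Lemma msize_mderiv i F : F != 0 -> (msize (mderiv i F) < msize F)%N.
Proof.
rewrite -msize_poly_eq0 -lt0n => sz; apply: (@leq_ltn_trans (msize F).-1).
  rewrite msizeE; apply/bigmax_leqP_seq => m + _.
  rewrite mcoeff_msupp mcoeff_mderiv => nz.
  have : mnm_add m (mnm1 i) \in msupp F.
    by rewrite mcoeff_msupp; apply: contraNneq nz => ->; rewrite mul0rn.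
  by move/msize_mdeg_lt; rewrite mdegD mdeg1 addn1 => lt; rewrite -ltnS prednK.
by rewrite prednK.
Qed.

End Prime_surfaces.

(** * Coordinates and the chain rule *)

(** The principle of induction that suits evaluation and differentiation: both are
   known on constants and variables, and compatible with sums and products. *)
Lemma mpoly_closed (R : fieldType) n (P : mpoly n R -> Prop) :
  (forall c, P (mpolyC n c)) -> (forall i, P (mpolyX R (mnm1 i))) ->
  (forall p q, P p -> P q -> P (p + q)) ->
  (forall p q, P p -> P q -> P (p * q)) -> forall p, P p.
Proof.
move=> PC PX PD PM; elim/mpolyind=> [|c m p _ _ Pp].
  by rewrite -(mpolyC0 n R).
apply: (PD) => //; rewrite -mul_mpolyC; apply: (PM) => //; rewrite mpolyXE_id.
apply: big_ind => [|x y Px Py|i _]; [by rewrite -mpolyC1|exact: PM|].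
elim: (m i) => [|e IHe]; first by rewrite expr0 -mpolyC1.
by rewrite exprS; apply: PM.
Qed.

Section Coordinates.
Variable R : realType.
Implicit Types (a b c p : space3 R) (M : 'M[R]_3).

Lemma ord3P (P : 'I_3 -> Prop) : P i0 -> P i1 -> P i2 -> forall i, P i.
Proof.
move=> P0 P1 P2 [[|[|[|//]]] lt]; [move: P0|move: P1|move: P2];
by congr P; apply/val_inj; rewrite /= inordK.
Qed.

Lemma sum3 (V : nmodType) (f : 'I_3 -> V) : \sum_i f i = f i0 + f i1 + f i2.
Proof.
rewrite !big_ord_recl big_ord0 addr0 addrA.
by congr (f _ + f _ + f _); apply/val_inj; rewrite /= inordK.
Qed.

Lemma vecE (x y z : R) : ((vec x y z i0 0 = x) * (vec x y z i1 0 = y) *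
  (vec x y z i2 0 = z))%type.
Proof. by rewrite !mxE !inordK. Qed.

Lemma matE (x1 x2 x3 y1 y2 y3 z1 z2 z3 : R) :
  let A := mat [:: [:: x1; x2; x3]; [:: y1; y2; y3]; [:: z1; z2; z3]] in
  ((A i0 i0 = x1) * (A i0 i1 = x2) * (A i0 i2 = x3) *
   (A i1 i0 = y1) * (A i1 i1 = y2) * (A i1 i2 = y3) *
   (A i2 i0 = z1) * (A i2 i1 = z2) * (A i2 i2 = z3))%type.
Proof. by rewrite /= !mxE !inordK. Qed.

Lemma vec_ext a b : a i0 0 = b i0 0 -> a i1 0 = b i1 0 -> a i2 0 = b i2 0 ->
  a = b.
Proof. by move=> *; apply/colP; apply: ord3P. Qed.

Lemma vec_eta p : p = vec (p i0 0) (p i1 0) (p i2 0).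
Proof. by apply: vec_ext; rewrite vecE. Qed.

Lemma vec0E : 0 = vec 0 0 0 :> space3 R.
Proof. by rewrite [LHS]vec_eta !mxE. Qed.

Lemma vec_inj (x y z x' y' z' : R) : vec x y z = vec x' y' z' ->
  [/\ x = x', y = y' & z = z'].
Proof.
move=> E; have E' i := congr1 (fun v : space3 R => v i 0) E.
by move: (E' i0) (E' i1) (E' i2); rewrite !vecE.
Qed.

Lemma dotE a b :
  dot a b = a i0 0 * b i0 0 + a i1 0 * b i1 0 + a i2 0 * b i2 0.
Proof. exact: sum3. Qed.

Lemma mul3E m (M : 'M[R]_(m, 3)) n (N : 'M[R]_(3, n)) i j :
  (M *m N) i j = M i i0 * N i0 j + M i i1 * N i1 j + M i i2 * N i2 j.
Proof. by rewrite mxE sum3. Qed.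

Lemma dot_mulmx a b : dot a b = (a^T *m b) 0 0.
Proof. by rewrite mul3E !mxE dotE. Qed.

Lemma dot_trmx M a b : dot (M *m a) b = dot a (M^T *m b).
Proof. by rewrite !dot_mulmx trmx_mul mulmxA. Qed.

Lemma dot_ge0 a : 0 <= dot a a.
Proof. by rewrite dotE !addr_ge0 // -expr2 sqr_ge0. Qed.

Lemma dot_eq0 a : (dot a a == 0) = (a == 0).
Proof.
apply/eqP/eqP => [|->]; last by rewrite dotE !mxE !mul0r !addr0.
rewrite dotE -!expr2 => a0; apply: vec_ext; rewrite mxE; nra.
Qed.

Lemma det_mat x1 x2 x3 y1 y2 y3 z1 z2 z3 :
  \det (@mat R [:: [:: x1; x2; x3]; [:: y1; y2; y3]; [:: z1; z2; z3]]) =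
  x1 * (y2 * z3 - y3 * z2) - x2 * (y1 * z3 - y3 * z1) +
  x3 * (y1 * z2 - y2 * z1).
Proof.
rewrite (expand_det_row _ ord0) !big_ord_recl big_ord0 /cofactor.
rewrite !(expand_det_row _ ord0) !big_ord_recl !big_ord0 /cofactor !det_mx11.
rewrite !mxE /= /bump /= ?(exprS, expr0); ring.
Qed.

Lemma mat_eta M : M = mat [:: [:: M i0 i0; M i0 i1; M i0 i2];
  [:: M i1 i0; M i1 i1; M i1 i2]; [:: M i2 i0; M i2 i1; M i2 i2]].
Proof.
by apply/matrixP; apply: ord3P; apply: ord3P; rewrite matE.
Qed.

Lemma det3E a b c : det3 a b c = dot a (cross b c).
Proof.
rewrite /det3 (mat_eta (\matrix_(_, _) _)) det_mat dotE !vecE !mxE !inordK //=.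
ring.
Qed.

End Coordinates.

Section Calculus.
Variable R : realType.
Implicit Types (F G : poly3 R) (p d : space3 R).

Definition ev F p : R := meval (fun i => p i 0) F.
Definition grad F p : space3 R := \col_i ev (mderiv i F) p.
Definition hess F p : 'M[R]_3 := \matrix_(i, j) ev (mderiv j (mderiv i F)) p.

Lemma hess_sym F p : (hess F p)^T = hess F p.
Proof. by apply/matrixP => i j; rewrite !mxE mderiv_comm. Qed.

Lemma evD F G p : ev (F + G) p = ev F p + ev G p. Proof. exact: mevalD. Qed.
Lemma evB F G p : ev (F - G) p = ev F p - ev G p. Proof. exact: mevalB. Qed.
Lemma evM F G p : ev (F * G) p = ev F p * ev G p. Proof. exact: mevalM. Qed.
Lemma evC c p : ev (mpolyC 3 c) p = c. Proof. exact: mevalC. Qed.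
Lemma evX i p : ev (mpolyX R (mnm1 i)) p = p i 0. Proof. exact: mevalXU. Qed.
Lemma ev0 p : ev 0 p = 0. Proof. exact: meval0. Qed.
Lemma ev_sum n (f : 'I_n -> poly3 R) p : ev (\sum_i f i) p = \sum_i ev (f i) p.
Proof. exact: raddf_sum. Qed.

Lemma gradM F G p : grad (F * G) p = ev G p *: grad F p + ev F p *: grad G p.
Proof. by apply/colP => i; rewrite !mxE mderivM evD !evM mulrC. Qed.

Lemma gradD F G p : grad (F + G) p = grad F p + grad G p.
Proof. by apply/colP => i; rewrite !mxE mderivD evD. Qed.

Lemma gradC c p : grad (mpolyC 3 c) p = 0.
Proof. by apply/colP => i; rewrite !mxE mderivC ev0. Qed.

Lemma grad_subC F c p : grad (F - mpolyC 3 c) p = grad F p.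
Proof. by rewrite -mpolyCN gradD gradC addr0. Qed.

Lemma hessC c p : hess (mpolyC 3 c) p = 0.
Proof. by apply/matrixP => i j; rewrite !mxE mderivC mderiv0 ev0. Qed.

Lemma mderiv_var i j : mderiv i (mpolyX R (mnm1 j)) = mpolyC 3 (i == j)%:R.
Proof.
rewrite mderivX mnm1E eq_sym; case: eqP => [->|_]; last by rewrite scale0r mpolyC0.
by rewrite scale1r -[X in mnm_sub X _]add0m addmK mpolyX0 mpolyC1.
Qed.

Lemma ev_chain (V : normedModType R) (f : V -> space3 R) w v d F :
  (forall i, is_derive w v (fun q => f q i 0) (d i 0)) ->
  is_derive w v (fun q => ev F (f q)) (dot (grad F (f w)) d).
Proof.
move=> fd; elim/mpoly_closed: F => [c|i|F G IF IG|F G IF IG].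
- rewrite (_ : (fun q => _) = cst c); last by apply/funext => q; rewrite evC.
  apply: (is_derive_eq (is_derive_cst c w v)).
  by rewrite gradC dotE !mxE !mul0r !addr0.
- rewrite (_ : (fun q => _) = (fun q => f q i 0)); last first.
    by apply/funext => q; rewrite evX.
  apply: (is_derive_eq (fd i)); rewrite /dot (bigD1 i) //= big1 ?addr0 => [|j ji].
    by rewrite mxE mderiv_var eqxx evC mul1r.
  by rewrite mxE mderiv_var (negPf ji) evC mul0r.
- rewrite (_ : (fun q => _) = (fun q => ev F (f q)) + (fun q => ev G (f q)));
    last by apply/funext => q; rewrite evD.
  by apply: (is_derive_eq (is_deriveD IF IG)); rewrite gradD !dotE !mxE; ring.
- rewrite (_ : (fun q => _) = (fun q => ev F (f q)) * (fun q => ev G (f q)));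
    last by apply/funext => q; rewrite evM.
  apply: (is_derive_eq (is_deriveM IF IG)).
  by rewrite gradM !dotE !mxE /GRing.scale /=; ring.
Qed.

Lemma ev_chain_vec (V : normedModType R) (f : V -> space3 R) w v F :
  derivable f w v ->
  is_derive w v (fun q => ev F (f q)) (dot (grad F (f w)) ('D_v f w)).
Proof.
move=> df; apply: ev_chain => i; move/derivable_mxP: (df) => /(_ i 0) dfi.
by rewrite derive_mx // mxE; apply: derivableP.
Qed.

End Calculus.

(** * Vector algebra *)

Section Vectors.
Variable R : realType.
Implicit Types (a b c d g n v w : space3 R) (M : 'M[R]_3) (k : R).

Lemma dotC a b : dot a b = dot b a.
Proof. by rewrite !dotE; ring. Qed.

Lemma dotZl k a b : dot (k *: a) b = k * dot a b.
Proof. by rewrite !dotE !mxE; ring. Qed.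

Lemma dotZr k a b : dot a (k *: b) = k * dot a b.
Proof. by rewrite !dotE !mxE; ring. Qed.

Lemma dotDl a b c : dot (a + b) c = dot a c + dot b c.
Proof. by rewrite !dotE !mxE; ring. Qed.

Lemma dotDr a b c : dot a (b + c) = dot a b + dot a c.
Proof. by rewrite !dotE !mxE; ring. Qed.

Lemma dot0l a : dot 0 a = 0.
Proof. by rewrite dotE !mxE; ring. Qed.

Lemma dot_cross_cross a b c d :
  dot (cross a b) (cross c d) = dot a c * dot b d - dot a d * dot b c.
Proof. by rewrite !dotE /cross !vecE; ring. Qed.

Lemma dot_crossl a b : dot a (cross a b) = 0.
Proof. by rewrite dotE /cross !vecE; ring. Qed.

Lemma crossZl k a b : cross (k *: a) b = k *: cross a b.
Proof. by apply: vec_ext; rewrite /cross !(vecE, mxE) ?vecE; ring. Qed.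

Lemma crossDl a b c : cross (a + b) c = cross a c + cross b c.
Proof. by apply: vec_ext; rewrite /cross !(vecE, mxE) ?vecE; ring. Qed.

Lemma crossC a b : cross a b = - cross b a.
Proof. by apply: vec_ext; rewrite /cross !(vecE, mxE) ?vecE; ring. Qed.

Lemma crossv a : cross a a = 0.
Proof. by apply: vec_ext; rewrite /cross !(vecE, mxE) ?vecE; ring. Qed.

Lemma crossZr k a b : cross a (k *: b) = k *: cross a b.
Proof. by rewrite crossC crossZl -scalerN -crossC. Qed.

Lemma cross0 a : cross 0 a = 0.
Proof. by apply: vec_ext; rewrite /cross !(vecE, mxE) ?vecE; ring. Qed.

(** Read through the cross product, the exterior square of M is its cofactor
   matrix. *)
Lemma mulmx_cross M a b : M^T *m cross (M *m a) (M *m b) = \det M *: cross a b.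
Proof.
rewrite [M in \det M]mat_eta det_mat.
by apply: vec_ext; rewrite [RHS]mxE mul3E /cross !vecE !mul3E ![M^T _ _]mxE; ring.
Qed.

Lemma det3_mulmx M a b c :
  dot (M *m a) (cross (M *m b) (M *m c)) = \det M * dot a (cross b c).
Proof. by rewrite dot_trmx mulmx_cross dotZr. Qed.

Lemma dot_delta i v : dot (delta_mx i 0) v = v i 0.
Proof.
rewrite /dot (bigD1 i) //= big1 ?addr0 => [|j ji]; rewrite !mxE ?eqxx ?mul1r //.
by rewrite (negPf ji) mul0r.
Qed.

Lemma dot_ext v w : (forall d, dot d v = dot d w) -> v = w.
Proof. by move=> vw; apply/colP => i; rewrite -!dot_delta. Qed.

Lemma exists_coord a : a != 0 -> exists i, a i 0 != 0.
Proof.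
move=> a0; apply/existsP; apply: contraR a0; rewrite negb_exists => /forallP h.
by apply/eqP/colP => i; rewrite [RHS]mxE; apply/eqP; have := h i; rewrite negbK.
Qed.

Lemma parallel_scale g n : n != 0 ->
  (forall i j, g i 0 * n j 0 = g j 0 * n i 0) -> exists k, g = k *: n.
Proof.
move=> /exists_coord[i ni] gn; exists (g i 0 / n i 0).
apply/colP => j; rewrite mxE mulrAC gn -mulrA mulfV //.
by rewrite mulr1.
Qed.

Lemma cross_eq0_scale a b : b != 0 -> cross a b = 0 -> exists k, a = k *: b.
Proof.
move=> b0 ab; apply: parallel_scale b0 _ => j l; move: ab.
rewrite /cross vec0E => /vec_inj[c0 c1 c2].
by elim/ord3P: j; elim/ord3P: l; lra.
Qed.

Lemma is_derive_dot (V : normedModType R) (f g : V -> space3 R) (w v : V) (df dg : space3 R) :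
  (forall i, is_derive w v (fun q => f q i 0) (df i 0)) ->
  (forall i, is_derive w v (fun q => g q i 0) (dg i 0)) ->
  is_derive w v (fun q => dot (f q) (g q)) (dot df (g w) + dot (f w) dg).
Proof.
move=> hf hg.
pose h i := (fun q => f q i 0) * (fun q => g q i 0).
rewrite (_ : (fun q => _) = h i0 + h i1 + h i2); last first.
  by apply/funext => q; rewrite dotE.
have hD i := is_deriveM (hf i) (hg i).
apply: (is_derive_eq (is_deriveD (is_deriveD (hD i0) (hD i1)) (hD i2))).
by rewrite !dotE /GRing.scale /=; ring.
Qed.

End Vectors.


(** * The ideal of a piece of a surface *)

Section Nullstellensatz.
Variable R : realType.
Implicit Types (F G : poly3 R) (p d v : space3 R) (U : set (R * R)).

Lemma is_derive_affine (a b t : R) : is_derive t 1 (fun s => a + s * b) b.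
Proof.
have H := is_deriveD (is_derive_cst a t 1)
  (is_deriveM (is_derive_id t 1) (is_derive_cst b t 1)).
by apply: (is_derive_eq H); rewrite /GRing.scale /= mulr0 mulr1 !add0r.
Qed.

Lemma is_derive_line p v (t : R) i : is_derive t 1 (fun s => (p + s *: v) i 0) (v i 0).
Proof. by under eq_fun do rewrite !mxE; exact: is_derive_affine. Qed.

Lemma ev_line F p d (s : R) :
  is_derive s 1 (fun t : R => ev F (p + t *: d)) (dot (grad F (p + s *: d)) d).
Proof. by apply: ev_chain => j; apply: is_derive_line. Qed.

(** The partial derivatives vanish everywhere as well; induction on the degree. *)
Lemma poly_vanish F : (forall p, ev F p = 0) -> F = 0.
Proof.
have [n] := ubnP (msize F); elim: n F => // n IH F szF vF.
suff : (msize F <= 1)%N.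
  by move=> /msize_le1P FE; move: (vF 0); rewrite FE evC => ->; rewrite mpolyC0.
have [->|F0] := eqVneq F 0; first by rewrite msize0.
apply: mderiv_const => i; apply: IH; first exact: leq_trans (msize_mderiv i F0) _.
move=> p; pose e : space3 R := delta_mx i 0.
have [_ dE] := ev_line F p e 0.
have <- : dot (grad F p) e = ev (mderiv i F) p by rewrite dotC dot_delta mxE.
rewrite scale0r addr0 in dE; rewrite -dE.
rewrite (_ : (fun _ => _) = cst 0) ?derive_cst //.
by apply/funext => s; rewrite vF.
Qed.

Definition continuous_coords (x : R * R -> space3 R) w :=
  forall i, {for w, continuous (fun q => x q i 0)}.

Definition normal (x : R * R -> space3 R) w := cross (du x w) (dv x w).

(** What is used of a chart in order to show that polynomials vanish; unlike a
   chart it survives restriction to a smaller open set for trivial reasons. *)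
Definition regular_piece U (x : R * R -> space3 R) :=
  [/\ open U, U !=set0,
      forall w, U w -> derivable x w ((1, 0) : R * R),
      forall w, U w -> derivable x w ((0, 1) : R * R) &
      forall w, U w -> [/\ normal x w != 0, continuous_coords (normal x) w &
                           continuous_coords x w]].

Lemma regular_piece_sub U V x : regular_piece U x -> open V -> V !=set0 ->
  V `<=` U -> regular_piece V x.
Proof. by move=> [_ _ h1 h2 h3] oV nV VU; split=> // w /VU; auto. Qed.

Lemma open_nonvanishing U (f : R * R -> R) : open U ->
  (forall q, U q -> {for q, continuous f}) -> open (U `&` [set q | f q != 0]).
Proof.
move=> oU cf; rewrite openE => q [Uq nq]; apply: filterI; first exact: open_nbhs_nbhs.
have : nbhs (f q) [set y : R | y != 0].
  by apply: open_nbhs_nbhs; split=> //; apply: open_neq.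
exact: cf.
Qed.

Lemma near_derive0 U (f : R * R -> R) w (v : R * R) (d : R) : open U -> U w ->
  (forall q, U q -> f q = 0) -> is_derive w v f d -> d = 0.
Proof.
move=> oU Uw f0 [_ <-]; rewrite (@near_eq_derive _ _ _ f (cst 0)) ?derive_cst //.
by near=> q; rewrite /cst f0 //; near: q; apply: open_nbhs_nbhs.
Unshelve. all: by end_near. Qed.

Lemma grad_tangent U x G : regular_piece U x -> (forall w, U w -> ev G (x w) = 0) ->
  forall w, U w -> dot (grad G (x w)) (du x w) = 0 /\
                   dot (grad G (x w)) (dv x w) = 0.
Proof.
move=> [oU _ h1 h2 _] G0 w Uw.
by split; apply: (near_derive0 oU Uw G0); apply: ev_chain_vec; [exact: h1|exact: h2].
Qed.

Lemma orthogonal_parallel (g a b : space3 R) : dot g a = 0 -> dot g b = 0 ->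
  forall i j, g i 0 * cross a b j 0 = g j 0 * cross a b i 0.
Proof.
move=> ga gb; have K k : a k 0 * dot g b - b k 0 * dot g a = 0.
  by rewrite ga gb !mulr0 subr0.
rewrite !dotE in K; apply: ord3P; apply: ord3P; rewrite /cross !vecE //.
all: first [by rewrite -[RHS]addr0 -[X in _ = _ + X](K i0); ring
           |by rewrite -[RHS]addr0 -[X in _ = _ + X](K i1); ring
           |by rewrite -[RHS]addr0 -[X in _ = _ + X](K i2); ring
           |by rewrite -[RHS]subr0 -[X in _ = _ - X](K i0); ring
           |by rewrite -[RHS]subr0 -[X in _ = _ - X](K i1); ring
           |by rewrite -[RHS]subr0 -[X in _ = _ - X](K i2); ring].
Qed.

Lemma grad_normal U x G : regular_piece U x -> (forall w, U w -> ev G (x w) = 0) ->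
  forall w, U w -> forall i j, grad G (x w) i 0 * normal x w j 0 =
                               grad G (x w) j 0 * normal x w i 0.
Proof.
by move=> rU G0 w Uw; have [? ?] := grad_tangent rU G0 Uw; apply: orthogonal_parallel.
Qed.

(** The partial derivatives of r also vanish on the piece, for the gradient of r is
   normal to the piece and has no i-th component; induction on the degree. *)
Lemma cylinder_vanish U x i r : regular_piece U x ->
  (forall w, U w -> normal x w i 0 != 0) -> mderiv i r = 0 ->
  (forall w, U w -> ev r (x w) = 0) -> r = 0.
Proof.
move=> rU ni; have [n] := ubnP (msize r); elim: n r => // n IH r szr dir vr.
suff : (msize r <= 1)%N.
  move=> /msize_le1P rE; have [_ [w Uw] _ _ _] := rU.
  by move: (vr w Uw); rewrite rE evC => ->; rewrite mpolyC0.
have [->|r0] := eqVneq r 0; first by rewrite msize0.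
apply: mderiv_const => j; apply: IH; first exact: leq_trans (msize_mderiv j r0) _.
  by rewrite mderiv_comm dir mderiv0.
move=> w Uw; have := grad_normal rU vr Uw j i.
rewrite [X in _ = X * _]mxE dir ev0 mul0r => /eqP.
by rewrite mulf_eq0 (negPf (ni w Uw)) orbF mxE => /eqP.
Qed.

(** The ideal of a surface that contains a regular piece is generated by its
   irreducible equation: if F does not divide G, then elimination of a variable
   transverse to the piece gives a nonzero polynomial in the two other variables
   that vanishes on the piece. *)
Theorem divides_of_vanish F G U x : irreducible3 F -> regular_piece U x ->
  (forall w, U w -> ev F (x w) = 0) -> (forall w, U w -> ev G (x w) = 0) ->
  divides F G.
Proof.
move=> irrF rU F0 G0; have [oU [w0 Uw0] h1 h2 h3] := rU.
have [/exists_coord[i ni] _ _] := h3 w0 Uw0.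
pose V := U `&` [set w | normal x w i 0 != 0].
have rV : regular_piece V x.
  apply: (regular_piece_sub rU); [|by exists w0|by move=> w []].
  by apply: open_nonvanishing => // w /h3[_ cn _]; exact: cn.
have sub (H : poly3 R) : (forall w, U w -> ev H (x w) = 0) ->
  forall w, V w -> ev H (x w) = 0 by move=> H0 w [/H0].
have nV w : V w -> normal x w i 0 != 0 by case.
have [dF|dF] := eqVneq (mderiv i F) 0.
  have := irreducible3_neq0 irrF.
  by rewrite (cylinder_vanish rV nV dF (sub _ F0)) eqxx.
have [//|nFG] := pselect (divides F G).
have [u [v [r [r0 dr rE]]]] := eliminate (irreducible3_prime irrF) dF nFG.
case/eqP: r0; apply: (cylinder_vanish rV nV dr) => w Vw.
by rewrite -rE evD !evM (sub _ F0 w Vw) (sub _ G0 w Vw) !mulr0 addr0.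
Qed.

(** F does not divide its partial derivatives, which have a smaller degree, so that
   one of them is not zero all over the piece. *)
Lemma regular_point F U x : irreducible3 F -> regular_piece U x ->
  (forall w, U w -> ev F (x w) = 0) -> exists w, U w /\ grad F (x w) != 0.
Proof.
move=> irrF rV F0.
have [i di] := nonconst_mderiv (proj1 irrF).
apply: contrapT => nex.
have [H HE] : divides F (mderiv i F).
  apply: (divides_of_vanish irrF rV) => q Vq; first exact: F0.
  have [g0|g0] := eqVneq (grad F (x q)) 0; last by case: nex; exists q.
  by have := congr1 (fun g : space3 R => g i 0) g0; rewrite !mxE.
have H0 : H != 0 by apply: contraNneq di => H0; rewrite HE H0 mul0r.
have Fn0 := irreducible3_neq0 irrF.
have := msize_mderiv i Fn0; rewrite HE msizeM // ltnNge => /negP; apply.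
rewrite -msize_poly_eq0 -lt0n in H0.
by case: (msize H) H0 => // h _; rewrite addSn leq_addl.
Qed.

End Nullstellensatz.

(** * The curvature in terms of the equation *)

Section Second_order.
Variable R : realType.
Implicit Types (F G : poly3 R) (S : set (space3 R)) (U : set (R * R)).
Implicit Types (x y n a b c : R * R -> space3 R).

Local Notation e1 := ((1, 0) : R * R).
Local Notation e2 := ((0, 1) : R * R).

Lemma is_derive_coord (V : normedModType R) (f : V -> space3 R) w v i :
  derivable f w v -> is_derive w v (fun q => f q i 0) (('D_v f w) i 0).
Proof.
move=> df; move/derivable_mxP: (df) => /(_ i 0) dfi.
by rewrite derive_mx // mxE; apply: derivableP.
Qed.

Lemma is_derive_grad (V : normedModType R) (f : V -> space3 R) w v F i :
  derivable f w v ->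
  is_derive w v (fun q => grad F (f q) i 0) ((hess F (f w) *m 'D_v f w) i 0).
Proof.
move=> df; rewrite (_ : (fun q => _) = (fun q => ev (mderiv i F) (f q))); last first.
  by apply/funext => q; rewrite mxE.
have -> : (hess F (f w) *m 'D_v f w) i 0 = dot (grad (mderiv i F) (f w)) ('D_v f w).
  by rewrite mul3E dotE !mxE.
exact: ev_chain_vec.
Qed.

Lemma smooth_derivable U x : smooth_on U x -> forall w, U w ->
  [/\ derivable x w e1, derivable x w e2 & {for w, continuous x}].
Proof. by move=> /(_ 1%N) [cx [d1 d2 _ _]] w Uw; split; [exact: d1|exact: d2|exact: cx]. Qed.

Lemma smooth_du U x : smooth_on U x -> smooth_on U (du x).
Proof. by move=> sx n; case: (sx n.+1) => _ []. Qed.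

Lemma smooth_dv U x : smooth_on U x -> smooth_on U (dv x).
Proof. by move=> sx n; case: (sx n.+1) => _ []. Qed.

Lemma continuous_coord x w : {for w, continuous x} -> continuous_coords x w.
Proof.
move=> cx i; apply: (@continuous_comp _ _ _ x (fun M : space3 R => M i 0) w cx).
exact: coord_continuous.
Qed.

Lemma continuous_dot x y w : continuous_coords x w -> continuous_coords y w ->
  {for w, continuous (fun q => dot (x q) (y q))}.
Proof.
move=> cx cy; pose m i := (fun q => x q i 0) \* (fun q => y q i 0).
rewrite (_ : (fun q => _) = m i0 \+ m i1 \+ m i2); last first.
  by apply/funext => q; rewrite dotE.
by apply: continuousD; [apply: continuousD|]; apply: continuousM.
Qed.

Lemma continuous_cross_coord x y w i : {for w, continuous x} ->
  {for w, continuous y} -> {for w, continuous (fun q => cross (x q) (y q) i 0)}.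
Proof.
move=> /continuous_coord cx /continuous_coord cy.
pose m j k := (fun q => x q j 0 * y q k 0) \- (fun q => x q k 0 * y q j 0).
have cm j k : {for w, continuous (m j k)}.
  by apply: continuousB; apply: continuousM.
elim/ord3P: i.
- by rewrite (_ : (fun q => _) = m i1 i2) //; apply/funext => q; rewrite vecE.
- by rewrite (_ : (fun q => _) = m i2 i0) //; apply/funext => q; rewrite vecE.
- by rewrite (_ : (fun q => _) = m i0 i1) //; apply/funext => q; rewrite vecE.
Qed.

Lemma continuous_second_form n a b c w : continuous_coords n w ->
  continuous_coords a w -> continuous_coords b w -> continuous_coords c w ->
  {for w, continuous (fun q => dot (n q) (a q) * dot (n q) (c q) -
                               dot (n q) (b q) ^+ 2)}.
Proof.
move=> cn ca cb cc; apply: (@continuousB _ _ _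
  ((fun q => dot (n q) (a q)) \* (fun q => dot (n q) (c q)))
  ((fun q => dot (n q) (b q)) \* (fun q => dot (n q) (b q)))).
  by apply: continuousM; apply: continuous_dot.
by apply: continuousM; apply: continuous_dot.
Qed.

(** With the unnormalized normal vector n in place of N, the numerator of the
   Gaussian curvature becomes polynomial in the derivatives of the chart. *)
Definition curvature_numerator x w :=
  dot (normal x w) (du (du x) w) * dot (normal x w) (dv (dv x) w) -
  dot (normal x w) (dv (du x) w) ^+ 2.

Lemma second_form_scale k (n a b c : space3 R) :
  dot a (k *: n) * dot c (k *: n) - dot b (k *: n) ^+ 2 =
  k ^+ 2 * (dot n a * dot n c - dot n b ^+ 2).
Proof. by rewrite !dotZr [dot a n]dotC [dot b n]dotC [dot c n]dotC; ring. Qed.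

Lemma lagrange (a b : space3 R) :
  dot a a * dot b b - dot a b ^+ 2 = dot (cross a b) (cross a b).
Proof. by rewrite dot_cross_cross [dot b a]dotC expr2. Qed.

Lemma curvature_ratio (n a b c u v : space3 R) : n = cross u v -> n != 0 ->
  let N := (enorm n)^-1 *: n in
  (dot a N * dot c N - dot b N ^+ 2) / (dot u u * dot v v - dot u v ^+ 2) =
  (dot n a * dot n c - dot n b ^+ 2) / dot n n ^+ 2.
Proof.
move=> nE n0 /=; have nn0 : dot n n != 0 by rewrite dot_eq0.
have nn : enorm n ^+ 2 = dot n n by rewrite sqr_sqrtr // dot_ge0.
have en0 : enorm n != 0.
  by apply: contra_neq nn0 => en; rewrite -nn en expr0n.
by rewrite second_form_scale lagrange -nE -nn; field.
Qed.

Lemma gauss_curvatureE x w : normal x w != 0 ->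
  gauss_curvature x w = curvature_numerator x w / dot (normal x w) (normal x w) ^+ 2.
Proof. by move=> n0; exact: curvature_ratio. Qed.

Lemma chart_in S U x w : local_parametrization S U x -> U w -> S (x w).
Proof.
case=> -[oU _] _ _ /(_ U oU (@subset_refl _ U)) [V _ xU] Uw.
by have [] : (S `&` V) (x w) by rewrite -xU; exists w.
Qed.

Lemma chart_regular S U V x : local_parametrization S U x -> open V ->
  V `<=` U -> V !=set0 -> regular_piece V x.
Proof.
move=> [[oU sx] nU _ _] oV VU V0; apply: (@regular_piece_sub _ U) => //.
split=> //; first by have [w /VU] := V0; exists w.
- by move=> w /(smooth_derivable sx) [].
- by move=> w /(smooth_derivable sx) [].
move=> w Uw; split; [exact: nU| |]; last first.
  by have [_ _ /continuous_coord] := smooth_derivable sx Uw.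
move=> i; have [_ _ cu] := smooth_derivable (smooth_du sx) Uw.
have [_ _ cv] := smooth_derivable (smooth_dv sx) Uw.
exact: (continuous_cross_coord cu cv).
Qed.

(** The gradient is orthogonal to the derivatives of the chart; these identities are
   differentiated once more. *)
Lemma second_order F U x w : local_parametrization (zeros F) U x -> U w ->
  [/\ dot (grad F (x w)) (du (du x) w) = - dot (du x w) (hess F (x w) *m du x w),
      dot (grad F (x w)) (dv (du x) w) = - dot (du x w) (hess F (x w) *m dv x w) &
      dot (grad F (x w)) (dv (dv x) w) = - dot (dv x w) (hess F (x w) *m dv x w)].
Proof.
move=> ch Uw; have [[oU sx] _ _ _] := ch.
have rU : regular_piece U x by apply: (chart_regular ch) => //; exists w.
have F0 q : U q -> ev F (x q) = 0 by exact: (chart_in ch).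
have tu q (Uq : U q) := proj1 (grad_tangent rU F0 Uq).
have tv q (Uq : U q) := proj2 (grad_tangent rU F0 Uq).
have [dx1 dx2 _] := smooth_derivable sx Uw.
have [dxu1 dxu2 _] := smooth_derivable (smooth_du sx) Uw.
have [dxv1 dxv2 _] := smooth_derivable (smooth_dv sx) Uw.
have key v (y : R * R -> space3 R) : derivable x w v -> derivable y w v ->
    (forall q, U q -> dot (grad F (x q)) (y q) = 0) ->
    dot (grad F (x w)) ('D_v y w) = - dot (y w) (hess F (x w) *m 'D_v x w).
  move=> dx dy yt; apply/eqP; rewrite -addr_eq0 addrC [dot (y w) _]dotC; apply/eqP.
  apply: (near_derive0 oU Uw yt); apply: is_derive_dot => i.
    exact: is_derive_grad.
  exact: is_derive_coord.
by split; [exact: key tu|exact: key tu|exact: key tv].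
Qed.

Lemma chart_normal F U x w : local_parametrization (zeros F) U x -> U w ->
  exists k, grad F (x w) = k *: normal x w.
Proof.
move=> ch Uw; have [[oU _] nx _ _] := ch.
have rU : regular_piece U x by apply: (chart_regular ch) => //; exists w.
apply: parallel_scale; first exact: nx.
by apply: (grad_normal rU) => // q /(chart_in ch).
Qed.

Lemma hess_numerator (H : 'M[R]_3) (g a b p q r : space3 R) k : H^T = H ->
  g = k *: cross a b -> dot g p = - dot a (H *m a) ->
  dot g q = - dot a (H *m b) -> dot g r = - dot b (H *m b) ->
  k ^+ 2 * (dot (cross a b) p * dot (cross a b) r - dot (cross a b) q ^+ 2) =
  dot (cross a b) (cross (H *m a) (H *m b)).
Proof.
move=> Hs ->; rewrite !dotZl dot_cross_cross => s1 s2 s3.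
have -> : dot b (H *m a) = dot a (H *m b) by rewrite dotC dot_trmx Hs.
rewrite mulrBr -[dot a (H *m a)]opprK -s1 -[dot a (H *m b)]opprK -s2.
by rewrite -[dot b (H *m b)]opprK -s3; ring.
Qed.

(** Up to a constant factor the second fundamental form is the restriction of the
   Hessian of F to the tangent plane; the right-hand side is the determinant of this
   restriction. *)
Lemma curvature_numerator_hess F U x w k : local_parametrization (zeros F) U x ->
  U w -> grad F (x w) = k *: normal x w ->
  k ^+ 2 * curvature_numerator x w =
  dot (normal x w)
    (cross (hess F (x w) *m du x w) (hess F (x w) *m dv x w)).
Proof.
move=> ch Uw gE; have [s1 s2 s3] := second_order ch Uw.
exact: (hess_numerator (hess_sym F (x w)) gE s1 s2 s3).
Qed.

(** A point where the surface is smooth and curved, described by the equation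
   alone: a and b span the tangent plane. *)
Definition curved_algebraically F p := exists (a b : space3 R) (k : R),
  [/\ ev F p = 0, grad F p = k *: cross a b, k != 0 &
      dot (cross a b) (cross (hess F p *m a) (hess F p *m b)) != 0].

(** A nonzero curvature remains nonzero nearby, and nearby some point is smooth for
   the equation F. *)
Lemma exists_curved_point F : irreducible3 F ->
  ~ gauss_curvature_identically_zero (zeros F) ->
  exists p, curved_algebraically F p.
Proof.
move=> irrF nK.
have [U [x [w [ch Uw Kw]]]] : exists U x w,
    [/\ local_parametrization (zeros F) U x, U w & gauss_curvature x w != 0].
  apply: contrapT => nex; apply: nK => U x w ch Uw; apply/eqP.
  by apply: contrapT => /negP Kw; apply: nex; exists U, x, w.
have [[oU sx] nx _ _] := ch.
have cn0 : curvature_numerator x w != 0.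
  by apply: contra_neq Kw => cn; rewrite gauss_curvatureE ?nx // cn mul0r.
pose V := U `&` [set q | curvature_numerator x q != 0].
have oV : open V.
  apply: open_nonvanishing => // q Uq.
  have su := smooth_du sx; have sv := smooth_dv sx.
  have [_ _ cu] := smooth_derivable su Uq.
  have [_ _ cv] := smooth_derivable sv Uq.
  have [_ _ cuu] := smooth_derivable (smooth_du su) Uq.
  have [_ _ cuv] := smooth_derivable (smooth_dv su) Uq.
  have [_ _ cvv] := smooth_derivable (smooth_dv sv) Uq.
  have cn : continuous_coords (normal x) q.
    by move=> i; exact: (continuous_cross_coord cu cv).
  exact: (continuous_second_form cn (continuous_coord cuu) (continuous_coord cuv)
                                    (continuous_coord cvv)).
have rV : regular_piece V x by apply: (chart_regular ch) => //; [move=> q []|exists w].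
have [q [Vq gq]] : exists q, V q /\ grad F (x q) != 0.
  by apply: (regular_point irrF rV) => q [Uq _]; exact: (chart_in ch Uq).
have [Uq nq] := Vq.
have [k gE] := chart_normal ch Uq.
have k0 : k != 0 by apply: contra_neq gq => k0; rewrite gE k0 scale0r.
exists (x q), (du x q), (dv x q), k; split=> //; first exact: (chart_in ch Uq).
by rewrite -(curvature_numerator_hess ch Uq gE) mulf_neq0 // expf_neq0.
Qed.

End Second_order.

(** * Affine vector fields tangent to a surface *)

Section Tangent_fields.
Variable R : realType.
Implicit Types (F G : poly3 R) (p v w e r : space3 R) (M N : 'M[R]_3).

(** The vector field p |-> M p + v is tangent to all the level surfaces of F: as a
   derivation it kills F. *)
Definition tangent_field F M v := forall p, dot (grad F p) (M *m p + v) = 0.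

Lemma is_derive_grad_line F p d i :
  is_derive (0 : R) 1 (fun t => grad F (p + t *: d) i 0) ((hess F p *m d) i 0).
Proof.
rewrite (_ : (fun t => _) = (fun t => ev (mderiv i F) (p + t *: d))); last first.
  by apply/funext => q; rewrite mxE.
have -> : (hess F p *m d) i 0 = dot (grad (mderiv i F) (p + 0 *: d)) d.
  by rewrite mul3E dotE scale0r addr0 !mxE.
by apply: ev_chain => j; apply: is_derive_line.
Qed.

(** Differentiation of the identity that says that the field kills F. *)
Lemma tangent_field_hess F M v : tangent_field F M v ->
  forall p, hess F p *m (M *m p + v) = - (M^T *m grad F p).
Proof.
move=> XF p; apply: dot_ext => d; apply/eqP; rewrite -subr_eq0; apply/eqP.
have dX i : is_derive (0 : R) 1 (fun t => (M *m (p + t *: d) + v) i 0) ((M *m d) i 0).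
  rewrite (_ : (fun _ => _) = (fun s => ((M *m p + v) + s *: (M *m d)) i 0)).
    exact: is_derive_line.
  by apply/funext => s; rewrite mulmxDr -scalemxAr addrAC.
have [_] := is_derive_dot (is_derive_grad_line F p d) dX.
rewrite (_ : (fun t => _) = cst 0) ?derive_cst; last by apply/funext => s; exact: XF.
rewrite scale0r addr0 dot_trmx hess_sym => D0.
by rewrite [RHS]D0 -[X in _ - dot d X]scaleN1r dotZr -dot_trmx [dot (M *m d) _]dotC; ring.
Qed.

(** The Hessian of a cylinder kills the direction v of the rulings, which is tangent
   to the surface: the second fundamental form degenerates. *)
Lemma not_cylinder F p v : curved_algebraically F p ->
  (forall q, dot (grad F q) v = 0) -> v = 0.
Proof.
move=> [a [b [k [_ gE k0 curv]]]] gv.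
have Hv : hess F p *m v = 0.
  have /tangent_field_hess/(_ p) : tangent_field F 0 v.
    by move=> q; rewrite mul0mx add0r gv.
  by rewrite mul0mx add0r trmx0 mul0mx oppr0.
have nv : dot (cross a b) v = 0.
  by apply: (mulfI k0); rewrite -dotZl -gE gv mulr0.
set n := cross a b in nv curv gE *.
have decomp : dot n n *: v = dot n (cross v b) *: a + dot n (cross a v) *: b + dot n v *: n.
  by apply: vec_ext; rewrite !dotE /n /cross !(vecE, mxE); ring.
have := congr1 (mulmx (hess F p)) decomp.
rewrite nv scale0r addr0 -scalemxAr Hv scaler0 mulmxDr -!scalemxAr.
set Ha := _ *m a in curv *; set Hb := _ *m b in curv *; move=> E.
have c1 : dot n (cross v b) = 0.
  have : cross 0 Hb = 0 by rewrite cross0.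
  rewrite {1}E crossDl !crossZl crossv scaler0 addr0 => /(congr1 (dot n)).
  by rewrite dotZr [RHS]dotC dot0l => /eqP; rewrite mulf_eq0 (negPf curv) orbF => /eqP.
have c2 : dot n (cross a v) = 0.
  have : cross 0 Ha = 0 by rewrite cross0.
  rewrite {1}E crossDl !crossZl crossv scaler0 add0r => /(congr1 (dot n)).
  rewrite [cross Hb Ha]crossC scalerN -scaleNr dotZr [RHS]dotC dot0l => /eqP.
  by rewrite mulf_eq0 (negPf curv) orbF oppr_eq0 => /eqP.
move: decomp; rewrite nv c1 c2 !scale0r !addr0 => /eqP.
rewrite scaler_eq0 dot_eq0 => /orP[/eqP n0|/eqP //].
by move: curv; rewrite n0 dot0l eqxx.
Qed.

Definition affine_poly r (s : R) : poly3 R :=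
  \sum_i mpolyC 3 (r i 0) * mpolyX R (mnm1 i) + mpolyC 3 s.

Lemma ev_affine_poly r s p : ev (affine_poly r s) p = dot r p + s.
Proof.
by rewrite evD evC ev_sum; congr (_ + _); apply: eq_bigr => i _; rewrite evM evC evX.
Qed.

Definition field_poly M v i := affine_poly (row i M)^T (v i 0).

Lemma ev_field_poly M v i p : ev (field_poly M v i) p = (M *m p + v) i 0.
Proof. by rewrite ev_affine_poly [RHS]mxE mul3E dotE !mxE. Qed.

Lemma poly_mul_vanish F G : (forall p, ev F p * ev G p = 0) -> F = 0 \/ G = 0.
Proof.
move=> FG; have /eqP : F * G = 0 by apply: poly_vanish => p; rewrite evM.
by rewrite mulf_eq0 => /orP[]/eqP; [left|right].
Qed.

(** Division by the affine factor would leave a constant field e that kills F, and the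
   surface would be a cylinder. *)
Lemma tangent_field_parallel F p M v r s e : curved_algebraically F p ->
  tangent_field F M v -> e != 0 -> (forall q, M *m q + v = (dot r q + s) *: e) ->
  forall q, M *m q + v = 0.
Proof.
move=> curv XF e0 ME q.
pose G : poly3 R := \sum_i mpolyC 3 (e i 0) * mderiv i F.
have evG u : ev G u = dot (grad F u) e.
  by rewrite ev_sum dotC /dot; apply: eq_bigr => i _; rewrite evM evC mxE.
have [|S0|G0] := @poly_mul_vanish (affine_poly r s) G.
- by move=> u; rewrite ev_affine_poly evG -dotZr -ME XF.
- by rewrite ME -ev_affine_poly S0 ev0 scale0r.
- case/eqP: e0; apply: (not_cylinder curv) => u.
  by rewrite -evG G0 ev0.
Qed.

(** The Hessian of a polynomial of degree at most 1 is zero. *)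
Lemma curved_msize F p : curved_algebraically F p -> (2 < msize F)%N.
Proof.
move=> [a [b [k [_ _ _ curv]]]]; rewrite ltnNge; apply: contraNN curv => szF.
have H0 : hess F p = 0.
  apply/matrixP => i j; rewrite !mxE.
  suff -> : mderiv j (mderiv i F) = 0 by rewrite ev0.
  have [F0|Fn0] := eqVneq F 0; first by rewrite F0 !mderiv0.
  have /msize_le1P -> : (msize (mderiv i F) <= 1)%N.
    by rewrite -ltnS; apply: leq_trans (msize_mderiv i Fn0) szF.
  by rewrite mderivC.
by rewrite H0 !mul0mx crossv dotC dot0l.
Qed.

(** Three linear equations with a nonzero solution, the gradient. *)
Lemma tangent_field_det F p M v N w K u : curved_algebraically F p ->
  tangent_field F M v -> tangent_field F N w -> tangent_field F K u ->
  forall q, dot (M *m q + v) (cross (N *m q + w) (K *m q + u)) = 0.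
Proof.
move=> curv XF YF ZF.
have [i di] := nonconst_mderiv (ltnW (curved_msize curv)).
pose f := field_poly M v; pose g := field_poly N w; pose h := field_poly K u.
pose D : poly3 R := f i0 * (g i1 * h i2 - g i2 * h i1) +
  f i1 * (g i2 * h i0 - g i0 * h i2) + f i2 * (g i0 * h i1 - g i1 * h i0).
have evD' q : ev D q = dot (M *m q + v) (cross (N *m q + w) (K *m q + u)).
  by rewrite /D /f /g /h 2!evD !evM !evB !evM !ev_field_poly dotE /cross !vecE.
have [|D0|dF] := @poly_mul_vanish D (mderiv i F).
- move=> q; have gE : ev (mderiv i F) q = grad F q i 0 by rewrite mxE.
  rewrite evD' gE.
  have := XF q; have := YF q; have := ZF q.
  move: (grad F q) (_ *m q + v) (_ *m q + w) (_ *m q + u) => g0 a b c gc gb ga.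
  have cramer : dot a (cross b c) *: g0 = dot g0 a *: cross b c +
      dot g0 b *: cross c a + dot g0 c *: cross a b.
    by apply: vec_ext; rewrite !dotE /cross !(vecE, mxE); ring.
  move: cramer; rewrite ga gb gc !scale0r !addr0.
  by move/(congr1 (fun x : space3 R => x i 0)); rewrite !mxE.
- by move=> q; rewrite -evD' D0 ev0.
- by move: di; rewrite dF eqxx.
Qed.

Lemma tangent_field_lin F a b M v N w : tangent_field F M v -> tangent_field F N w ->
  tangent_field F (a *: M + b *: N) (a *: v + b *: w).
Proof.
move=> XF YF p.
rewrite (_ : (a *: M + b *: N) *m p + (a *: v + b *: w) =
             a *: (M *m p + v) + b *: (N *m p + w)); last first.
  by rewrite mulmxDl -!scalemxAl !scalerDr addrACA.
by rewrite dotDr !dotZr XF YF !mulr0 addr0.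
Qed.

(** This is the Lie bracket of the two fields up to sign: the derivatives of second
   order cancel by symmetry of the Hessian. *)
Lemma tangent_field_bracket F M v N w : tangent_field F M v -> tangent_field F N w ->
  tangent_field F (M *m N - N *m M) (M *m w - N *m v).
Proof.
move=> XF YF p; have hX := tangent_field_hess XF p; have hY := tangent_field_hess YF p.
rewrite (_ : (M *m N - N *m M) *m p + (M *m w - N *m v) =
             M *m (N *m p + w) - N *m (M *m p + v)); last first.
  by rewrite mulmxBl !mulmxDr -!mulmxA opprD addrACA.
set X := M *m p + v in hX *; set Y := N *m p + w in hY *.
rewrite -scaleN1r dotDr dotZr dotC dot_trmx [dot _ (N *m X)]dotC dot_trmx.
rewrite -[M^T *m _]opprK -hX -[N^T *m _]opprK -hY.
rewrite -[- (_ *m X)]scaleN1r -[- (_ *m Y)]scaleN1r !dotZr.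
have -> : dot Y (hess F p *m X) = dot X (hess F p *m Y).
  by rewrite dotC dot_trmx hess_sym.
ring.
Qed.

End Tangent_fields.

(** * Two infinitesimal rotations in the frame of the first one *)

Section Classification.
Variable R : realType.
Implicit Types (v w : space3 R) (M N Q : 'M[R]_3) (a b c d f g h k x y z : R).

(** What the case analysis uses of the Lie algebra of the affine vector fields
   that are tangent to a curved surface. *)
Record curved_algebra (G : 'M[R]_3 -> space3 R -> Prop) : Prop := CurvedAlgebra {
  ca_lin : forall a b M v N w, G M v -> G N w ->
    G (a *: M + b *: N) (a *: v + b *: w);
  ca_bracket : forall M v N w, G M v -> G N w ->
    G (M *m N - N *m M) (M *m w - N *m v);
  ca_det : forall M v N w K u, G M v -> G N w -> G K u ->
    forall q, dot (M *m q + v) (cross (N *m q + w) (K *m q + u)) = 0;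
  ca_parallel : forall M v r s (e : space3 R), G M v -> e != 0 ->
    (forall q, M *m q + v = (dot r q + s) *: e) -> forall q, M *m q + v = 0
}.

Definition mat9 (a b c d e f g h k : R) : 'M[R]_3 :=
  mat [:: [:: a; b; c]; [:: d; e; f]; [:: g; h; k]].

(** The linear parts of the infinitesimal rotations of the three types, up to
   conjugation by an isometry. *)
Definition rotation_generator M :=
  [/\ \tr M = 0, \det M = 0, M != 0 &
      [\/ M^T = - M, M^T = M | \tr (M *m M) = 0 /\ M *m M != 0]].

(** The field p |-> M p + v vanishes at P and is an infinitesimal isometry of
   the quadratic form Q centered at P. *)
Definition preserves Q P M v := Q *m M + M^T *m Q = 0 /\ M *m P + v = 0.

Definition nondegenerate Q := Q^T = Q /\ \det Q != 0.

Lemma mat9_eta M : M = mat9 (M i0 i0) (M i0 i1) (M i0 i2)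
  (M i1 i0) (M i1 i1) (M i1 i2) (M i2 i0) (M i2 i1) (M i2 i2).
Proof. exact: mat_eta. Qed.

Lemma mat9_inj a b c d e f g h k a' b' c' d' e' f' g' h' k' :
  mat9 a b c d e f g h k = mat9 a' b' c' d' e' f' g' h' k' ->
  [/\ a = a', b = b' & c = c'] /\ [/\ d = d', e = e' & f = f'] /\
  [/\ g = g', h = h' & k = k'].
Proof.
move=> E; have E' i j := congr1 (fun M : 'M[R]_3 => M i j) E.
move: (E' i0 i0) (E' i0 i1) (E' i0 i2) (E' i1 i0) (E' i1 i1) (E' i1 i2)
  (E' i2 i0) (E' i2 i1) (E' i2 i2).
by rewrite /mat9 !matE => *; do ![split].
Qed.

Lemma mat9_tr a b c d e f g h k : (mat9 a b c d e f g h k)^T = mat9 a d g b e h c f k.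
Proof. by apply/matrixP; apply: ord3P; apply: ord3P; rewrite [LHS]mxE /mat9 !matE. Qed.

Lemma mat9_opp a b c d e f g h k : - mat9 a b c d e f g h k =
  mat9 (- a) (- b) (- c) (- d) (- e) (- f) (- g) (- h) (- k).
Proof. by apply/matrixP; apply: ord3P; apply: ord3P; rewrite [LHS]mxE /mat9 !matE. Qed.

Lemma mat9_add a b c d e f g h k a' b' c' d' e' f' g' h' k' :
  mat9 a b c d e f g h k + mat9 a' b' c' d' e' f' g' h' k' =
  mat9 (a + a') (b + b') (c + c') (d + d') (e + e') (f + f') (g + g') (h + h') (k + k').
Proof. by apply/matrixP; apply: ord3P; apply: ord3P; rewrite [LHS]mxE /mat9 !matE. Qed.

Lemma mat9_scale s a b c d e f g h k : s *: mat9 a b c d e f g h k =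
  mat9 (s * a) (s * b) (s * c) (s * d) (s * e) (s * f) (s * g) (s * h) (s * k).
Proof. by apply/matrixP; apply: ord3P; apply: ord3P; rewrite [LHS]mxE /mat9 !matE. Qed.

Lemma mat9_mul a b c d e f g h k a' b' c' d' e' f' g' h' k' :
  mat9 a b c d e f g h k *m mat9 a' b' c' d' e' f' g' h' k' =
  mat9 (a * a' + b * d' + c * g') (a * b' + b * e' + c * h') (a * c' + b * f' + c * k')
       (d * a' + e * d' + f * g') (d * b' + e * e' + f * h') (d * c' + e * f' + f * k')
       (g * a' + h * d' + k * g') (g * b' + h * e' + k * h') (g * c' + h * f' + k * k').
Proof. by rewrite [LHS]mat9_eta /mat9 !mul3E !matE. Qed.

Lemma mat9_vec a b c d e f g h k x y z :
  mat9 a b c d e f g h k *m vec x y z =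
  vec (a * x + b * y + c * z) (d * x + e * y + f * z) (g * x + h * y + k * z).
Proof. by rewrite [LHS]vec_eta !mul3E /mat9 !matE !vecE. Qed.

Lemma vec_add (x y z x' y' z' : R) :
  vec x y z + vec x' y' z' = vec (x + x') (y + y') (z + z').
Proof. by apply: vec_ext; rewrite [LHS]mxE !vecE. Qed.

Lemma vec_opp (x y z : R) : - vec x y z = vec (- x) (- y) (- z).
Proof. by apply: vec_ext; rewrite [LHS]mxE !vecE. Qed.

Lemma vec_scale (s x y z : R) : s *: vec x y z = vec (s * x) (s * y) (s * z).
Proof. by apply: vec_ext; rewrite [LHS]mxE !vecE. Qed.

Lemma mat90 : 0 = mat9 0 0 0 0 0 0 0 0 0.
Proof. by rewrite [LHS]mat9_eta !mxE. Qed.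

Lemma mat9_trace a b c d e f g h k : \tr (mat9 a b c d e f g h k) = a + e + k.
Proof. by rewrite /mxtrace sum3 /mat9 !matE. Qed.

Lemma mat9_det a b c d e f g h k : \det (mat9 a b c d e f g h k) =
  a * (e * k - f * h) - b * (d * k - f * g) + c * (d * h - e * g).
Proof. exact: det_mat. Qed.

Definition mat9E := (mat9_tr, mat9_mul, mat9_add, mat9_opp, mat9_scale, mat9_vec,
  vec_add, vec_opp, vec_scale, mat9_trace, mat9_det).

Variable G : 'M[R]_3 -> space3 R -> Prop.
Hypothesis HG : curved_algebra G.

Definition field3 a b c d e f g h k x y z := G (mat9 a b c d e f g h k) (vec x y z).

Lemma field3_eq a b c d e f g h k x y z a' b' c' d' e' f' g' h' k' x' y' z' :
  field3 a b c d e f g h k x y z ->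
  a = a' -> b = b' -> c = c' -> d = d' -> e = e' -> f = f' ->
  g = g' -> h = h' -> k = k' -> x = x' -> y = y' -> z = z' ->
  field3 a' b' c' d' e' f' g' h' k' x' y' z'.
Proof. by move=> + <- <- <- <- <- <- <- <- <- <- <- <-. Qed.

Lemma field3_lin s t a b c d e f g h k x y z a' b' c' d' e' f' g' h' k' x' y' z' :
  field3 a b c d e f g h k x y z -> field3 a' b' c' d' e' f' g' h' k' x' y' z' ->
  field3 (s * a + t * a') (s * b + t * b') (s * c + t * c')
         (s * d + t * d') (s * e + t * e') (s * f + t * f')
         (s * g + t * g') (s * h + t * h') (s * k + t * k')
         (s * x + t * x') (s * y + t * y') (s * z + t * z').
Proof. by move=> X Y; move: (ca_lin HG s t X Y); rewrite !mat9E. Qed.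

Lemma field3_bracket a b c d e f g h k x y z a' b' c' d' e' f' g' h' k' x' y' z' :
  field3 a b c d e f g h k x y z -> field3 a' b' c' d' e' f' g' h' k' x' y' z' ->
  field3
    (a * a' + b * d' + c * g' - (a' * a + b' * d + c' * g))
    (a * b' + b * e' + c * h' - (a' * b + b' * e + c' * h))
    (a * c' + b * f' + c * k' - (a' * c + b' * f + c' * k))
    (d * a' + e * d' + f * g' - (d' * a + e' * d + f' * g))
    (d * b' + e * e' + f * h' - (d' * b + e' * e + f' * h))
    (d * c' + e * f' + f * k' - (d' * c + e' * f + f' * k))
    (g * a' + h * d' + k * g' - (g' * a + h' * d + k' * g))
    (g * b' + h * e' + k * h' - (g' * b + h' * e + k' * h))
    (g * c' + h * f' + k * k' - (g' * c + h' * f + k' * k))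
    (a * x' + b * y' + c * z' - (a' * x + b' * y + c' * z))
    (d * x' + e * y' + f * z' - (d' * x + e' * y + f' * z))
    (g * x' + h * y' + k * z' - (g' * x + h' * y + k' * z)).
Proof. by move=> X Y; move: (ca_bracket HG X Y); rewrite !mat9E. Qed.

Lemma field3_det a b c d e f g h k x y z a' b' c' d' e' f' g' h' k' x' y' z'
    a2 b2 c2 d2 e2 f2 g2 h2 k2 x2 y2 z2 :
  field3 a b c d e f g h k x y z -> field3 a' b' c' d' e' f' g' h' k' x' y' z' ->
  field3 a2 b2 c2 d2 e2 f2 g2 h2 k2 x2 y2 z2 -> forall X Y Z,
  (a * X + b * Y + c * Z + x) *
     ((d' * X + e' * Y + f' * Z + y') * (g2 * X + h2 * Y + k2 * Z + z2) -
      (g' * X + h' * Y + k' * Z + z') * (d2 * X + e2 * Y + f2 * Z + y2)) +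
  (d * X + e * Y + f * Z + y) *
     ((g' * X + h' * Y + k' * Z + z') * (a2 * X + b2 * Y + c2 * Z + x2) -
      (a' * X + b' * Y + c' * Z + x') * (g2 * X + h2 * Y + k2 * Z + z2)) +
  (g * X + h * Y + k * Z + z) *
     ((a' * X + b' * Y + c' * Z + x') * (d2 * X + e2 * Y + f2 * Z + y2) -
      (d' * X + e' * Y + f' * Z + y') * (a2 * X + b2 * Y + c2 * Z + x2)) = 0.
Proof.
move=> V1 V2 V3 X Y Z; have := ca_det HG V1 V2 V3 (vec X Y Z).
by rewrite !mat9E dotE /cross !vecE.
Qed.

(** The field is parallel to the i-th coordinate axis. *)
Lemma field3_parallel M v i : G M v ->
  (forall j l, j != i -> M j l = 0) -> (forall j, j != i -> v j 0 = 0) ->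
  M = 0 /\ v = 0.
Proof.
move=> Mv M0 v0; pose e : space3 R := delta_mx i 0.
have e0 : e != 0.
  apply/eqP => /(congr1 (fun u : space3 R => u i 0)); rewrite !mxE !eqxx => /eqP.
  by rewrite oner_eq0.
have van : forall q, M *m q + v = 0.
  apply: (@ca_parallel _ HG M v (row i M)^T (v i 0) e) => // q.
  apply/colP => j; rewrite mxE [RHS]mxE mul3E dotE ![(row i M)^T _ _]mxE ![row i M _ _]mxE.
  have [->|ji] := eqVneq j i; first by rewrite !mxE !eqxx mulr1.
  by rewrite !(M0 j) // (v0 j) // [e j 0]mxE (negPf ji) mulr0 !mul0r !addr0.
have v00 : v = 0 by rewrite -(van 0) mulmx0 add0r.
split=> //; apply/matrixP => j l; have := van (delta_mx l 0).
rewrite v00 addr0 => /(congr1 (fun u : space3 R => u j 0)).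
by rewrite -colE !mxE.
Qed.

Lemma field3_row0 a b c x : field3 a b c 0 0 0 0 0 0 x 0 0 ->
  [/\ a = 0, b = 0, c = 0 & x = 0].
Proof.
move=> X; have [||M0 v0] := field3_parallel (i := i0) X.
- by apply: ord3P; rewrite ?eqxx //; apply: ord3P => _; rewrite /mat9 matE.
- by apply: ord3P; rewrite ?eqxx // => _; rewrite vecE.
move: M0 v0; rewrite mat90 vec0E => /mat9_inj[[-> -> ->] _] /vec_inj[-> _ _].
by split.
Qed.

Lemma field3_row1 d e f y : field3 0 0 0 d e f 0 0 0 0 y 0 ->
  [/\ d = 0, e = 0, f = 0 & y = 0].
Proof.
move=> X; have [||M0 v0] := field3_parallel (i := i1) X.
- by apply: ord3P; rewrite ?eqxx //; apply: ord3P => _; rewrite /mat9 matE.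
- by apply: ord3P; rewrite ?eqxx // => _; rewrite vecE.
move: M0 v0; rewrite mat90 vec0E => /mat9_inj[_ [[-> -> ->] _]] /vec_inj[_ -> _].
by split.
Qed.

Lemma field3_row2 g h k z : field3 0 0 0 0 0 0 g h k 0 0 z ->
  [/\ g = 0, h = 0, k = 0 & z = 0].
Proof.
move=> X; have [||M0 v0] := field3_parallel (i := i2) X.
- by apply: ord3P; rewrite ?eqxx //; apply: ord3P => _; rewrite /mat9 matE.
- by apply: ord3P; rewrite ?eqxx // => _; rewrite vecE.
move: M0 v0; rewrite mat90 vec0E => /mat9_inj[_ [_ [-> -> ->]]] /vec_inj[_ _ ->].
by split.
Qed.

End Classification.

Section Elliptic_case.
Variables (R : realType) (G : 'M[R]_3 -> space3 R -> Prop).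
Hypothesis HG : curved_algebra G.
Implicit Types (a b c d f g h k x y z : R).
Local Notation field3 := (field3 G).
Hypothesis rotG : field3 0 (-1) 0 1 0 0 0 0 0 0 0 0.

Lemma rot_bracket a b c d e f g h k x y z : field3 a b c d e f g h k x y z ->
  field3 (- (b + d)) (a - e) (- f) (a - e) (b + d) c (- h) g 0 (- y) x 0.
Proof.
by move=> X; apply: (field3_eq (field3_bracket HG rotG X)); ring.
Qed.

Lemma pos_sqr2_eq0 a b : a ^+ 2 + b ^+ 2 = 0 -> a = 0 /\ b = 0.
Proof. by move=> E; split; nra. Qed.

(** The part of weight 2 for the rotations generates, together with them, the fields
   x d/dy and y d/dx, which are parallel to a coordinate axis. *)
Lemma elliptic_weight2 a b c d e f g h k x y z : field3 a b c d e f g h k x y z ->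
  a = e /\ b = - d.
Proof.
move=> X; have X1 := rot_bracket X; have X2 := rot_bracket X1.
have X3 := rot_bracket X2; have X4 := rot_bracket X3.
pose P := (a - e) / 2; pose Q := (b + d) / 2.
have W : field3 P Q 0 Q (- P) 0 0 0 0 0 0 0.
  by apply: (field3_eq (field3_lin HG 12^-1 12^-1 X2 X4)); rewrite /P /Q; lra.
have W' : field3 (- Q) P 0 P Q 0 0 0 0 0 0 0.
  by apply: (field3_eq (field3_lin HG (2^-1) 0 (rot_bracket W) W)); lra.
have V : field3 0 (P ^+ 2 + Q ^+ 2) 0 (P ^+ 2 + Q ^+ 2) 0 0 0 0 0 0 0 0.
  by apply: (field3_eq (field3_lin HG Q P W W')); ring.
have : field3 0 0 0 (P ^+ 2 + Q ^+ 2) 0 0 0 0 0 0 0 0.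
  by apply: (field3_eq (field3_lin HG (2^-1) ((P ^+ 2 + Q ^+ 2) / 2) V rotG)); field.
case/(field3_row1 HG) => /pos_sqr2_eq0[P0 Q0] _ _ _.
by move: P0 Q0; rewrite /P /Q => P0 Q0; split; lra.
Qed.

(** The bracket with the rotation has the eigenvalues 0, i, -i, 2i and -2i; the
   components of a field for them are polynomials in the bracket. *)
Lemma elliptic_weight1 a b c d e f g h k x y z : field3 a b c d e f g h k x y z ->
  field3 0 0 c 0 0 f g h 0 x y 0.
Proof.
move=> X; have [ae bd] := elliptic_weight2 X.
have X2 := rot_bracket (rot_bracket X).
by apply: (field3_eq (field3_lin HG (-1) 0 X2 X)); rewrite ?ae ?bd; ring.
Qed.

Lemma elliptic_weight0 a b c d e f g h k x y z : field3 a b c d e f g h k x y z ->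
  field3 a 0 0 0 a 0 0 0 k 0 0 z.
Proof.
move=> X; have [ae bd] := elliptic_weight2 X.
have X1 := field3_lin HG 1 (-1) X (elliptic_weight1 X).
by apply: (field3_eq (field3_lin HG 1 (- d) X1 rotG)); rewrite ?ae ?bd; ring.
Qed.

(** Three tangent fields are linearly dependent at every point; the rotation, a
   diagonal field and a field of weight 1 are not, unless one of the last two is
   zero. *)
Lemma elliptic_no_scaling a z c f g h x y : field3 a 0 0 0 a 0 0 0 (- 2 * a) 0 0 z ->
  field3 0 0 c 0 0 f g h 0 x y 0 ->
  (a = 0 /\ z = 0) \/ [/\ [/\ c = 0, f = 0 & g = 0] & [/\ h = 0, x = 0 & y = 0]].
Proof.
move=> X W; have det := field3_det HG rotG X W.
have [a0|a0] := eqVneq a 0.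
  left; split=> //; move: X; rewrite a0 mulr0.
  by case/(field3_row2 HG).
right; have g0 : g = 0.
  apply: (mulfI a0); have := det 1 0 0; have := det 2 0 0; nra.
have h0 : h = 0.
  apply: (mulfI a0); have := det 0 1 0; have := det 0 2 0; nra.
have c0 : c = 0.
  apply: (mulfI a0); have := det 1 0 1; have := det 1 0 (-1); have := det 1 0 0.
  rewrite g0 h0; nra.
have f0 : f = 0.
  apply: (mulfI a0); have := det 0 1 1; have := det 0 1 (-1); have := det 0 1 0.
  rewrite g0 h0; nra.
have x0 : x = 0.
  apply: (mulfI a0); have := det 1 0 1; have := det 1 0 (-1); have := det 1 0 0.
  rewrite g0 h0 c0; nra.
have y0 : y = 0.
  apply: (mulfI a0); have := det 0 1 1; have := det 0 1 (-1); have := det 0 1 0.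
  rewrite g0 h0 f0; nra.
by [].
Qed.

(** Modulo the rotations about the axis, the second field is of weight 1; its bracket
   with its quarter turn is of weight 0, hence zero. This makes it an infinitesimal
   isometry of a quadric of revolution. The paraboloids, which have no center, are
   excluded because their infinitesimal isometries are not conjugate to a rotation
   generator by an isometry. *)
Lemma elliptic_pair a b c d e f g h k x y z :
  let M := mat9 a b c d e f g h k in let v := vec x y z in
  let J := mat9 0 (-1) 0 1 0 0 0 0 0 in
  G M v -> rotation_generator M -> (forall s, M = s *: J -> v = 0 -> False) ->
  exists t Q, [/\ nondegenerate Q, preserves Q (vec 0 0 t) J 0 &
                  preserves Q (vec 0 0 t) M v].
Proof.
move=> M v J X [trM dM M0 types] notprop.
have [ae bd] := elliptic_weight2 X; subst e b.
have W := elliptic_weight1 X.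
have ka : k = - 2 * a by move: trM; rewrite /M !mat9E; lra.
have X0 : field3 a 0 0 0 a 0 0 0 (- 2 * a) 0 0 z.
  by rewrite -ka; apply: elliptic_weight0 X.
have notW : ~ [/\ [/\ c = 0, f = 0 & g = 0] & [/\ h = 0, x = 0 & y = 0]].
  move=> [[c0 f0 g0] [h0 x0 y0]]; subst c f g h x y.
  have a0 : a = 0.
    move: dM; rewrite /M !mat9E ka => dM.
    have {}dM : a * (a ^+ 2 + d ^+ 2) = 0 by move: dM; lra.
    have [//|a0] := eqVneq a 0.
    by move/eqP: dM; rewrite mulf_eq0 (negPf a0) => /eqP/pos_sqr2_eq0[].
  rewrite a0 mulr0 in X0; have [_ _ _ z0] := field3_row2 HG X0.
  apply: (notprop d); last by rewrite /v z0 -vec0E.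
  by rewrite /M /J a0 ka a0 !mat9E; congr mat9; ring.
have [[a0 z0]|//] := elliptic_no_scaling X0 W.
subst a z; rewrite mulr0 in ka; subst k.
have W' := rot_bracket W.
have WW := elliptic_weight0 (field3_bracket HG W W').
have {}WW : field3 (f * g - c * h) 0 0 0 (f * g - c * h) 0 0 0
    (- 2 * (f * g - c * h)) 0 0 (2 * (h * x - g * y)).
  by apply: (field3_eq WW); ring.
have [[fg_ch hx_gy]|//] := elliptic_no_scaling WW W.
have gh0 : g ^+ 2 + h ^+ 2 != 0.
  apply/eqP => /pos_sqr2_eq0[g0 h0]; subst g h.
  case: types; rewrite /M !mat9E.
  - case/mat9_inj=> _ [_ [g0 h0 _]].
    have c0 : c = 0 by lra.
    have f0 : f = 0 by lra.
    subst c f.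
    have : field3 0 0 0 0 0 0 0 0 0 (x ^+ 2 + y ^+ 2) 0 0.
      by apply: (field3_eq (field3_lin HG x (- y) W W')); ring.
    by case/(field3_row0 HG) => _ _ _ /pos_sqr2_eq0[x0 y0]; apply: notW.
  - case/mat9_inj=> [[_ d0 c0] [[_ _ f0] _]]; case/eqP: M0.
    have {}d0 : d = 0 by lra.
    by rewrite /M d0 -c0 -f0 oppr0 -mat90.
  - case=> tr0; case/negP; apply/eqP.
    have d0 : d = 0 by nra.
    by rewrite d0 mat90; congr mat9; ring.
have cf0 : c * g + f * h != 0.
  apply/eqP => cf.
  have c0 : c = 0.
    apply: (mulfI gh0); rewrite mulr0.
    transitivity (g * (c * g + f * h) - h * (f * g - c * h)); first by ring.
    by rewrite cf fg_ch !mulr0 subr0.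
  have f0 : f = 0.
    apply: (mulfI gh0); rewrite mulr0.
    transitivity (h * (c * g + f * h) + g * (f * g - c * h)); first by ring.
    by rewrite cf fg_ch !mulr0 addr0.
  subst c f; case: types; rewrite /M !mat9E.
  - by case/mat9_inj=> _ [_ [g0 h0 _]]; case/eqP: gh0; nra.
  - by case/mat9_inj=> _ [_ [g0 h0 _]]; case/eqP: gh0; nra.
  - case=> tr0; case/negP; apply/eqP.
    have d0 : d = 0 by nra.
    by rewrite d0 mat90; congr mat9; ring.
pose s := g ^+ 2 + h ^+ 2; pose t := c * g + f * h; pose u := x * g + y * h.
have cE : s * c = t * g.
  by rewrite -[RHS]subr0 -(mulr0 h) -fg_ch /s /t; ring.
have fE : s * f = t * h.
  by rewrite -[RHS]addr0 -(mulr0 g) -fg_ch /s /t; ring.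
have hx : h * x - g * y = 0 by lra.
have xE : s * x = u * g.
  by rewrite -[RHS]addr0 -(mulr0 h) -hx /s /u; ring.
have yE : s * y = u * h.
  by rewrite -[RHS]subr0 -(mulr0 g) -hx /s /u; ring.
(* Now (c, f) = (t / s) (g, h) and (x, y) = (u / s) (g, h), so that the field kills
   the quadratic form s (X^2 + Y^2) - t (Z + u / t)^2 in the coordinates X, Y, Z. *)
exists (- u / t), (mat9 s 0 0 0 s 0 0 0 (- t)); split.
- split; rewrite !mat9E // (_ : _ + _ = - (s * s * t)); last by ring.
  by rewrite oppr_eq0 !mulf_neq0.
- by split; rewrite /J ?vec0E !mat9E ?mat90; [congr mat9|congr vec]; ring.
- split; rewrite /M /v ?vec0E !mat9E ?mat90.
    by congr mat9; lra.
  congr vec; last ring.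
    apply: (mulfI gh0); rewrite -/s mulr0.
    transitivity (s * c * (- u / t) + s * x); first by ring.
    by rewrite cE xE; field.
  apply: (mulfI gh0); rewrite -/s mulr0.
  transitivity (s * f * (- u / t) + s * y); first by ring.
  by rewrite fE yE; field.
Qed.

End Elliptic_case.

Section Hyperbolic_case.
Variables (R : realType) (G : 'M[R]_3 -> space3 R -> Prop).
Hypothesis HG : curved_algebra G.
Implicit Types (a b c d f g h k x y z : R).
Local Notation field3 := (field3 G).
Hypothesis boostG : field3 1 0 0 0 (-1) 0 0 0 0 0 0 0.

Lemma boost_bracket a b c d e f g h k x y z : field3 a b c d e f g h k x y z ->
  field3 0 (2 * b) c (- 2 * d) 0 (- f) (- g) h 0 x (- y) 0.
Proof.
by move=> X; apply: (field3_eq (field3_bracket HG boostG X)); ring.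
Qed.

Lemma hyperbolic_weight2 a b c d e f g h k x y z : field3 a b c d e f g h k x y z ->
  b = 0 /\ d = 0.
Proof.
move=> X; have X1 := boost_bracket X; have X2 := boost_bracket X1.
have X3 := boost_bracket X2; have X4 := boost_bracket X3.
have W : field3 0 b 0 d 0 0 0 0 0 0 0 0.
  by apply: (field3_eq (field3_lin HG 12^-1 (- 12^-1) X4 X2)); lra.
have W' := boost_bracket W.
have : field3 0 b 0 0 0 0 0 0 0 0 0 0.
  by apply: (field3_eq (field3_lin HG (2^-1) (4^-1) W W')); lra.
case/(field3_row0 HG) => _ b0 _ _.
have : field3 0 0 0 d 0 0 0 0 0 0 0 0.
  by apply: (field3_eq (field3_lin HG (2^-1) (- 4^-1) W W')); lra.
by case/(field3_row1 HG) => d0 _ _ _; split.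
Qed.

(** The bracket with the boost has the eigenvalues 0, 1, -1, 2 and -2, the last two of
   which do not occur. *)
Lemma hyperbolic_weights a b c d e f g h k x y z : field3 a b c d e f g h k x y z ->
  [/\ field3 a 0 0 0 e 0 0 0 k 0 0 z, field3 0 0 c 0 0 0 0 h 0 x 0 0 &
      field3 0 0 0 0 0 f g 0 0 0 y 0].
Proof.
move=> X; have [b0 d0] := hyperbolic_weight2 X; subst b d.
have X1 := boost_bracket X; have X2 := boost_bracket X1.
split.
- by apply: (field3_eq (field3_lin HG 1 (-1) X X2)); ring.
- by apply: (field3_eq (field3_lin HG (2^-1) (2^-1) X1 X2)); lra.
- by apply: (field3_eq (field3_lin HG (- 2^-1) (2^-1) X1 X2)); lra.
Qed.

(** Together with a second diagonal field the boosts only leave the functions of x y z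
   invariant, for a suitable origin, and no field of weight 1 or -1 preserves these:
   it would make three independent tangent fields. *)
Lemma hyperbolic_torus a e k z c h x f g y : field3 a 0 0 0 e 0 0 0 k 0 0 z ->
  field3 0 0 c 0 0 0 0 h 0 x 0 0 -> field3 0 0 0 0 0 f g 0 0 0 y 0 ->
  a + e + k = 0 -> k != 0 ->
  [/\ c = 0, h = 0 & x = 0] /\ [/\ f = 0, g = 0 & y = 0].
Proof.
move=> X A B tr k0; have ek : e = - a - k by lra.
subst e; have detA := field3_det HG boostG X A.
have detB := field3_det HG boostG X B.
split.
  have h0 : h = 0.
    by apply: (mulfI k0); have := detA 1 1 0; have := detA 0 1 0; nra.
  have c0 : c = 0.
    apply: (mulfI k0); have := detA 0 1 0; have := detA 0 1 1; have := detA 0 1 (-1).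
    rewrite h0; nra.
  split=> //; apply: (mulfI k0).
  by have := detA 0 1 1; have := detA 0 1 (-1); rewrite h0 c0; nra.
have g0 : g = 0.
  by apply: (mulfI k0); have := detB 1 1 0; have := detB 1 0 0; nra.
have f0 : f = 0.
  apply: (mulfI k0); have := detB 1 0 0; have := detB 1 0 1; have := detB 1 0 (-1).
  rewrite g0; nra.
split=> //; apply: (mulfI k0).
by have := detB 1 0 1; have := detB 1 0 (-1); rewrite g0 f0; nra.
Qed.

(** A part of weight 0 that is no multiple of the boost gives the torus. Otherwise the
   bracket of the parts of weight 1 and -1, again of weight 0, is a multiple of the
   boost, and this says that the two parts preserve a common quadratic form. *)
Lemma hyperbolic_pair a b c d e f g h k x y z :
  let M := mat9 a b c d e f g h k in let v := vec x y z in
  let D := mat9 1 0 0 0 (-1) 0 0 0 0 in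
  G M v -> rotation_generator M -> (forall s, M = s *: D -> v = 0 -> False) ->
  exists t,
    (exists Q, [/\ nondegenerate Q, preserves Q (vec 0 0 t) D 0 &
                  preserves Q (vec 0 0 t) M v]) \/
    (exists a' e' k', [/\ M = mat9 a' 0 0 0 e' 0 0 0 k',
        M *m vec 0 0 t + v = 0, a' + e' + k' = 0 & k' != 0]).
Proof.
move=> M v D X [trM dM M0 types] notprop.
have [b0 d0] := hyperbolic_weight2 X; subst b d.
have [X0 A B] := hyperbolic_weights X.
have tr : a + e + k = 0 by move: trM; rewrite /M !mat9E.
have [k0|k0] := eqVneq k 0; last first.
  have [[c0 h0 x0] [f0 g0 y0]] := hyperbolic_torus X0 A B tr k0.
  subst c h x f g y; exists (- z / k); right; exists a, e, k; split=> //.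
  by rewrite /M /v !mat9E vec0E; congr vec; field.
subst k; have ea : e = - a by lra.
subst e.
have z0 : z = 0.
  have : field3 0 0 0 0 0 0 0 0 0 0 0 z.
    by apply: (field3_eq (field3_lin HG 1 (- a) X0 boostG)); ring.
  by case/(field3_row2 HG).
subst z.
have C := field3_bracket HG A B.
have {}C : field3 (c * g) 0 0 0 (- (h * f)) 0 0 0 (h * f - c * g) 0 0 (h * y - g * x).
  by apply: (field3_eq C); ring.
have notAB : ~ ([/\ c = 0, h = 0 & x = 0] /\ [/\ f = 0, g = 0 & y = 0]).
  move=> [[c0 h0 x0] [f0 g0 y0]]; subst c h x f g y.
  apply: (notprop a); last by rewrite /v -vec0E.
  by rewrite /M /D !mat9E; congr mat9; ring.
have hf : h * f = c * g.
  apply/eqP; rewrite -subr_eq0; apply/eqP.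
  have [//|ne] := eqVneq (h * f - c * g) 0.
  by case: notAB; apply: (hyperbolic_torus C A B _ ne); ring.
have hy : h * y = g * x.
  have : field3 0 0 0 0 0 0 0 0 0 0 0 (h * y - g * x).
    by apply: (field3_eq (field3_lin HG 1 (- (c * g)) C boostG)); rewrite ?hf; ring.
  by case/(field3_row2 HG) => _ _ _; lra.
have nilcase : \tr (M *m M) = 0 -> c * g + h * f = 0 -> a = 0.
  by rewrite /M !mat9E => tr0 cg; nra.
have [h0|h0] := eqVneq h 0.
  subst h; have [c0 _ x0] : [/\ c = 0, c = 0 & x = 0].
    have : field3 0 0 c 0 0 0 0 0 0 x 0 0 by [].
    by case/(field3_row0 HG) => _ _ -> ->.
  subst c x.
  have g0 : g != 0.
    apply/eqP => g0; subst g; case: notAB; split; split=> //.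
      by case: (field3_row1 HG B) => _ _ -> _.
    by case: (field3_row1 HG B).
  have f0 : f != 0.
    apply/eqP => f0; subst f; case: types; rewrite /M !mat9E.
    - by case/mat9_inj=> [[_ _ E] _]; case/eqP: g0; lra.
    - by case/mat9_inj=> [[_ _ E] _]; case/eqP: g0; lra.
    - case=> tr0; case/negP; apply/eqP.
      have a0 : a = 0 by apply: nilcase; [rewrite /M !mat9E|ring].
      by rewrite a0 mat90; congr mat9; ring.
  (* The invariant form is f (Z + y / f)^2 - 2 g X Y. *)
  exists (- y / f); left; exists (mat9 0 (- g) 0 (- g) 0 0 0 0 f); split.
  - split; rewrite !mat9E // (_ : _ + _ = - (g * g * f)); last by ring.
    by rewrite oppr_eq0 !mulf_neq0.
  - by split; rewrite /D ?vec0E !mat9E ?mat90; [congr mat9|congr vec]; ring.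
  - split; rewrite /M /v ?vec0E !mat9E ?mat90; first by congr mat9; ring.
    by congr vec; field.
have c0 : c != 0.
  apply/eqP => c0; subst c.
  have f0 : f = 0 by apply: (mulfI h0); rewrite hf; ring.
  subst f; case: types; rewrite /M !mat9E.
  - by case/mat9_inj=> _ [[_ _ E] _]; case/eqP: h0; lra.
  - by case/mat9_inj=> _ [[_ _ E] _]; case/eqP: h0; lra.
  - case=> tr0; case/negP; apply/eqP.
    have a0 : a = 0 by apply: nilcase; [rewrite /M !mat9E|ring].
    by rewrite a0 mat90; congr mat9; ring.
have gE : g = h * f / c by rewrite hf mulrAC divff // mul1r.
have yE : y = f * x / c.
  by apply: (mulfI h0); rewrite hy gE; field.
(* The invariant form is c (Z + x / c)^2 - 2 h X Y. *)
exists (- x / c); left; exists (mat9 0 (- h) 0 (- h) 0 0 0 0 c); split.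
- split; rewrite !mat9E // (_ : _ + _ = - (h * h * c)); last by ring.
  by rewrite oppr_eq0 !mulf_neq0.
- by split; rewrite /D ?vec0E !mat9E ?mat90; [congr mat9|congr vec]; ring.
- split; rewrite /M /v ?vec0E !mat9E ?mat90.
    by congr mat9; rewrite ?gE; field.
  by congr vec; rewrite ?yE; field.
Qed.

End Hyperbolic_case.

Section Parabolic_case.
Variables (R : realType) (G : 'M[R]_3 -> space3 R -> Prop).
Hypothesis HG : curved_algebra G.
Implicit Types (a b c d f g h k x y z : R).
Local Notation field3 := (field3 G).
Hypothesis shearG : field3 0 0 0 1 0 0 0 1 0 0 0 0.

Lemma shear_bracket a b c d e f g h k x y z : field3 a b c d e f g h k x y z ->
  field3 (- b) (- c) 0 (a - e) (b - f) c (d - h) (e - k) f 0 x y.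
Proof.
by move=> X; apply: (field3_eq (field3_bracket HG shearG X)); ring.
Qed.

(** Iterated brackets with the nilpotent generator end in fields parallel to the
   z-axis. *)
Lemma parabolic_weights a b c d e f g h k x y z : field3 a b c d e f g h k x y z ->
  [/\ c = 0, f = b, a - 2 * e + k = 0 & x = 0].
Proof.
move=> X; have X1 := shear_bracket X; have X2 := shear_bracket X1.
have X3 := shear_bracket X2; have X4 := shear_bracket X3.
have c0 : c = 0.
  have : field3 0 0 0 0 0 0 (6 * c) 0 0 0 0 0 by apply: (field3_eq X4); ring.
  by case/(field3_row2 HG) => c0 _ _ _; lra.
subst c.
have fb : f = b.
  have : field3 0 0 0 0 0 0 (3 * (f - b)) 0 0 0 0 0 by apply: (field3_eq X3); ring.
  by case/(field3_row2 HG) => fb _ _ _; lra.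
subst f.
have : field3 0 0 0 0 0 0 (a - 2 * e + k) 0 0 0 0 x.
  by apply: (field3_eq (field3_lin HG 1 b X2 shearG)); ring.
by case/(field3_row2 HG) => E _ _ x0; split.
Qed.

(** The coefficient b of the second field is not zero, as otherwise the field would be a
   multiple of the generator. Its bracket with the generator and the dependence of
   three tangent fields then determine all the coefficients in terms of a, b, d, h
   and y. *)
Lemma parabolic_pair a b c d e f g h k x y z :
  let M := mat9 a b c d e f g h k in let v := vec x y z in
  let N := mat9 0 0 0 1 0 0 0 1 0 in
  G M v -> \tr M = 0 -> \tr (M *m M) = 0 ->
  (forall s, M = s *: N -> v = 0 -> False) ->
  exists t Q, [/\ nondegenerate Q, preserves Q (vec 0 0 t) N 0 &
                  preserves Q (vec 0 0 t) M v].
Proof.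
move=> M v N X trM trM2 notprop.
have [c0 fb aek x0] := parabolic_weights X; subst c f x.
have e0 : e = 0 by move: trM; rewrite /M !mat9E; lra.
have ka : k = - a by lra.
subst e k.
have Y : field3 (- b) 0 0 0 0 0 (d - h) 0 b 0 0 y.
  by apply: (field3_eq (field3_lin HG 1 (- a) (shear_bracket X) shearG)); ring.
have [b0|b0] := eqVneq b 0.
  exfalso; subst b; rewrite oppr0 in Y.
  have [dh _ _ y0] := field3_row2 HG Y.
  have a0 : a = 0 by move: trM2; rewrite /M !mat9E => E; nra.
  subst a y; have hd : h = d by lra.
  subst h.
  have : field3 0 0 0 0 0 0 g 0 0 0 0 z.
    by apply: (field3_eq (field3_lin HG 1 (- d) X shearG)); ring.
  case/(field3_row2 HG) => g0 _ _ z0; subst g z.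
  apply: (notprop d); last by rewrite /v -vec0E.
  by rewrite /M /N !mat9E; congr mat9; ring.
have Z : field3 0 b 0 ((d - h) / 2) 0 b (g + a * (d - h) / b) (- ((d - h) / 2)) 0
    0 y (z + a * y / b).
  have Z1 := field3_lin HG 1 (- ((d + h) / 2)) X shearG.
  by apply: (field3_eq (field3_lin HG 1 (a / b) Z1 Y)); field.
have det := field3_det HG shearG Y Z.
have [m0 w0] : g + a * (d - h) / b = 0 /\ z + a * y / b = 0.
  move: (g + _) (z + _) det => m w det.
  have p := det 1 0 0; have q := det (-1) 0 0.
  have {}p : b * (m + w) = 0 by rewrite -[RHS]p; field.
  have {}q : b * (w - m) = 0 by rewrite -[RHS]q; field.
  move/eqP: p; rewrite mulf_eq0 (negPf b0) => /eqP p.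
  move/eqP: q; rewrite mulf_eq0 (negPf b0) => /eqP q.
  by split; lra.
have gE : g = - (a * (d - h) / b) by lra.
have zE : z = - (a * y / b) by lra.
(* The invariant form is Y^2 - 2 X (Z + y / b) - ((d - h) / b) X^2. *)
exists (- y / b), (mat9 (- (d - h) / b) 0 (-1) 0 1 0 (-1) 0 0); split.
- split; rewrite !mat9E // (_ : _ + _ = -1); last by ring.
  by rewrite oppr_eq0 oner_eq0.
- by split; rewrite /N ?vec0E !mat9E ?mat90; [congr mat9|congr vec]; ring.
- split; rewrite /M /v ?vec0E !mat9E ?mat90.
    by congr mat9; rewrite ?gE; field.
  by congr vec; rewrite ?zE; field.
Qed.

End Parabolic_case.

(** * Two axes *)

Section Frames.
Variable R : realType.
Implicit Types (F : poly3 R) (p v w e r u P : space3 R) (M N W B Q : 'M[R]_3).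

Lemma dotBr v w u : dot v (w - u) = dot v w - dot v u.
Proof. by rewrite !dotE !mxE; ring. Qed.

Lemma orthogonalC W : W^T *m W = 1%:M -> W *m W^T = 1%:M.
Proof. exact: mulmx1C. Qed.

Lemma orthogonal_det W : W^T *m W = 1%:M -> \det W != 0.
Proof.
move=> WW; have /eqP : \det (W^T *m W) = 1 by rewrite WW det1.
rewrite det_mulmx det_tr; apply: contraTneq => ->.
by rewrite mul0r eq_sym oner_eq0.
Qed.

(** The tangent fields in the coordinates y of an orthonormal frame W at P,
   where p = P + W y. *)
Definition frame_field F W P M v :=
  tangent_field F (W *m M *m W^T) (W *m v - W *m M *m W^T *m P).

Lemma frame_fieldE W P M v q : W^T *m W = 1%:M ->
  W *m M *m W^T *m (P + W *m q) + (W *m v - W *m M *m W^T *m P) = W *m (M *m q + v).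
Proof.
move=> WW; rewrite !mulmxDr -!mulmxA [W^T *m (W *m q)]mulmxA WW mul1mx.
by rewrite addrC addrA subrK addrC.
Qed.

Lemma frame_curved_algebra F p W P : curved_algebraically F p -> W^T *m W = 1%:M ->
  curved_algebra (frame_field F W P).
Proof.
move=> curv WW; have WW' := orthogonalC WW; have dW := orthogonal_det WW.
split.
- move=> a b M v N w X Y; have := tangent_field_lin a b X Y; rewrite /frame_field.
  suff -> : W *m (a *: M + b *: N) *m W^T =
            a *: (W *m M *m W^T) + b *: (W *m N *m W^T).
    suff -> : forall K L : 'M[R]_3, W *m (a *: v + b *: w) - (a *: K + b *: L) *m P =
        a *: (W *m v - K *m P) + b *: (W *m w - L *m P) by [].
    move=> K L; rewrite mulmxDr mulmxDl -!scalemxAr -!scalemxAl !scalerBr opprD.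
    by rewrite addrACA.
  by rewrite mulmxDr mulmxDl -!scalemxAr -!scalemxAl.
- move=> M v N w X Y; have := tangent_field_bracket X Y; rewrite /frame_field.
  have E (K L : 'M[R]_3) : W *m K *m W^T *m (W *m L *m W^T) = W *m (K *m L) *m W^T.
    by rewrite -!mulmxA [W^T *m (W *m _)]mulmxA WW mul1mx.
  have E' (K : 'M[R]_3) u : W *m K *m W^T *m (W *m u) = W *m (K *m u).
    by rewrite -!mulmxA [W^T *m (W *m _)]mulmxA WW mul1mx.
  rewrite !E -mulmxBl -mulmxBr; congr (tangent_field F _ _).
  rewrite !mulmxBr !E' ![_ *m (_ *m P)]mulmxA !E !mulmxBl.
  by rewrite !opprB addrACA [RHS]addrACA; congr (_ + _); rewrite addrC.
- move=> M v N w K u X Y Z q.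
  have := tangent_field_det curv X Y Z (P + W *m q).
  rewrite !frame_fieldE // det3_mulmx => /eqP.
  by rewrite mulf_eq0 (negPf dW) => /eqP.
- move=> M v r s e X e0 par q.
  have We0 : W *m e != 0.
    by apply: contra_neq e0 => We; rewrite -[e]mul1mx -WW -mulmxA We mulmx0.
  have par' u : W *m M *m W^T *m u + (W *m v - W *m M *m W^T *m P) =
      (dot (W *m r) u + (s - dot (W *m r) P)) *: (W *m e).
    pose y := W^T *m (u - P).
    have uE : u = P + W *m y by rewrite /y mulmxA WW' mul1mx addrC subrK.
    rewrite {1}uE frame_fieldE // par -scalemxAr; congr (_ *: _).
    by rewrite !dot_trmx /y mulmxBr dotBr; ring.
  have := tangent_field_parallel curv X We0 par' (P + W *m q).
  rewrite frame_fieldE // => /(congr1 (mulmx W^T)).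
  by rewrite mulmxA WW mul1mx mulmx0.
Qed.

End Frames.

Section Pairs_of_axes.
Variable R : realType.
Implicit Types (F : poly3 R) (p v w q y P : space3 R) (M N W B Q : 'M[R]_3).
Implicit Types (k : rotation_type) (A : set (space3 R)).

(** The infinitesimal generators of the three canonical groups; the hyperbolic
   one is written in the basis of its eigenvectors. *)
Definition canonical_generator k : 'M[R]_3 :=
  match k with
  | Elliptic => mat9 0 (-1) 0 1 0 0 0 0 0
  | Hyperbolic => mat9 1 0 0 0 (-1) 0 0 0 0
  | Parabolic => mat9 0 0 0 1 0 0 0 1 0
  end.

Lemma canonical_rotation_generator k : rotation_generator (canonical_generator k).
Proof.
have ne a b c d e f g h (j : R) : mat9 a b c d e f g h j = 0 ->
    [/\ a = 0, b = 0 & c = 0] /\ [/\ d = 0, e = 0 & f = 0] /\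
    [/\ g = 0, h = 0 & j = 0] by rewrite mat90 => /mat9_inj.
case: k; rewrite /rotation_generator /= !mat9E; split; try ring.
- by apply/eqP => /ne[_ [[/eqP]]]; rewrite oner_eq0.
- by apply: Or31; congr mat9; ring.
- by apply/eqP => /ne[[/eqP]]; rewrite oner_eq0.
- by apply: Or32; congr mat9; ring.
- by apply/eqP => /ne[_ [[/eqP]]]; rewrite oner_eq0.
- apply: Or33; split; first by ring.
  by apply/eqP => /ne[_ [_ [/eqP]]]; rewrite ?(mulr0, mulr1, addr0, add0r) oner_eq0.
Qed.

Lemma conj_mul W M N : W^T *m W = 1%:M ->
  W^T *m M *m W *m (W^T *m N *m W) = W^T *m (M *m N) *m W.
Proof.
by move=> WW; rewrite -!mulmxA [W *m (W^T *m _)]mulmxA orthogonalC // mul1mx.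
Qed.

Lemma conj_trace W M : W^T *m W = 1%:M -> \tr (W^T *m M *m W) = \tr M.
Proof. by move=> WW; rewrite mxtrace_mulC mulmxA orthogonalC // mul1mx. Qed.

Lemma rotation_generator_conj W M : W^T *m W = 1%:M -> rotation_generator M ->
  rotation_generator (W^T *m M *m W).
Proof.
move=> WW [trM dM M0 types]; have WW' := orthogonalC WW.
have ne K : K != 0 -> W^T *m K *m W != 0.
  apply: contra_neq => E.
  have -> : K = W *m (W^T *m K *m W) *m W^T.
    by rewrite !mulmxA WW' mul1mx -mulmxA WW' mulmx1.
  by rewrite E mulmx0 mul0mx.
split; [by rewrite conj_trace|by rewrite !det_mulmx dM mulr0 mul0r|exact: ne|].
rewrite conj_mul // conj_trace // !trmx_mul trmxK mulmxA.
case: types => [->|->|[t0 n0]]; [apply: Or31|exact: Or32|apply: Or33].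
  by rewrite mulmxN mulNmx.
by split=> //; apply: ne.
Qed.

Lemma canonical_kernel k y :
  canonical_generator k *m y = 0 <-> y i0 0 = 0 /\ y i1 0 = 0.
Proof.
rewrite {1}[y]vec_eta; case: k; rewrite /= !mat9E vec0E; split=> [/vec_inj[]|[-> ->]].
all: rewrite ?(mul0r, mul1r, mulN1r, mulr0, addr0, add0r, oppr0) //.
all: by move=> *; split; lra.
Qed.

Lemma canonical_cross_proportional k M :
  (forall y, cross (canonical_generator k *m y) (M *m y) = 0) ->
  exists s, M = s *: canonical_generator k.
Proof.
move=> H; rewrite [M]mat9_eta in H *; move: H.
move: (M i0 i0) (M i0 i1) (M i0 i2) (M i1 i0) (M i1 i1) (M i1 i2) (M i2 i0) (M i2 i1)
  (M i2 i2) => a b c d e f g h j H.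
have {}H (x y z : R) : let u := canonical_generator k *m vec x y z in
    let v := mat9 a b c d e f g h j *m vec x y z in
    [/\ u i1 0 * v i2 0 - u i2 0 * v i1 0 = 0,
        u i2 0 * v i0 0 - u i0 0 * v i2 0 = 0 &
        u i0 0 * v i1 0 - u i1 0 * v i0 0 = 0].
  by have := H (vec x y z); rewrite /cross [X in _ = X]vec0E => /vec_inj.
have := H 1 0 0; have := H 0 1 0; have := H 1 1 0; have := H 1 0 1; have := H 0 1 1.
case: k H => _; rewrite /= !mat9E !vecE => -[? ? ?] [? ? ?] [? ? ?] [? ? ?] [? ? ?].
- by exists d; rewrite mat9_scale; congr mat9; lra.
- by exists a; rewrite mat9_scale; congr mat9; lra.
- by exists d; rewrite mat9_scale; congr mat9; lra.
Qed.

Lemma frame_pair (G : 'M[R]_3 -> space3 R -> Prop) k M v : curved_algebra G ->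
  G (canonical_generator k) 0 -> G M v -> rotation_generator M ->
  (k = Parabolic -> \tr (M *m M) = 0) ->
  (forall s, M = s *: canonical_generator k -> v = 0 -> False) ->
  exists q, [/\ canonical_generator k *m q = 0, M *m q + v = 0 &
    (exists Q, [/\ nondegenerate Q,
        Q *m canonical_generator k + (canonical_generator k)^T *m Q = 0 &
        Q *m M + M^T *m Q = 0]) \/
    (k = Hyperbolic /\ exists a e j, [/\ M = mat9 a 0 0 0 e 0 0 0 j,
        a + e + j = 0 & j != 0])].
Proof.
move=> HG Gk GM gM par; rewrite vec0E in Gk.
rewrite [M]mat9_eta [v]vec_eta in GM gM par *; move=> notprop.
case: k par Gk notprop => /= par Gk notprop.
- have [t [Q [nQ [Q1 t1] [Q2 t2]]]] := elliptic_pair HG Gk GM gM notprop.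
  exists (vec 0 0 t); split=> //; first by rewrite -[LHS]addr0.
  by left; exists Q.
- have [t [[Q [nQ [Q1 t1] [Q2 t2]]]|[a [e [j [ME t2 tr j0]]]]]] :=
    hyperbolic_pair HG Gk GM gM notprop.
    exists (vec 0 0 t); split=> //; first by rewrite -[LHS]addr0.
    by left; exists Q.
  exists (vec 0 0 t); split=> //; first by rewrite !mat9E vec0E; congr vec; ring.
  by right; split=> //; exists a, e, j.
- have [trM _ _ _] := gM.
  have [t [Q [nQ [Q1 t1] [Q2 t2]]]] :=
    parabolic_pair HG Gk GM trM (par erefl) notprop.
  exists (vec 0 0 t); split=> //; first by rewrite -[LHS]addr0.
  by left; exists Q.
Qed.

(** What remains of an axis of rotation once the group is replaced by its generator. *)
Definition frame_axis F k W P A :=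
  [/\ W^T *m W = 1%:M, frame_field F W P (canonical_generator k) 0 &
      A = [set p | canonical_generator k *m (W^T *m (p - P)) = 0]].

(** Two linear fields centered at P that kill F, with a polynomial invariant of
   degree 2, or of degree 3 when they span the torus of the diagonal fields of
   trace 0 in an orthonormal frame. *)
Definition centered_pair F P := exists B1 B2,
  [/\ forall p, dot (grad F p) (B1 *m (p - P)) = 0,
      forall p, dot (grad F p) (B2 *m (p - P)) = 0,
      exists y, cross (B1 *m y) (B2 *m y) != 0 &
      (exists Q, [/\ nondegenerate Q, Q *m B1 + B1^T *m Q = 0 &
                    Q *m B2 + B2^T *m Q = 0]) \/
      (exists W a e j, [/\ W^T *m W = 1%:M,
          B1 = W *m mat9 1 0 0 0 (-1) 0 0 0 0 *m W^T,
          B2 = W *m mat9 a 0 0 0 e 0 0 0 j *m W^T, a + e + j = 0 & j != 0])].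

Lemma axis_direction k W q p : W^T *m W = 1%:M ->
  canonical_generator k *m (W^T *m q) = 0 -> canonical_generator k *m (W^T *m p) = 0 ->
  q <> 0 -> exists c : R, p = c *: q.
Proof.
move=> WW /canonical_kernel[q0 q1] /canonical_kernel[p0 p1] qn0.
have WE (u : space3 R) : u = W *m (W^T *m u) by rewrite mulmxA orthogonalC // mul1mx.
have q2 : (W^T *m q) i2 0 != 0.
  apply/eqP => q2; apply: qn0; rewrite (WE q) (_ : W^T *m q = 0) ?mulmx0 //.
  by apply: vec_ext; rewrite [RHS]mxE.
exists ((W^T *m p) i2 0 / (W^T *m q) i2 0).
rewrite {1}(WE p) {2}(WE q) scalemxAr; congr (_ *m _).
by apply: vec_ext; rewrite [RHS]mxE ?p0 ?q0 ?p1 ?q1 ?mulr0 // mulfVK.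
Qed.

(** Both axes are lines. *)
Lemma frame_axis_sub F k1 W1 P1 A k2 W2 P2 A' P q :
  frame_axis F k1 W1 P1 A -> frame_axis F k2 W2 P2 A' ->
  A P -> A' P -> A q -> A' q -> q <> P -> A `<=` A'.
Proof.
move=> [WW1 _ ->] [WW2 _ ->] /= AP A'P Aq A'q qP p /= Ap.
have diff K (u r : space3 R) P0 : K *m (u - P0) = 0 -> K *m (r - P0) = 0 ->
    K *m (u - r) = 0 :> space3 R.
  move=> u0 r0; rewrite (_ : u - r = (u - P0) - (r - P0)).
    by rewrite mulmxBr u0 r0 subrr.
  by rewrite opprB addrA subrK.
rewrite !mulmxA in AP A'P Aq A'q Ap *.
have /= qP0 : q - P <> 0 by move=> /subr0_eq.
have [||c cE] := @axis_direction k1 W1 (q - P) (p - P) WW1 _ _ qP0.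
- by rewrite mulmxA; apply: diff Aq AP.
- by rewrite mulmxA; apply: diff Ap AP.
rewrite (_ : p - P2 = (p - P) + (P - P2)); last by rewrite addrA subrK.
by rewrite mulmxDr A'P addr0 cE -scalemxAr (diff _ _ _ _ A'q A'P) scaler0.
Qed.

(** The second field is written in the frame of the first axis, where the case analysis
   applies. The order matters because a parabolic first generator needs tr (M^2) = 0
   for the second one, that is, a second generator that is parabolic too. *)
Lemma axes_meet_ordered F p k1 W1 P1 A k2 W2 P2 A' : curved_algebraically F p ->
  frame_axis F k1 W1 P1 A -> frame_axis F k2 W2 P2 A' -> A <> A' ->
  (k1 = Parabolic -> k2 = Parabolic) ->
  exists P, [/\ A P, A' P & centered_pair F P].
Proof.
move=> curv [WW1 X1 AE] [WW2 X2 A'E] AA' ord.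
have WW1' := orthogonalC WW1; have WW2' := orthogonalC WW2.
pose C1 := canonical_generator k1; pose C2 := canonical_generator k2.
pose V := W2^T *m W1; pose M := V^T *m C2 *m V.
have VV : V^T *m V = 1%:M.
  by rewrite /V trmx_mul trmxK -mulmxA [W2 *m _]mulmxA WW2' mul1mx.
pose B2 := W2 *m C2 *m W2^T.
have B2E : W1 *m M *m W1^T = B2.
  rewrite /M /V trmx_mul trmxK !mulmxA WW1' mul1mx -!mulmxA WW1' mulmx1.
  by rewrite /B2 !mulmxA.
pose v := W1^T *m (B2 *m (P1 - P2)).
have vE : W1 *m v = B2 *m (P1 - P2) by rewrite /v mulmxA WW1' mul1mx.
have genM : rotation_generator M.
  exact: rotation_generator_conj (canonical_rotation_generator k2).
have X2' : frame_field F W1 P1 M v.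
  rewrite /frame_field B2E vE mulmxBr addrAC subrr add0r.
  by move: X2; rewrite /frame_field mulmx0 add0r.
have fieldE u : B2 *m (u - P2) = W1 *m (M *m (W1^T *m (u - P1)) + v).
  have E : W1 *m (M *m (W1^T *m (u - P1))) = B2 *m (u - P1) by rewrite -B2E !mulmxA.
  by rewrite [RHS]mulmxDr vE E -mulmxDr addrA subrK.
have A'E' u : A' u <-> M *m (W1^T *m (u - P1)) + v = 0.
  rewrite A'E /=; split=> [u0|u0].
    have : W1 *m (M *m (W1^T *m (u - P1)) + v) = 0.
      by rewrite -fieldE /B2 -!mulmxA u0 mulmx0.
    by move/(congr1 (mulmx W1^T)); rewrite mulmxA WW1 mul1mx mulmx0.
  move: (fieldE u); rewrite u0 mulmx0 => /(congr1 (mulmx W2^T)).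
  by rewrite /B2 !mulmxA WW2 mul1mx mulmx0.
have notprop s : M = s *: C1 -> v = 0 -> False.
  move=> ME v0; apply: AA'; apply/seteqP.
  have s0 : s != 0.
    case: genM => _ _ + _; apply: contra_neq => s0.
    by rewrite ME s0 scale0r.
  split=> u; rewrite A'E' ME v0 addr0 -scalemxAl AE /= -/C1.
    by move=> ->; rewrite scaler0.
  by move/eqP; rewrite scaler_eq0 (negPf s0) => /eqP.
have par : k1 = Parabolic -> \tr (M *m M) = 0.
  move=> /ord k2P.
  by rewrite /M conj_mul // conj_trace // /C2 k2P /= !mat9E; ring.
have X1' : frame_field F W1 P1 C1 0 by [].
have [q [q1 q2 inv]] :=
  frame_pair (frame_curved_algebra P1 curv WW1) X1' X2' genM par notprop.
pose P := P1 + W1 *m q.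
have WP : W1^T *m (P - P1) = q.
  by rewrite /P addrAC subrr add0r mulmxA WW1 mul1mx.
have AP : A P by rewrite AE /= WP.
have A'P : A' P by rewrite A'E' WP.
exists P; split=> //.
pose B1 := W1 *m C1 *m W1^T.
exists B1, B2; split.
- move=> u; have := X1 u; rewrite /frame_field mulmx0 add0r -mulmxBr -/B1 => E.
  rewrite (_ : B1 *m (u - P) = B1 *m (u - P1)) //; apply/eqP.
  rewrite -subr_eq0 -mulmxBr (_ : _ - _ = - (P - P1)).
    by rewrite mulmxN /B1 -!mulmxA WP q1 mulmx0 oppr0.
  by rewrite !opprB addrC addrA subrK.
- move=> u; have := X2 u; rewrite /frame_field mulmx0 add0r -mulmxBr -/B2 => E.
  rewrite (_ : B2 *m (u - P) = B2 *m (u - P2)) //; apply/eqP.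
  rewrite -subr_eq0 -mulmxBr (_ : _ - _ = - (P - P2)).
    by rewrite mulmxN fieldE WP q2 mulmx0 oppr0.
  by rewrite !opprB addrC addrA subrK.
- apply: contrapT => noy.
  have cr y : cross (C1 *m y) (M *m y) = 0.
    apply: contrapT => ne; apply: noy; exists (W1 *m y).
    have -> : B1 *m (W1 *m y) = W1 *m (C1 *m y).
      by rewrite /B1 -!mulmxA [W1^T *m (W1 *m _)]mulmxA WW1 mul1mx.
    have -> : B2 *m (W1 *m y) = W1 *m (M *m y).
      by rewrite -B2E -!mulmxA [W1^T *m (W1 *m _)]mulmxA WW1 mul1mx.
    apply/eqP => E; apply: ne; have := mulmx_cross W1 (C1 *m y) (M *m y).
    rewrite E mulmx0 => /esym/eqP; rewrite scaler_eq0 (negPf (orthogonal_det WW1)).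
    by move/eqP.
  have [s sE] := canonical_cross_proportional cr.
  apply: (notprop s sE); move: q2; rewrite sE -scalemxAl q1 scaler0 add0r.
  by [].
case: inv => [[Q [[Qs dQ] Q1 Q2]]|[k1H [a [e [j [ME tr j0]]]]]]; [left|right].
  have conj N : Q *m N + N^T *m Q = 0 ->
      W1 *m Q *m W1^T *m (W1 *m N *m W1^T) +
      (W1 *m N *m W1^T)^T *m (W1 *m Q *m W1^T) = 0.
    move=> QN; rewrite !trmx_mul trmxK -!mulmxA ![W1^T *m (W1 *m _)]mulmxA WW1 !mul1mx.
    by rewrite -mulmxDr ![_ *m (_ *m W1^T)]mulmxA -mulmxDl QN mul0mx mulmx0.
  exists (W1 *m Q *m W1^T); split; last by rewrite -B2E; apply: conj.
    split; first by rewrite !trmx_mul trmxK Qs mulmxA.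
    by rewrite !det_mulmx det_tr !mulf_neq0 //; apply: orthogonal_det.
  exact: conj.
by exists W1, a, e, j; split=> //; rewrite /B1 /C1 ?k1H // -B2E ME.
Qed.

(** One of the two orders of the axes is admissible; two distinct lines have at most one
   common point. *)
Lemma axes_meet F p k1 W1 P1 A k2 W2 P2 A' : curved_algebraically F p ->
  frame_axis F k1 W1 P1 A -> frame_axis F k2 W2 P2 A' -> A <> A' ->
  exists P, A `&` A' = [set P] /\ centered_pair F P.
Proof.
move=> curv X1 X2 AA'.
suff [P [AP A'P cP]] : exists P, [/\ A P, A' P & centered_pair F P].
  exists P; split=> //; apply/seteqP; split=> [q [Aq A'q]|q ->//].
  apply: contrapT => /= qP; apply: AA'; apply/seteqP; split.
    exact: (frame_axis_sub X1 X2 AP A'P Aq A'q qP).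
  exact: (frame_axis_sub X2 X1 A'P AP A'q Aq qP).
have [k1P|k1P] := pselect (k1 = Parabolic -> k2 = Parabolic).
  exact: (axes_meet_ordered curv X1 X2 AA' k1P).
have A'A : A' <> A by move=> E; apply: AA'.
have [|P [A'P AP cP]] := axes_meet_ordered curv X2 X1 A'A.
  by move=> k2P; apply: contrapT => _; apply: k1P.
by exists P.
Qed.

End Pairs_of_axes.

(** * From an axis to a tangent field *)

Section Planes.
Variable R : realType.
Implicit Types (F : poly3 R) (p v r : space3 R) (W M : 'M[R]_3) (s t lam : R).

Lemma grad_affine_poly r s p : grad (affine_poly r s) p = r.
Proof.
apply: dot_ext => d.
have [_] := ev_line (affine_poly r s) p d 0; rewrite scale0r addr0 dotC => <-.
rewrite (_ : (fun t => _) = (fun t => dot r p + s + t * dot r d)); last first.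
  by apply/funext => t; rewrite ev_affine_poly dotDr dotZr addrAC.
by have [_ ->] := is_derive_affine (dot r p + s) (dot r d) 0; rewrite dotC.
Qed.

Lemma msize_affine_poly r s : (msize (affine_poly r s) <= 2)%N.
Proof.
apply: leq_trans (msizeD_le _ _) _; rewrite geq_max; apply/andP; split; last first.
  by rewrite msizeC; case: eqP.
apply: leq_trans (msize_sum _ _ _) _; apply/bigmax_leqP => i _.
by rewrite mul_mpolyC; apply: leq_trans (msizeZ_le _ _) _; rewrite msizeX mdeg1.
Qed.

Lemma irreducible_affine_poly r s : r != 0 -> irreducible3 (affine_poly r s).
Proof.
move=> r0; split.
  rewrite ltnNge; apply: contra_neqN r0 => /msize_le1P lE.
  by rewrite -(grad_affine_poly r s 0) lE gradC.
move=> G H GH; have [szG|szG] := leqP (msize G) 1; first by left.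
right; have [H0|H0] := eqVneq H 0; first by rewrite H0 msize0.
have G0 : G != 0 by apply: contraTneq szG => ->; rewrite msize0.
have := msize_affine_poly r s; rewrite GH msizeM //.
by case: (msize G) szG => [|[|a]] // _; rewrite !addSn /= ltnS; apply: leq_trans (leq_addl _ _).
Qed.

Lemma ev_along F p v : (forall q, dot (grad F q) v = 0) ->
  forall t, ev F (p + t *: v) = ev F p.
Proof.
move=> Fv t; rewrite -[in RHS](addr0 p) -[in RHS](scale0r v).
apply: (is_derive_0_is_cst (f := fun s => ev F (p + s *: v))) => s.
by have := ev_line F p v s; rewrite Fv.
Qed.

(** If the affine form did not divide F, then elimination of a variable transverse to
   the plane would give a nonzero polynomial that vanishes on the plane and does not
   depend on that variable. *)
Lemma divides_of_vanish_plane F r s : r != 0 ->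
  (forall p, dot r p + s = 0 -> ev F p = 0) -> divides (affine_poly r s) F.
Proof.
move=> r0 vF; apply: contrapT => ndiv.
have [i ri] := exists_coord r0.
have dl : mderiv i (affine_poly r s) != 0.
  apply: contraNneq ri => dl; have := grad_affine_poly r s 0.
  by move/(congr1 (fun u : space3 R => u i 0)); rewrite mxE dl ev0 => <-.
have lprime := irreducible3_prime (irreducible_affine_poly s r0).
have [u [v [g [g0 dg uv]]]] := eliminate lprime dl ndiv.
case/eqP: g0; apply: poly_vanish => p; pose e : space3 R := delta_mx i 0.
have ge q : dot (grad g q) e = 0 by rewrite dotC dot_delta mxE dg ev0.
rewrite -(ev_along p ge (- (dot r p + s) / r i 0)).
have on : dot r (p + (- (dot r p + s) / r i 0) *: e) + s = 0.
  by rewrite dotDr dotZr [dot r e]dotC dot_delta mulfVK // addrAC subrr.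
by rewrite -uv evD !evM ev_affine_poly on vF // !mulr0 addr0.
Qed.

(** F would be a constant multiple of the affine form, and a plane is a cylinder. *)
Lemma vanish_plane_not_curved F p r s : irreducible3 F -> curved_algebraically F p ->
  r != 0 -> (forall q, dot r q + s = 0 -> ev F q = 0) -> False.
Proof.
move=> [szF irr] curv r0 /(divides_of_vanish_plane r0) [H FE].
have lirr := irreducible_affine_poly s r0.
have [/msize_le1P HE|szl] := irr _ _ FE; last first.
  by case: lirr; rewrite ltnNge szl.
have gE q : grad F q = mcoeff mnm0 H *: r.
  by rewrite FE {1}HE gradM gradC scaler0 add0r evC grad_affine_poly.
have nc v : dot r v = 0 -> v = 0.
  by move=> rv; apply: (not_cylinder curv) => q; rewrite gE dotZl rv mulr0.
pose v1 := vec (- r i1 0) (r i0 0) 0; pose v2 := vec 0 (- r i2 0) (r i1 0).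
have /vec_inj[r1 r0' _] : vec (- r i1 0) (r i0 0) 0 = vec 0 0 0.
  by rewrite -vec0E; apply: nc; rewrite dotE !vecE; ring.
have /vec_inj[_ r2 _] : vec 0 (- r i2 0) (r i1 0) = vec 0 0 0.
  by rewrite -vec0E; apply: nc; rewrite dotE !vecE; ring.
by case/eqP: r0; apply: vec_ext; rewrite [RHS]mxE; lra.
Qed.

End Planes.

Section Infinitesimal_rotations.
Variable R : realType.
Implicit Types (F : poly3 R) (p v y P : space3 R) (W M : 'M[R]_3) (s t a lam : R).
Implicit Types (k : rotation_type).

Lemma horner_vanish (f : {poly R}) : (forall a, f.[a] = 0) -> f = 0.
Proof.
move=> f0; apply/eqP; apply: contrapT => /negP nf0.
pose s : seq R := [seq i%:R | i <- iota 0 (size f)].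
have us : uniq s.
  rewrite map_inj_uniq ?iota_uniq // => i j /eqP; rewrite eqr_nat => /eqP //.
have rs : all (root f) s by apply/allP => x _; rewrite rootE f0.
by have := max_poly_roots nf0 rs us; rewrite size_map size_iota ltnn.
Qed.

Lemma ev_poly_curve (c : 'I_3 -> {poly R}) F : exists f : {poly R}, forall a,
  let q : space3 R := \col_i (c i).[a] in
  f.[a] = ev F q /\ f^`().[a] = dot (grad F q) (\col_i ((c i)^`()).[a]).
Proof.
elim/mpoly_closed: F => [x|i|F G [f fE] [g gE]|F G [f fE] [g gE]].
- by exists x%:P => a /=; rewrite hornerC derivC horner0 evC gradC dot0l.
- exists (c i) => a; rewrite /= evX mxE; split=> //.
  rewrite (_ : grad _ _ = delta_mx i 0) ?dot_delta ?mxE //.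
  by apply/colP => j; rewrite !mxE mderiv_var evC eqxx andbT.
- exists (f + g) => a; have [f1 f2] := fE a; have [g1 g2] := gE a.
  by rewrite /= derivD !hornerD f1 f2 g1 g2 evD gradD dotDl.
- exists (f * g) => a; have [f1 f2] := fE a; have [g1 g2] := gE a.
  rewrite /= derivM hornerD !hornerM f1 f2 g1 g2 evM gradM dotDl !dotZl; split=> //.
  by ring.
Qed.

(** F is an eigenvector of the derivation defined by a field. *)
Definition eigen_field F M P lam := forall p, dot (grad F p) (M *m (p - P)) = lam * ev F p.

(** The derivatives of the canonical groups at a = 0. The generator of the hyperbolic
   group is the one that is not yet in the form used for pairs of axes. *)
Definition raw_generator k : 'M[R]_3 :=
  match k with
  | Elliptic => mat9 0 (-1) 0 1 0 0 0 0 0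
  | Hyperbolic => mat9 0 1 0 1 0 0 0 0 0
  | Parabolic => mat9 0 0 0 1 0 0 0 1 0
  end.

Lemma is_derive_cosh a : is_derive a 1 (@cosh R) (sinh a).
Proof.
rewrite (_ : cosh (R := R) = (expR + (expR \o -%R)) * cst 2^-1); last by apply/funext.
by apply: is_derive_eq; rewrite /sinh /GRing.scale /=; field.
Qed.

Lemma is_derive_sinh a : is_derive a 1 (@sinh R) (cosh a).
Proof.
rewrite (_ : sinh (R := R) = (expR - (expR \o -%R)) * cst 2^-1); last by apply/funext.
by apply: is_derive_eq; rewrite /cosh /GRing.scale /=; field.
Qed.

Lemma is_derive_comb (x0 x1 x2 : R -> R) (d0 d1 d2 c0 c1 c2 a : R) :
  is_derive a 1 x0 d0 -> is_derive a 1 x1 d1 -> is_derive a 1 x2 d2 ->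
  is_derive a 1 (fun t => x0 t * c0 + x1 t * c1 + x2 t * c2)
    (d0 * c0 + d1 * c1 + d2 * c2).
Proof.
move=> h0 h1 h2.
have H := is_deriveD (is_deriveD (is_deriveM h0 (is_derive_cst c0 a 1))
  (is_deriveM h1 (is_derive_cst c1 a 1))) (is_deriveM h2 (is_derive_cst c2 a 1)).
by apply: (is_derive_eq H); rewrite /GRing.scale /= /cst; ring.
Qed.

Lemma is_derive_mulmx (M : R -> 'M[R]_3) (dM : 'M[R]_3) y a i :
  (forall i j, is_derive a 1 (fun t => M t i j) (dM i j)) ->
  is_derive a 1 (fun t => (M t *m y) i 0) ((dM *m y) i 0).
Proof.
move=> hM; rewrite mul3E.
by under eq_fun do rewrite mul3E; apply: is_derive_comb.
Qed.

Lemma is_derive_rotation k y a i :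
  is_derive a 1 (fun t => (canonical_rotation k t *m y) i 0)
    ((raw_generator k *m (canonical_rotation k a *m y)) i 0).
Proof.
rewrite mulmxA; apply: is_derive_mulmx => {}i j.
have Dc := is_derive_cosh a; have Ds := is_derive_sinh a.
have Dcos := is_derive_cos a; have Dsin := is_derive_sin a.
have C (c : R) : is_derive a 1 (fun=> c) (0 : R) by exact: is_derive_cst.
have I : is_derive a 1 (fun t : R => t) 1 by exact: is_derive_id.
have I2 : is_derive a 1 (fun t : R => t ^+ 2 / 2) a.
  rewrite (_ : (fun t => _) = id * id * cst (2^-1)) //.
  by apply: is_derive_eq; rewrite /GRing.scale /=; field.
have Sn : is_derive a 1 (fun t => - sin t) (- cos a).
  by rewrite (_ : (fun t => _) = - sin) //; apply: is_derive_eq.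
have fin (f : R -> R) d d' : is_derive a 1 f d -> d = d' -> is_derive a 1 f d'.
  by move=> ? <-.
case: k; elim/ord3P: i; elim/ord3P: j; rewrite /raw_generator /= /mat9 !mul3E !matE;
  under eq_fun do rewrite matE.
all: first [by apply: (fin _ _ _ (C 0)); ring | by apply: (fin _ _ _ (C 1)); ring
  | by apply: (fin _ _ _ Dcos); ring | by apply: (fin _ _ _ Dsin); ring
  | by apply: (fin _ _ _ Sn); ring | by apply: (fin _ _ _ Dc); ring
  | by apply: (fin _ _ _ Ds); ring | by apply: (fin _ _ _ I); ring
  | by apply: (fin _ _ _ I2); ring].
Qed.

End Infinitesimal_rotations.

Section Axes_of_rotation.
Variable R : realType.
Implicit Types (F : poly3 R) (p v y P : space3 R) (W M : 'M[R]_3) (s t a lam : R).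
Implicit Types (k : rotation_type) (A S : set (space3 R)).

Definition orbit k W P y t := P + W *m (canonical_rotation k t *m y).

Lemma canonical_rotation0 k : canonical_rotation k 0 = 1%:M :> 'M[R]_3.
Proof.
have one : 1%:M = mat9 1 0 0 0 1 0 0 0 1 :> 'M[R]_3.
  by apply/matrixP; apply: ord3P; apply: ord3P; rewrite mxE /mat9 matE ?eqxx //
    -(inj_eq val_inj) /= !inordK.
rewrite one; case: k => /=; rewrite -/(mat9 _ _ _ _ _ _ _ _ _).
- by rewrite cos0 sin0 oppr0.
- by rewrite /cosh /sinh oppr0 expR0 subrr; congr mat9; field.
- by congr mat9; ring.
Qed.

Lemma orbit0 k W P p : W^T *m W = 1%:M -> orbit k W P (W^T *m (p - P)) 0 = p.
Proof.
move=> WW; rewrite /orbit canonical_rotation0 mul1mx mulmxA orthogonalC // mul1mx.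
by rewrite addrC subrK.
Qed.

Lemma is_derive_orbit F k W P y a : W^T *m W = 1%:M ->
  is_derive a 1 (fun t => ev F (orbit k W P y t))
    (dot (grad F (orbit k W P y a))
         (W *m raw_generator R k *m W^T *m (orbit k W P y a - P))).
Proof.
move=> WW; apply: ev_chain => i.
have -> : W *m raw_generator R k *m W^T *m (orbit k W P y a - P) =
          W *m (raw_generator R k *m (canonical_rotation k a *m y)).
  rewrite /orbit addrAC subrr add0r -!mulmxA [W^T *m (W *m _)]mulmxA WW mul1mx.
  by rewrite !mulmxA.
pose u t := canonical_rotation k t *m y.
have du j := is_derive_rotation k y a j.
have [d0 d1 d2] := And3 (du i0) (du i1) (du i2).
have H := is_deriveD (is_derive_cst (P i 0) a 1)
  (is_derive_comb (W i i0) (W i i1) (W i i2) d0 d1 d2).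
rewrite (_ : (fun q => _) = cst (P i 0) + (fun t => u t i0 0 * W i i0 +
    u t i1 0 * W i i1 + u t i2 0 * W i i2)); last first.
  by apply/funext => t; rewrite /orbit mxE mul3E !(mulrC (W i _)).
by apply: (is_derive_eq H); rewrite add0r [RHS]mul3E !(mulrC (W i _)).
Qed.

Lemma eigenvalue_eq0 F M P lam : F != 0 -> eigen_field F M P lam ->
  (forall p, lam != 0 -> ev F p = 0) -> lam = 0.
Proof.
move=> F0 eig vF; apply/eqP; apply: contraT => lam0.
by case/eqP: F0; apply: poly_vanish => p; apply: vF.
Qed.

(** After a full turn the value of F would be multiplied by exp (2 pi lam). *)
Lemma elliptic_eigen F W P lam : F != 0 -> W^T *m W = 1%:M ->
  eigen_field F (W *m raw_generator R Elliptic *m W^T) P lam -> lam = 0.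
Proof.
move=> F0 WW eig; apply: (eigenvalue_eq0 F0 eig) => p lam0.
pose y := W^T *m (p - P); pose h t := ev F (orbit Elliptic W P y t).
have dh a : is_derive a 1 h (lam * h a).
  by have := is_derive_orbit F Elliptic P y a WW; rewrite eig.
pose g := h * (expR \o (fun t => - lam * t)).
have dg a : is_derive a 1 g 0.
  have de : is_derive a 1 (fun t => - lam * t) (- lam).
    rewrite (_ : (fun t => _) = cst (- lam) * id) //.
    by apply: is_derive_eq; rewrite /GRing.scale /= mulr0 addr0 mulr1.
  by apply: is_derive_eq; rewrite /GRing.scale /=; ring.
have := is_derive_0_is_cst (pi *+ 2) 0 dg.
rewrite /g /= !mulrfctE /= mulr0 expR0 mulr1.
have -> : h (pi *+ 2) = h 0.
  by rewrite /h /orbit /= cos2pi sin2pi cos0 sin0.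
have -> : h 0 = ev F p by rewrite /h orbit0.
move/eqP; rewrite -subr_eq0 -[X in _ - X]mulr1 -mulrBr mulf_eq0 => /orP[/eqP //|].
rewrite subr_eq0 -expR0 => /eqP/expR_inj/eqP.
rewrite mulf_eq0 oppr_eq0 (negPf lam0) /= mulrn_eq0 /= => /eqP pi0.
by have := pi_gt0 R; rewrite pi0 ltxx.
Qed.

Definition quadratic_curve (u0 u1 u2 : space3 R) i : {poly R} :=
  (u0 i 0)%:P + u1 i 0 *: 'X + u2 i 0 *: 'X^2.

Lemma quadratic_curveE u0 u1 u2 a :
  \col_i (quadratic_curve u0 u1 u2 i).[a] = u0 + a *: u1 + a ^+ 2 *: u2 :> space3 R.
Proof.
apply/colP => i; rewrite !mxE /quadratic_curve !hornerE /=.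
by ring.
Qed.

Lemma quadratic_curve_deriv u0 u1 u2 a :
  \col_i ((quadratic_curve u0 u1 u2 i)^`()).[a] = u1 + (2 * a) *: u2 :> space3 R.
Proof.
apply/colP => i; rewrite !mxE /quadratic_curve !derivD derivC !derivZ derivX derivXn !hornerE /=.
by ring.
Qed.

(** Along an orbit F is a polynomial function f of the parameter with f' = lam f. *)
Lemma parabolic_eigen F W P lam : F != 0 -> W^T *m W = 1%:M ->
  eigen_field F (W *m raw_generator R Parabolic *m W^T) P lam -> lam = 0.
Proof.
move=> F0 WW eig; apply: (eigenvalue_eq0 F0 eig) => p lam0.
have [y yE] : exists y, y = W^T *m (p - P) by eexists.
pose N := raw_generator R Parabolic.
pose c0 := P + W *m y; pose c1 := W *m (N *m y).
pose c2 := W *m (vec 0 0 (y i0 0 / 2)).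
have cE a : c0 + a *: c1 + a ^+ 2 *: c2 = orbit Parabolic W P y a.
  rewrite /c0 /c1 /c2 /orbit !scalemxAr -!addrA -!mulmxDr; congr (_ + _ *m _).
  by rewrite [y]vec_eta /N /= -/(mat9 _ _ _ _ _ _ _ _ _) !mat9E !vecE; congr vec; field.
have cE' a : c1 + (2 * a) *: c2 = W *m N *m W^T *m (orbit Parabolic W P y a - P).
  rewrite /orbit addrAC subrr add0r -!mulmxA [W^T *m (W *m _)]mulmxA WW mul1mx.
  rewrite /c1 /c2 scalemxAr -mulmxDr; congr (_ *m _).
  by rewrite [y]vec_eta /N /= -/(mat9 _ _ _ _ _ _ _ _ _) !mat9E !vecE; congr vec; field.
have [f fE] := ev_poly_curve (quadratic_curve c0 c1 c2) F.
have df : f^`() = lam *: f.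
  apply/eqP; rewrite -subr_eq0; apply/eqP/horner_vanish => a.
  have [] := fE a; rewrite /= quadratic_curveE quadratic_curve_deriv cE cE' => f1 f2.
  rewrite !hornerE f2 f1.
  by rewrite eig subrr.
have f0 : f = 0.
  apply/eqP; apply: contraT => f0; have := lt_size_deriv f0.
  by rewrite df size_scale // ltnn.
have [f1 _] := fE 0; move: f1.
by rewrite f0 horner0 quadratic_curveE cE yE orbit0.
Qed.

(** Along the line through P + z of direction u the coefficients of F are killed by the
   numbers eps i - lam, and none of these is zero. *)
Lemma eigen_vanish F M P lam eps z u : eigen_field F M P lam -> M *m z = 0 ->
  M *m u = eps *: u -> eps * lam < 0 -> ev F (P + z + u) = 0.
Proof.
move=> eig Mz Mu neg; have [f fE] := ev_poly_curve (quadratic_curve (P + z) u 0) F.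
have curve a : P + z + a *: u + a ^+ 2 *: 0 = P + z + a *: u by rewrite scaler0 addr0.
suff f0 : f = 0.
  have [] := fE 1; rewrite /= quadratic_curveE curve scale1r => <- _.
  by rewrite f0 horner0.
have E : eps *: ('X * f^`()) = lam *: f.
  apply/eqP; rewrite -subr_eq0; apply/eqP/horner_vanish => a.
  have [] := fE a; rewrite /= quadratic_curveE curve quadratic_curve_deriv.
  rewrite scaler0 addr0 => f1 f2.
  rewrite hornerD hornerN !hornerZ hornerM hornerX f1 f2.
  have := eig (P + z + a *: u).
  rewrite (_ : P + z + a *: u - P = z + a *: u); last first.
    by rewrite [P + z]addrC (addrAC z) addrK.
  rewrite mulmxDr Mz add0r -scalemxAr Mu !dotZr => <-; ring.
apply/polyP => i; rewrite coef0; have := congr1 (fun g : {poly R} => g`_i) E.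
rewrite /= !coefZ coefXM coef_deriv => Ei.
have {}Ei : (eps * i%:R - lam) * f`_i = 0.
  case: i Ei => [|i] /= Ei; first by rewrite !(mulr0, mul0r, sub0r) in Ei *; lra.
  by rewrite mulrBl -Ei -mulr_natr; ring.
move/eqP: Ei; rewrite mulf_eq0 => /orP[|/eqP //].
rewrite subr_eq0 => /eqP lamE.
have i0 : 0 <= (i%:R : R) by exact: ler0n.
by move: neg; rewrite -lamE; nra.
Qed.

(** If lam is not zero, then F vanishes on one of the two planes through the axis that
   are spanned by eigenvectors, according to the sign of lam. *)
Lemma hyperbolic_eigen F p W P lam : irreducible3 F -> curved_algebraically F p ->
  W^T *m W = 1%:M ->
  eigen_field F (W *m canonical_generator R Hyperbolic *m W^T) P lam -> lam = 0.
Proof.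
move=> irr curv WW eig; apply/eqP; apply: contraT => lam0.
have WW' := orthogonalC WW.
have field (x y z : R) : W *m canonical_generator R Hyperbolic *m W^T *m (W *m vec x y z) =
    W *m vec x (- y) 0.
  rewrite -!mulmxA [W^T *m (W *m _)]mulmxA WW mul1mx; congr (_ *m _).
  by rewrite /= !mat9E; congr vec; ring.
have coord (q : space3 R) : q = P + W *m vec 0 0 ((W^T *m (q - P)) i2 0) +
    (W *m vec ((W^T *m (q - P)) i0 0) ((W^T *m (q - P)) i1 0) 0).
  rewrite -addrA -mulmxDr !mat9E !add0r addr0 -vec_eta mulmxA WW' mul1mx.
  by rewrite addrC subrK.
have plane (e : space3 R) (q : space3 R) : dot (W *m e) q + - dot (W *m e) P =
    dot e (W^T *m (q - P)) by rewrite -dotBr dot_trmx.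
have We (e : space3 R) : e != 0 -> W *m e != 0.
  by apply: contra_neq => E; rewrite -[e]mul1mx -WW -mulmxA E mulmx0.
have [lamp|lamn] := ltrP 0 lam.
- have e0 : vec 1 0 0 != 0 :> space3 R.
    by apply/eqP; rewrite vec0E => /vec_inj[/eqP]; rewrite oner_eq0.
  apply: False_ind.
  apply: (vanish_plane_not_curved (s := - dot (W *m vec 1 0 0) P) irr curv (We _ e0)) => q.
  rewrite plane dotE !vecE !mul0r !addr0 mul1r => q0; rewrite (coord q) q0.
  apply: (eigen_vanish (eps := -1) eig); last by lra.
    by rewrite field oppr0 -vec0E mulmx0.
  by rewrite field scalemxAr !mat9E; congr (_ *m vec _ _ _); ring.
- have e0 : vec 0 1 0 != 0 :> space3 R.
    by apply/eqP; rewrite vec0E => /vec_inj[_ /eqP]; rewrite oner_eq0.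
  apply: False_ind.
  apply: (vanish_plane_not_curved (s := - dot (W *m vec 0 1 0) P) irr curv (We _ e0)) => q.
  rewrite plane dotE !vecE !mul0r addr0 add0r mul1r => q0; rewrite (coord q) q0.
  apply: (eigen_vanish (eps := 1) eig).
  + by rewrite field oppr0 -vec0E mulmx0.
  + by rewrite field scale1r oppr0.
  + by rewrite mul1r lt_neqAle lam0.
Qed.

(** The derivative of F along the field vanishes on the surface and its degree is at
   most that of F: it is F times a constant. *)
Lemma tangent_eigen F M v U x : irreducible3 F -> regular_piece U x ->
  (forall w, U w -> ev F (x w) = 0) ->
  (forall q, ev F q = 0 -> dot (grad F q) (M *m q + v) = 0) ->
  exists lam, forall q, dot (grad F q) (M *m q + v) = lam * ev F q.
Proof.
move=> irr rU F0 XF; have Fn0 := irreducible3_neq0 irr.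
pose G : poly3 R := \sum_i mderiv i F * field_poly M v i.
have GE q : ev G q = dot (grad F q) (M *m q + v).
  by rewrite ev_sum /dot; apply: eq_bigr => i _; rewrite evM ev_field_poly [grad _ _ _ _]mxE.
have [H HE] : divides F G.
  by apply: (divides_of_vanish irr rU F0) => w Uw; rewrite GE XF // F0.
exists (mcoeff mnm0 H) => q; rewrite -GE HE.
suff /msize_le1P {1}-> : (msize H <= 1)%N by rewrite evM evC.
have szG : (msize G <= msize F)%N.
  apply: leq_trans (msize_sum _ _ _) _; apply/bigmax_leqP => i _.
  have [->|d0] := eqVneq (mderiv i F) 0; first by rewrite mul0r msize0.
  have [->|l0] := eqVneq (field_poly M v i) 0; first by rewrite mulr0 msize0.
  rewrite msizeM //; have := msize_mderiv i Fn0.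
  have := msize_affine_poly (row i M)^T (v i 0).
  rewrite -/(field_poly M v i) => sl sd.
  have : (msize (mderiv i F) + msize (field_poly M v i) <= (msize F).-1 + 2)%N.
    by apply: leq_add => //; rewrite -ltnS prednK // (leq_trans _ sd).
  have : (0 < msize F)%N by rewrite (leq_trans _ sd).
  by case: (msize F) => // n _; rewrite addn2 /=; case: (_ + _)%N.
have [->|H0] := eqVneq H 0; first by rewrite msize0.
move: szG; rewrite HE msizeM //.
have : (0 < msize F)%N by rewrite lt0n msize_poly_eq0.
case: (msize F) => // n _; case: (msize H) => [|[|m]] //.
by rewrite addSn addnS /= addSn ltnS ltnNge leq_addl.
Qed.

End Axes_of_rotation.

Section Frames_of_axes.
Variable R : realType.
Implicit Types (F : poly3 R) (p v y P : space3 R) (W M : 'M[R]_3) (s t a lam : R).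
Implicit Types (k : rotation_type) (A S : set (space3 R)).

(** An orthonormal basis in which the hyperbolic generator is diagonal; the other two
   generators need no change of basis. *)
Definition diagonalizer k : 'M[R]_3 :=
  match k with
  | Hyperbolic => let c := Num.sqrt 2^-1 in mat9 c (- c) 0 c c 0 0 0 1
  | _ => 1%:M
  end.

Lemma diagonalizerP k : (diagonalizer k)^T *m diagonalizer k = 1%:M /\
  raw_generator R k = diagonalizer k *m canonical_generator R k *m (diagonalizer k)^T.
Proof.
have one : 1%:M = mat9 1 0 0 0 1 0 0 0 1 :> 'M[R]_3.
  by rewrite -(canonical_rotation0 R Elliptic) /= cos0 sin0 oppr0.
case: k => /=; rewrite ?trmx1 ?mul1mx ?mulmx1 //.
have c2 : Num.sqrt 2^-1 * Num.sqrt 2^-1 = 2^-1 :> R.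
  by rewrite -expr2 sqr_sqrtr // invr_ge0 ler0n.
rewrite one !mat9E; move: (Num.sqrt _) c2 => c c2.
by split; congr mat9; lra.
Qed.

Lemma raw_kernel k y : raw_generator R k *m y = 0 <-> z_axis y.
Proof.
have -> : z_axis y <-> y i0 0 = 0 /\ y i1 0 = 0.
  split=> [[t _ <-]|[y0 y1]]; first by rewrite !vecE.
  by exists (y i2 0) => //; rewrite [RHS]vec_eta y0 y1.
rewrite {1}[y]vec_eta; case: k; rewrite /= !mat9E vec0E; split=> [/vec_inj[]|[-> ->]].
all: rewrite ?(mul0r, mul1r, mulN1r, mulr0, addr0, add0r, oppr0) //.
all: by move=> *; split; lra.
Qed.

(** The rotation group moves the points of the surface along curves in it, so that its
   generator is tangent to the surface and multiplies F by a constant lam. For each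
   type lam is zero: the generator kills F. *)
Lemma axis_frame F p U x k A : irreducible3 F -> curved_algebraically F p ->
  regular_piece U x -> (forall w, U w -> ev F (x w) = 0) ->
  axis_of_type k (zeros F) A -> exists W P, frame_axis F k W P A.
Proof.
move=> irr curv rU F0 [T [[Q [b [QQ _ TE]]] TA inv]].
have QQ' := orthogonalC QQ; have Fn0 := irreducible3_neq0 irr.
pose P := - (Q^T *m b).
have TP q : Q *m (q - P) = T q by rewrite TE /P opprK mulmxDr mulmxA QQ' mul1mx.
have WW : (Q^T)^T *m Q^T = 1%:M by rewrite trmxK.
have Torb y a : T (orbit k Q^T P y a) = canonical_rotation k a *m y.
  rewrite -TP /orbit addrAC subrr add0r [LHS]mulmxA QQ'.
  by rewrite mul1mx.
have Tinj q q' : T q = T q' -> q = q'.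
  rewrite !TE => /addIr /(congr1 (mulmx Q^T)).
  by rewrite !mulmxA QQ !mul1mx.
have onS q a : ev F q = 0 -> ev F (orbit k Q^T P (T q) a) = 0.
  move=> Fq.
  have : (T @` zeros F) (canonical_rotation k a *m T q).
    by rewrite -(inv a); exists (T q) => //; exists q.
  by case=> q' Fq'; rewrite -Torb => /Tinj <-.
pose raw := Q^T *m raw_generator R k *m Q.
have tangent q : ev F q = 0 -> dot (grad F q) (raw *m q + - (raw *m P)) = 0.
  move=> Fq; have := is_derive_orbit F k P (T q) 0 WW.
  have orb : orbit k Q^T P (T q) 0 = q.
    by have := orbit0 k P q WW; rewrite trmxK TP.
  rewrite orb trmxK -/raw mulmxBr => -[_ <-].
  rewrite (_ : (fun t => _) = cst 0) ?derive_cst //.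
  by apply/funext => t; rewrite onS.
have [lam eig] := tangent_eigen irr rU F0 tangent.
have {}eig : eigen_field F raw P lam by move=> q; rewrite mulmxBr eig.
have [CC rawE] := diagonalizerP k.
pose C := diagonalizer k; pose W := Q^T *m C.
have CC' := orthogonalC CC.
have WWC : W^T *m W = 1%:M.
  by rewrite /W trmx_mul trmxK -mulmxA [Q *m (Q^T *m _)]mulmxA QQ' mul1mx.
have rawW : raw = W *m canonical_generator R k *m W^T.
  by rewrite /raw rawE /W trmx_mul trmxK !mulmxA.
have lam0 : lam = 0.
  case: k @C @W {Torb onS rawE inv} @raw tangent eig CC CC' WWC rawW => C W raw _ eig _ _ WWC rawW.
  - by apply: (elliptic_eigen Fn0 WW (P := P)); rewrite trmxK.
  - by apply: (hyperbolic_eigen irr curv WWC (P := P)); rewrite -rawW.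
  - by apply: (parabolic_eigen Fn0 WW (P := P)); rewrite trmxK.
exists W, P; split=> //.
  move=> q; rewrite mulmx0 add0r -mulmxBr -rawW.
  by rewrite eig lam0 mul0r.
apply/seteqP; split=> q /=.
  move=> Aq; have /raw_kernel : z_axis (T q) by rewrite -TA; exists q.
  move/(_ k); rewrite rawE -!mulmxA -TP => /(congr1 (mulmx C^T)).
  by rewrite mulmxA CC mul1mx mulmx0 /W trmx_mul trmxK -!mulmxA.
rewrite /W trmx_mul trmxK -!mulmxA TP => q0.
have : z_axis (T q) by apply/(raw_kernel k); rewrite rawE -!mulmxA q0 mulmx0.
by rewrite -TA => -[q' Aq' /Tinj <-].
Qed.

End Frames_of_axes.

(** * The equation of the surface *)

Section Level_sets.
Variable R : realType.
Implicit Types (F G : poly3 R) (p v y P : space3 R) (M : 'M[R]_3) (U V : set (R * R)).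
Implicit Types (x : R * R -> space3 R).

Lemma derive_zero_segment (f : R -> R) (a b : R) :
  (forall t : R, (a <= t <= b) || (b <= t <= a) -> is_derive t 1 f 0) -> f a = f b.
Proof.
wlog ab : a b / a <= b.
  move=> H df; case: (leP a b) => [ab|/ltW ba]; first exact: H ab df.
  by apply/esym/(H b a ba) => t; rewrite orbC => /df.
move=> df; have dfab t : t \in `[a, b] -> is_derive t 1 f 0.
  by rewrite in_itv => tab; apply: df; rewrite tab.
have H1 t : t \in `]a, b[%R -> is_derive t 1 f ((fun=> 0) t).
  by move=> tab; apply: dfab; apply: subset_itv_oo_cc.
have H2 : {within `[a, b], continuous f}.
  by apply: derivable_within_continuous => t /dfab [].
have [c _] := MVT_segment ab H1 H2.
by rewrite mul0r => /eqP; rewrite subr_eq0 eq_sym => /eqP.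
Qed.

Lemma is_derive_slice1 (f : R * R -> R) (u v d : R) :
  is_derive (u, v) ((1, 0) : R * R) f d -> is_derive u 1 (fun t => f (t, v)) d.
Proof.
move=> [df dE].
have E : (fun h : R => h^-1 *: ((f \o shift (u, v)) (h *: ((1, 0) : R * R)) - f (u, v))) =
         (fun h => h^-1 *: (((fun t => f (t, v)) \o shift u) (h *: (1 : R)) - f (u, v))).
  apply/funext => h; rewrite /= /shift /=; congr (_ *: (f (_, _) - _)).
  by rewrite [(_ *: _).2]scaler0 add0r.
by split; [rewrite /derivable -E|rewrite /derive -E].
Qed.

Lemma is_derive_slice2 (f : R * R -> R) (u v d : R) :
  is_derive (u, v) ((0, 1) : R * R) f d -> is_derive v 1 (fun t => f (u, t)) d.
Proof.
move=> [df dE].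
have E : (fun h : R => h^-1 *: ((f \o shift (u, v)) (h *: ((0, 1) : R * R)) - f (u, v))) =
         (fun h => h^-1 *: (((fun t => f (u, t)) \o shift v) (h *: (1 : R)) - f (u, v))).
  apply/funext => h; rewrite /= /shift /=; congr (_ *: (f (_, _) - _)).
  by rewrite [(_ *: _).1]scaler0 add0r.
by split; [rewrite /derivable -E|rewrite /derive -E].
Qed.

Lemma locally_constant (f : R * R -> R) V (w : R * R) : open V -> V w ->
  (forall q, V q -> is_derive q ((1, 0) : R * R) f 0) ->
  (forall q, V q -> is_derive q ((0, 1) : R * R) f 0) ->
  exists V', [/\ open V', V' `<=` V, V' w & forall q, V' q -> f q = f w].
Proof.
move=> oV Vw d1 d2; have /nbhs_ballP[e /= e0 eV] : nbhs w V by apply: open_nbhs_nbhs.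
exists (ball w e); split=> //; [exact: ball_open|exact: ballxx|].
case: w Vw eV => u0 v0 Vw eV [u v] [/= bu bv].
have between (a b c : R) : ball a e b -> (a <= c <= b) || (b <= c <= a) -> ball a e c.
  rewrite /ball /= => ab acb; apply: le_lt_trans ab.
  case/orP: acb => /andP[h1 h2].
    by rewrite !ler0_norm ?subr_le0 ?(le_trans h1 h2) // lerN2 lerB.
  by rewrite !ger0_norm ?subr_ge0 ?(le_trans h1 h2) // lerB.
transitivity (f (u0, v)).
  apply/esym; apply: (derive_zero_segment (f := fun t => f (t, v))) => t tu.
  apply: is_derive_slice1; apply: d1; apply: eV; split=> //=.
  exact: between bu tu.
apply/esym; apply: (derive_zero_segment (f := fun t => f (u0, t))) => t tv.
apply: is_derive_slice2; apply: d2; apply: eV; split=> /=; first exact: ballxx.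
exact: between bv tv.
Qed.

Lemma continuous_ev F x w : continuous_coords x w ->
  {for w, continuous (fun q => ev F (x q))}.
Proof.
move=> cx; elim/mpoly_closed: F => [c|i|F G cF cG|F G cF cG].
- by rewrite (_ : (fun q => _) = cst c); [exact: cst_continuous|apply/funext => q; rewrite evC].
- by rewrite (_ : (fun q => _) = (fun q => x q i 0)); [|apply/funext => q; rewrite evX].
- rewrite (_ : (fun q => _) = (fun q => ev F (x q)) \+ (fun q => ev G (x q))).
    exact: continuousD.
  by apply/funext => q; rewrite evD.
- rewrite (_ : (fun q => _) = (fun q => ev F (x q)) \* (fun q => ev G (x q))).
    exact: continuousM.
  by apply/funext => q; rewrite evM.
Qed.

(** As the gradients are parallel, G is constant along the surface; this constant
   subtracted, G vanishes on a piece of the surface. *)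
Lemma divides_level F G U x : irreducible3 F -> regular_piece U x ->
  (forall w, U w -> ev F (x w) = 0) ->
  (forall p, cross (grad F p) (grad G p) = 0) ->
  exists c, divides F (G - mpolyC 3 c).
Proof.
move=> irr rU F0 FG; have [w [Uw gw]] := regular_point irr rU F0.
have [oU _ d1 d2 nU] := rU.
have [i gi] := exists_coord gw.
pose V := U `&` [set q | ev (mderiv i F) (x q) != 0].
have oV : open V.
  by apply: open_nonvanishing => // q Uq; apply: continuous_ev; have [] := nU q Uq.
have gV q : V q -> grad F (x q) != 0.
  by move=> [_ /=]; apply: contra_neq => /(congr1 (fun u : space3 R => u i 0)); rewrite !mxE.
have Vw : V w by split=> //=; rewrite mxE in gi.
have key q (v : R * R) : V q -> derivable x q v ->
    dot (grad F (x q)) ('D_v x q) = 0 ->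
    is_derive q v (fun r => ev G (x r)) 0.
  move=> Vq dx tq; have := ev_chain_vec G dx.
  suff -> : dot (grad G (x q)) ('D_v x q) = 0 by [].
  have [k ->] : exists k, grad G (x q) = k *: grad F (x q).
    by apply: cross_eq0_scale (gV q Vq) _; rewrite crossC FG oppr0.
  by rewrite dotZl tq mulr0.
have tang q (Vq : V q) := grad_tangent rU F0 (proj1 Vq).
have [V' [oV' V'V V'w cst]] := locally_constant oV Vw
  (fun q Vq => key q _ Vq (d1 q (proj1 Vq)) (proj1 (tang q Vq)))
  (fun q Vq => key q _ Vq (d2 q (proj1 Vq)) (proj2 (tang q Vq))).
exists (ev G (x w)).
have rV' : regular_piece V' x.
  by apply: (regular_piece_sub rU) => //; [exists w|move=> q /V'V []].
apply: (divides_of_vanish irr rV') => q V'q.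
  by apply: F0; have [] := V'V q V'q.
by rewrite evB evC cst // subrr.
Qed.

End Level_sets.

Section Equations.
Variable R : realType.
Implicit Types (F G H : poly3 R) (p q v y P : space3 R) (M B Q W : 'M[R]_3).

(** Where the two fields are independent, both gradients are normal to their span, and
   these points are dense. *)
Lemma common_invariants F G B1 B2 P : (exists y, cross (B1 *m y) (B2 *m y) != 0) ->
  (forall p, dot (grad F p) (B1 *m (p - P)) = 0) ->
  (forall p, dot (grad F p) (B2 *m (p - P)) = 0) ->
  (forall p, dot (grad G p) (B1 *m (p - P)) = 0) ->
  (forall p, dot (grad G p) (B2 *m (p - P)) = 0) ->
  forall p, cross (grad F p) (grad G p) = 0.
Proof.
move=> [y y0] F1 F2 G1 G2.
pose f := field_poly B1 (- (B1 *m P)); pose g := field_poly B2 (- (B2 *m P)).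
pose n := cross (B1 *m y) (B2 *m y).
pose D : poly3 R := mpolyC 3 (n i0 0) * (f i1 * g i2 - f i2 * g i1) +
  mpolyC 3 (n i1 0) * (f i2 * g i0 - f i0 * g i2) +
  mpolyC 3 (n i2 0) * (f i0 * g i1 - f i1 * g i0).
have evD' q : ev D q = dot n (cross (B1 *m (q - P)) (B2 *m (q - P))).
  rewrite /D /f /g 2!evD !evM !evB !evM !ev_field_poly !evC -!mulmxBr.
  by rewrite dotE /cross !vecE.
have D0 : D <> 0.
  move=> D0; have := evD' (P + y); rewrite D0 ev0 [P + y]addrC addrK -/n => /esym/eqP.
  by rewrite dot_eq0 (negPf y0).
have par i j q : grad F q i 0 * grad G q j 0 - grad F q j 0 * grad G q i 0 = 0.
  pose K : poly3 R := mderiv i F * mderiv j G - mderiv j F * mderiv i G.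
  have -> : grad F q i 0 * grad G q j 0 - grad F q j 0 * grad G q i 0 = ev K q.
    by rewrite !mxE evB !evM.
  have [|/D0 []|->] := @poly_mul_vanish _ D K; last by rewrite ev0.
  move=> u; rewrite evD'.
  have -> : ev K u = grad F u i 0 * grad G u j 0 - grad F u j 0 * grad G u i 0.
    by rewrite !mxE evB !evM.
  have Fp := orthogonal_parallel (F1 u) (F2 u).
  have Gp := orthogonal_parallel (G1 u) (G2 u).
  have [n0|n0] := eqVneq (cross (B1 *m (u - P)) (B2 *m (u - P))) 0.
    by rewrite n0 dotC dot0l mul0r.
  have [k ->] := parallel_scale n0 Fp; have [l ->] := parallel_scale n0 Gp.
  have sE (c : R) (v : space3 R) m : (c *: v) m 0 = c * v m 0 by rewrite mxE.
  by rewrite !sE; ring.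
by move=> p; apply: vec_ext; rewrite /cross vecE [RHS]mxE; exact: par.
Qed.

(** On the surface the vector from P is a constant multiple of adj (hess F) grad F,
   which has the direction of the affine normal, and e is the affine distance from P
   up to a constant. Such surfaces are named after Tzitzeica, who characterized them
   by the property that K is a constant multiple of the fourth power of the distance
   from P to the tangent plane. *)
Definition tzitzeica F P := exists m h e : R, [/\ m != 0, h != 0, e != 0 &
  forall p, ev F p = 0 -> [/\ hess F p *m (p - P) = m *: grad F p,
    \det (hess F p) = h & dot (grad F p) (p - P) = e]].

Lemma hess_deriv F p d v :
  (forall i, is_derive (0 : R) 1 (fun t => grad F (p + t *: d) i 0) (v i 0)) ->
  hess F p *m d = v.
Proof.
move=> gv; apply/colP => i; have [_ <-] := is_derive_grad_line F p d i.
by have [_ ->] := gv i.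
Qed.

Lemma hess_linear F M v p : (forall q, grad F q = M *m q + v) -> hess F p = M.
Proof.
move=> gE; apply/matrixP => i j.
have : hess F p *m delta_mx j (0 : 'I_1) = M *m delta_mx j 0.
  apply: hess_deriv => l.
  rewrite (_ : (fun t => _) = (fun t => (M *m p + v + t *: (M *m delta_mx j 0)) l 0)).
    exact: is_derive_line.
  by apply/funext => t; rewrite gE mulmxDr -scalemxAr addrAC.
by move/(congr1 (fun u : space3 R => u i 0)); rewrite -!colE !mxE.
Qed.

Definition quadratic_poly Q P : poly3 R :=
  \sum_i affine_poly (delta_mx i 0) (- P i 0) * field_poly Q (- (Q *m P)) i.

Lemma ev_quadratic_poly Q P p : ev (quadratic_poly Q P) p = dot (p - P) (Q *m (p - P)).
Proof.
rewrite ev_sum /dot; apply: eq_bigr => i _.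
by rewrite evM ev_affine_poly dot_delta ev_field_poly -mulmxBr !mxE.
Qed.

Lemma quadratic_form_line Q y v (t : R) : Q^T = Q ->
  dot (y + t *: v) (Q *m (y + t *: v)) =
  dot y (Q *m y) + t * (2 * dot v (Q *m y)) + t * (t * dot v (Q *m v)).
Proof.
move=> Qs; have sym : dot v (Q *m y) = dot y (Q *m v) by rewrite dotC dot_trmx Qs.
by rewrite mulmxDr -scalemxAr !dotDl !dotDr !dotZl !dotZr -sym; ring.
Qed.

Lemma is_derive_quadratic (a b c : R) :
  is_derive (0 : R) 1 (fun t => a + t * b + t * (t * c)) b.
Proof.
pose f : {poly R} := a%:P + 'X * b%:P + 'X * ('X * c%:P).
rewrite (_ : (fun t => _) = horner f); last first.
  by apply/funext => t; rewrite /f !(hornerD, hornerM, hornerX, hornerC).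
have := is_derive_poly f 0; congr (is_derive _ _ _ _).
rewrite /f !derivD !derivM derivX !derivC !(hornerD, hornerM, hornerX, hornerC).
by rewrite !(mulr0, mul0r, addr0, add0r, mul1r).
Qed.

Lemma grad_quadratic_poly Q P p : Q^T = Q ->
  grad (quadratic_poly Q P) p = 2 *: (Q *m (p - P)).
Proof.
move=> Qs; apply: dot_ext => d.
have [_] := ev_line (quadratic_poly Q P) p d 0; rewrite scale0r addr0 dotC => <-.
rewrite dotZr; set b := 2 * _.
have [_ <-] := is_derive_quadratic (dot (p - P) (Q *m (p - P))) b (dot d (Q *m d)).
apply: (congr1 (fun f : R -> R => 'D_(1 : R) f (0 : R))).
apply/funext => t; rewrite ev_quadratic_poly.
by rewrite (_ : p + t *: d - P = (p - P) + t *: d) ?quadratic_form_line // addrAC.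
Qed.

End Equations.

Section Level_surfaces.
Variable R : realType.
Implicit Types (F G H : poly3 R) (p q v y P : space3 R) (M B Q W : 'M[R]_3) (c k : R).

Lemma hessM F G p : hess (F * G) p = ev G p *: hess F p + ev F p *: hess G p
  + grad F p *m (grad G p)^T + grad G p *m (grad F p)^T.
Proof.
apply/matrixP => i j; rewrite !mxE !big_ord1 !mxE mderivM !mderivD !mderivM !evD !evM.
ring.
Qed.

Lemma hess_affine_poly r (s : R) p : hess (affine_poly r s) p = 0.
Proof.
by apply: (hess_linear (v := r)) => q; rewrite mul0mx add0r grad_affine_poly.
Qed.

Definition coordinate W P i : poly3 R := field_poly W^T (- (W^T *m P)) i.

Definition torus_poly W P := coordinate W P i0 * coordinate W P i1 * coordinate W P i2.

Lemma ev_coordinate W P i p : ev (coordinate W P i) p = (W^T *m (p - P)) i 0.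
Proof. by rewrite ev_field_poly -mulmxBr. Qed.

Lemma grad_coordinate W P i p : grad (coordinate W P i) p = col i W.
Proof. by rewrite grad_affine_poly -tr_col trmxK. Qed.

Lemma ev_torus_poly W P p : ev (torus_poly W P) p =
  (W^T *m (p - P)) i0 0 * (W^T *m (p - P)) i1 0 * (W^T *m (p - P)) i2 0.
Proof. by rewrite !evM !ev_coordinate. Qed.

Lemma grad_torus_poly W P p (y := W^T *m (p - P)) : grad (torus_poly W P) p =
  W *m vec (y i1 0 * y i2 0) (y i0 0 * y i2 0) (y i0 0 * y i1 0).
Proof.
rewrite !gradM !evM !ev_coordinate !grad_coordinate -/y; move: y => y.
by apply/colP => i; rewrite [RHS]mul3E !vecE !mxE; ring.
Qed.

Lemma hess_torus_poly W P p (y := W^T *m (p - P)) : hess (torus_poly W P) p =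
  W *m mat9 0 (y i2 0) (y i1 0) (y i2 0) 0 (y i0 0) (y i1 0) (y i0 0) 0 *m W^T.
Proof.
rewrite !hessM !gradM !hess_affine_poly !ev_coordinate !grad_coordinate -/y.
rewrite !scaler0 !add0r; move: y => y.
by apply/matrixP => i j; rewrite [RHS]mul3E !mul3E /mat9 !matE !mxE !big_ord1 !mxE; ring.
Qed.

Lemma msize_mul_le F G a b : (msize F <= a.+1)%N -> (msize G <= b.+1)%N ->
  (msize (F * G) <= (a + b).+1)%N.
Proof.
move=> Fa Gb; have [->|F0] := eqVneq F 0; first by rewrite mul0r msize0.
have [->|G0] := eqVneq G 0; first by rewrite mulr0 msize0.
rewrite msizeM //; move: F0 G0; rewrite -!msize_poly_eq0.
case: (msize F) Fa => // m; case: (msize G) Gb => // n.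
by rewrite addSn addnS !ltnS => *; rewrite leq_add.
Qed.

Lemma msize_torus_poly W P : (msize (torus_poly W P) <= 4)%N.
Proof.
apply: (@msize_mul_le _ _ 2 1); last exact: msize_affine_poly.
by apply: (@msize_mul_le _ _ 1 1); exact: msize_affine_poly.
Qed.

Lemma msize_quadratic_poly Q P : (msize (quadratic_poly Q P) <= 3)%N.
Proof.
apply: leq_trans (msize_sum _ _ _) _; apply/bigmax_leqP => i _.
by apply: (@msize_mul_le _ _ 1 1); exact: msize_affine_poly.
Qed.

Lemma msize_subC_le G c n : (msize G <= n.+1)%N -> (msize (G - mpolyC 3 c) <= n.+1)%N.
Proof.
move=> Gn; rewrite -mpolyCN; apply: leq_trans (msizeD_le _ _) _; rewrite geq_max Gn.
by rewrite msizeC; case: eqP.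
Qed.

Lemma msize_factor F H a b : F != 0 -> (a < msize F)%N -> (msize (F * H) <= a + b)%N ->
  (msize H <= b)%N.
Proof.
move=> F0 aF; have [->|H0] := eqVneq H 0; first by rewrite msize0.
rewrite msizeM //; move: aF; case: (msize F) => // m.
rewrite addSn ltnS /= => am le; rewrite -(leq_add2l a).
by apply: leq_trans le; rewrite leq_add2r.
Qed.

(** The relations of Euler for G, homogeneous of degree m + 1 about P, and for its
   gradient make a level surface of G a Tzitzeica surface; that the level is not 0 follows
   from the curvature, as a cone is flat along its rulings. *)
Lemma tzitzeica_level F G P p k c m (h : R -> R) : curved_algebraically F p ->
  F = mpolyC 3 k * (G - mpolyC 3 c) -> m != 0 -> m + 1 != 0 ->
  (forall s, s != 0 -> h s != 0) ->
  (forall q, dot (grad G q) (q - P) = (m + 1) * ev G q) ->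
  (forall q, hess G q *m (q - P) = m *: grad G q) ->
  (forall q, \det (hess G q) = h (ev G q)) ->
  [/\ k != 0, c != 0 & tzitzeica F P].
Proof.
move=> curv FE m0 m1 h0 eG hG dG.
have FX q : ev F q = k * (ev G q - c) by rewrite FE evM evB !evC.
have gF q : grad F q = k *: grad G q.
  by rewrite FE gradM gradC scaler0 add0r grad_subC evC.
have hF q : hess F q = k *: hess G q.
  rewrite FE hessM gradC mul0mx trmx0 mulmx0 !addr0 evC hessC scaler0 add0r.
  congr (_ *: _); apply/matrixP => i j.
  by rewrite !mxE mderivB mderivC subr0.
have k0 : k != 0.
  case: curv => [a [b [l [_ _ _]]]]; apply: contraNneq => k0.
  by rewrite hF k0 scale0r !mul0mx crossv dotC dot0l.
have onG q : ev F q = 0 -> ev G q = c.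
  by rewrite FX => /eqP; rewrite mulf_eq0 (negPf k0) subr_eq0 => /eqP.
have c0 : c != 0.
  case: curv => [a [b [l [Fp gp l0]]]]; apply: contraNneq => c0.
  set n := cross a b in gp *.
  have yn : dot (p - P) n = 0.
    apply: (mulfI l0); rewrite mulr0 -dotZr -gp gF dotZr dotC eG onG // c0.
    by rewrite !mulr0.
  have Hy : hess F p *m (p - P) = (m * l) *: n.
    by rewrite -scalerA -gp gF hF -scalemxAl hG !scalerA mulrC.
  have := det3_mulmx (hess F p) (p - P) a b.
  rewrite -/n yn mulr0 Hy dotZl => /eqP.
  by rewrite !mulf_eq0 (negPf m0) (negPf l0).
split=> //; exists m, (k ^+ 3 * h c), (k * ((m + 1) * c)); split=> //.
- by rewrite mulf_neq0 ?expf_neq0 // h0.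
- by rewrite !mulf_neq0.
move=> q Fq; rewrite gF hF detZ dG dotZl eG onG // -scalemxAl hG.
by split=> //; rewrite !scalerA mulrC.
Qed.

End Level_surfaces.

Section Surface_equation.
Variable R : realType.
Implicit Types (F G H : poly3 R) (p q v y P : space3 R) (M B Q W : 'M[R]_3) (c k : R).
Implicit Types (U : set (R * R)) (x : R * R -> space3 R).

Lemma level_factor F G H c q : G - mpolyC 3 c = F * H -> (msize H <= 1)%N ->
  \det (hess G q) != 0 -> exists k, F = mpolyC 3 k * (G - mpolyC 3 c).
Proof.
move=> FG /msize_le1P HE dG; set h := mcoeff mnm0 H in HE; exists h^-1.
have h0 : h != 0.
  apply: contraNneq dG => h0; move: FG; rewrite HE h0 mpolyC0 mulr0 => /eqP.
  by rewrite subr_eq0 => /eqP ->; rewrite hessC det0.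
by rewrite FG HE mulrCA -mpolyCM mulVf // mulr1.
Qed.

Lemma quadratic_poly_invariant Q B P q : Q^T = Q -> Q *m B + B^T *m Q = 0 ->
  dot (grad (quadratic_poly Q P) q) (B *m (q - P)) = 0.
Proof.
move=> Qs QB; rewrite grad_quadratic_poly // dotZl; move: (q - P) => y.
suff : dot (Q *m y) (B *m y) = - dot (Q *m y) (B *m y) by lra.
rewrite {1}dot_trmx Qs mulmxA (_ : Q *m B = - (B^T *m Q)); last first.
  by apply/eqP; rewrite -addr_eq0 QB.
by rewrite mulNmx -scaleN1r dotZr mulN1r -mulmxA -dot_trmx dotC.
Qed.

Lemma torus_poly_invariant W (a e j : R) P q : W^T *m W = 1%:M -> a + e + j = 0 ->
  dot (grad (torus_poly W P) q) (W *m mat9 a 0 0 0 e 0 0 0 j *m W^T *m (q - P)) = 0.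
Proof.
move=> WW tr0; rewrite grad_torus_poly -!mulmxA; move: (W^T *m (q - P)) => y.
rewrite dot_trmx mulmxA WW mul1mx dotE !vecE !mul3E /mat9 !matE.
transitivity ((a + e + j) * (y i0 0 * y i1 0 * y i2 0)); first by ring.
by rewrite tr0 mul0r.
Qed.

(** The derivative of G - c = F H along the field is F times the derivative of H. *)
Lemma cofactor_invariant F G H c B P : F != 0 -> G - mpolyC 3 c = F * H ->
  (forall q, dot (grad F q) (B *m (q - P)) = 0) ->
  (forall q, dot (grad G q) (B *m (q - P)) = 0) ->
  forall q, dot (grad H q) (B *m (q - P)) = 0.
Proof.
move=> F0 FG FB GB.
pose D : poly3 R := \sum_i mderiv i H * field_poly B (- (B *m P)) i.
have DE q : ev D q = dot (grad H q) (B *m (q - P)).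
  by rewrite ev_sum /dot; apply: eq_bigr => i _; rewrite evM ev_field_poly -mulmxBr [in RHS]mxE.
have [|FE|D0] := @poly_mul_vanish _ F D; last by move=> q; rewrite -DE D0 ev0.
  move=> q; rewrite DE; have := GB q.
  by rewrite -(grad_subC G c) FG gradM dotDl !dotZl FB mulr0 add0r.
by move: F0; rewrite FE eqxx.
Qed.

(** The gradient of H is constant and orthogonal to the three coordinate directions of
   the frame. *)
Lemma affine_torus_invariant H W (a e j : R) P : (msize H <= 2)%N -> W^T *m W = 1%:M ->
  j != 0 ->
  (forall q, dot (grad H q) (W *m mat9 1 0 0 0 (-1) 0 0 0 0 *m W^T *m (q - P)) = 0) ->
  (forall q, dot (grad H q) (W *m mat9 a 0 0 0 e 0 0 0 j *m W^T *m (q - P)) = 0) ->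
  (msize H <= 1)%N.
Proof.
move=> szH WW j0 H1 H2.
have [->|Hn0] := eqVneq H 0; first by rewrite msize0.
have dC i : mderiv i H = mpolyC 3 (mcoeff mnm0 (mderiv i H)).
  by apply: msize_le1P; rewrite -ltnS; apply: leq_trans (msize_mderiv i Hn0) szH.
pose v : space3 R := \col_i mcoeff mnm0 (mderiv i H).
have gv q : grad H q = v by apply/colP => i; rewrite !mxE dC evC mcoeffC eqxx mulr1.
have WW' := orthogonalC WW.
have zero (d : 'M[R]_3) (y : space3 R) :
    (forall q, dot (grad H q) (W *m d *m W^T *m (q - P)) = 0) ->
    dot (W^T *m v) (d *m y) = 0.
  move=> /(_ (P + W *m y)); rewrite gv [P + _]addrC addrK -!mulmxA [W^T *m (_ *m _)]mulmxA WW.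
  by rewrite mul1mx dotC dot_trmx dotC.
suff v0 : v = 0.
  apply: mderiv_const => i; rewrite dC.
  by have := congr1 (fun u : space3 R => u i 0) v0; rewrite !mxE => ->; rewrite mpolyC0.
rewrite -[v]mul1mx -WW' -mulmxA; move: (W^T *m v) zero => u zero.
suff -> : u = 0 by rewrite mulmx0.
have := zero _ (vec 1 0 0) H1; have := zero _ (vec 0 1 0) H1; have := zero _ (vec 0 0 1) H2.
rewrite !dotE !mul3E /mat9 !matE !vecE => u2 u1 u0.
have /(mulIf j0) e2 : u i2 0 * j = 0 * j by rewrite mul0r -[RHS]u2; ring.
by apply: vec_ext; rewrite [RHS]mxE; [lra|lra|exact: e2].
Qed.

Lemma det_torus (a b c : R) : \det (mat9 0 c b c 0 a b a 0) = 2 * (a * b * c).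
Proof. by rewrite /mat9 det_mat; ring. Qed.

(** The invariant of degree 2 or 3 of the pair is constant on the surface, so F
   divides a level polynomial of it; the cofactor is invariant of degree at most 1,
   hence constant. *)
Lemma surface_equation F p U x P : irreducible3 F -> curved_algebraically F p ->
  regular_piece U x -> (forall w, U w -> ev F (x w) = 0) -> centered_pair F P ->
  tzitzeica F P /\ (msize F = 3%N \/ exists W k c, [/\ W^T *m W = 1%:M, k != 0, c != 0 &
    F = mpolyC 3 k * (torus_poly W P - mpolyC 3 c)]).
Proof.
move=> irr curv rU onF [B1 [B2 [F1 F2 indep inv]]].
have F0 := irreducible3_neq0 irr; have szF := curved_msize curv.
case: inv => [[Q [[Qs dQ] QB1 QB2]]|[W [a [e [j [WW B1E B2E tr0 j0]]]]]].
- pose G := quadratic_poly Q P.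
  have G1 q := quadratic_poly_invariant P q Qs QB1.
  have G2 q := quadratic_poly_invariant P q Qs QB2.
  have [c [H]] := divides_level irr rU onF (common_invariants indep F1 F2 G1 G2).
  rewrite mulrC => FG.
  have szFH : (msize (F * H) <= 3)%N by rewrite -FG msize_subC_le // msize_quadratic_poly.
  have szH : (msize H <= 1)%N := @msize_factor _ F H 2 1 F0 szF szFH.
  have hG q : hess G q = 2 *: Q.
    apply: (hess_linear (v := - (2 *: (Q *m P)))) => u.
    by rewrite grad_quadratic_poly // mulmxBr scalerBr -scalemxAl.
  have dG q : \det (hess G q) = 2 ^+ 3 * \det Q by rewrite hG detZ.
  have dn0 : 2 ^+ 3 * \det Q != 0 by rewrite mulf_neq0 // expf_neq0 // pnatr_eq0.
  have [k FE] : exists k, F = mpolyC 3 k * (G - mpolyC 3 c).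
    by apply: (level_factor (q := P) FG szH); rewrite dG.
  have [||||||k0 c0 star] := tzitzeica_level (m := 1) (P := P) (h := fun=> 2 ^+ 3 * \det Q) curv FE.
  + exact: oner_neq0.
  + by rewrite -mulr2n pnatr_eq0.
  + by [].
  + by move=> q; rewrite grad_quadratic_poly // dotZl ev_quadratic_poly dotC -mulr2n.
  + by move=> q; rewrite hG grad_quadratic_poly // scale1r scalemxAl.
  + exact: dG.
  split=> //; left; apply/eqP; rewrite eqn_leq szF andbT FE mul_mpolyC.
  by apply: leq_trans (msizeZ_le _ _) _; rewrite msize_subC_le // msize_quadratic_poly.
- pose G := torus_poly W P.
  have G1 q : dot (grad G q) (B1 *m (q - P)) = 0.
    by rewrite B1E; apply: torus_poly_invariant => //; rewrite addr0 subrr.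
  have G2 q : dot (grad G q) (B2 *m (q - P)) = 0.
    by rewrite B2E; apply: torus_poly_invariant.
  have [c [H]] := divides_level irr rU onF (common_invariants indep F1 F2 G1 G2).
  rewrite mulrC => FG.
  have szFH : (msize (F * H) <= 4)%N by rewrite -FG msize_subC_le // msize_torus_poly.
  have szH2 : (msize H <= 2)%N := @msize_factor _ F H 2 2 F0 szF szFH.
  have H1 := cofactor_invariant F0 FG F1 G1; have H2 := cofactor_invariant F0 FG F2 G2.
  rewrite B1E in H1; rewrite B2E in H2.
  have szH := affine_torus_invariant szH2 WW j0 H1 H2.
  have dW : \det W * \det W^T = 1 by rewrite mulrC -det_mulmx WW det1.
  have dG q : \det (hess G q) = 2 * ev G q.
    rewrite hess_torus_poly !det_mulmx mulrAC dW mul1r det_torus ev_torus_poly; ring.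
  have [k FE] : exists k, F = mpolyC 3 k * (G - mpolyC 3 c).
    apply: (level_factor (q := P + W *m vec 1 1 1) FG szH).
    rewrite dG ev_torus_poly [P + _]addrC addrK mulmxA WW mul1mx !vecE !mulr1.
    by rewrite pnatr_eq0.
  have Wy (q : space3 R) : q - P = W *m (W^T *m (q - P)).
    by rewrite mulmxA orthogonalC // mul1mx.
  have [||||||k0 c0 star] := tzitzeica_level (m := 2) (P := P) (h := fun s => 2 * s) curv FE.
  + by rewrite pnatr_eq0.
  + by rewrite natr1 pnatr_eq0.
  + by move=> s s0; rewrite mulf_neq0 ?pnatr_eq0.
  + move=> q; rewrite grad_torus_poly ev_torus_poly dot_trmx; move: (W^T *m _) => y.
    by rewrite dotE !vecE; ring.
  + move=> q; rewrite hess_torus_poly grad_torus_poly -mulmxA; move: (W^T *m _) => y.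
    rewrite -mulmxA scalemxAr; congr (_ *m _).
    by apply: vec_ext; rewrite !mul3E /mat9 !matE mxE !vecE; ring.
  + exact: dG.
  by split=> //; right; exists W, k, c.
Qed.

End Surface_equation.

(** * Affine normals *)

Section Starshaped_surfaces.
Variable R : realType.
Implicit Types (F G : poly3 R) (p y g n a b c P : space3 R) (H W : 'M[R]_3) (k m h e : R).
Implicit Types (U : set (R * R)) (x : R * R -> space3 R).

Lemma enorm_gt0 n : n != 0 -> 0 < enorm n.
Proof. by move=> n0; rewrite sqrtr_gt0 lt_neqAle dot_ge0 eq_sym dot_eq0 n0. Qed.

Lemma enorm_sqr n : enorm n ^+ 2 = dot n n.
Proof. by rewrite sqr_sqrtr // dot_ge0. Qed.

Lemma enormZ k n : enorm (k *: n) = `|k| * enorm n.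
Proof.
by rewrite /enorm dotZl dotZr mulrA -expr2 sqrtrM ?sqr_ge0 // sqrtr_sqr.
Qed.

Lemma unit_scale k n : k != 0 ->
  (enorm (k *: n))^-1 *: (k *: n) = Num.sg k *: ((enorm n)^-1 *: n).
Proof.
move=> k0; rewrite enormZ !scalerA; congr (_ *: _).
have nk0 : `|k| != 0 by rewrite normr_eq0.
by rewrite invfM [Num.sg k * _]mulrC mulrAC -{2}[k]mulr_sg_norm mulrCA mulVf // mulr1 mulrC.
Qed.

(** The factor |K|^(-1/4) undoes the normalization of the normal vector: if K is a
   constant multiple of |g|^(-4), then the conormal is a constant multiple of g. *)
Lemma conormal_scale g n (k kap : R) : n != 0 -> k != 0 -> g = k *: n ->
  `|kap / dot g g ^+ 2| `^ (- 4^-1) *: ((enorm n)^-1 *: n) =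
  (Num.sg (dot g n) * `|kap| `^ (- 4^-1)) *: g.
Proof.
move=> n0 k0 gE; have g0 : g != 0 by rewrite gE scaler_eq0 negb_or k0.
have nE : n = k^-1 *: g by rewrite gE scalerA mulVf // scale1r.
have sE : Num.sg (dot g n) = Num.sg k^-1.
  rewrite {1}nE dotZr sgrM; suff -> : Num.sg (dot g g) = 1 by rewrite mulr1.
  by apply/gtr0_sg; rewrite -enorm_sqr exprn_gt0 // enorm_gt0.
rewrite sE {1 2}nE unit_scale ?invr_eq0 // !scalerA; congr (_ *: _).
have s0 := enorm_gt0 g0; rewrite -enorm_sqr; move: (enorm g) s0 => s s0.
have sp : `|s ^+ 2 ^+ 2|^-1 = s `^ (- 4).
  by rewrite -exprM ger0_norm ?exprn_ge0 ?ltW // powRN powR_mulrn // ltW.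
rewrite normrM normfV sp powRM ?powR_ge0 // -powRrM.
have -> : - 4 * - 4^-1 = 1 :> R by field.
by rewrite powRr1 ?ltW //; field; rewrite gt_eqF.
Qed.

Lemma near_sg (f : R * R -> R) w : {for w, continuous f} -> f w != 0 ->
  \forall q \near w, Num.sg (f q) = Num.sg (f w).
Proof.
move=> cf; rewrite neq_lt => /orP[fw|fw].
  have nw := @cvgr_lt _ _ _ _ f (f w) cf 0 fw.
  by near=> q; rewrite !ltr0_sg //; near: q; exact: nw.
have nw := @cvgr_gt _ _ _ _ f (f w) cf 0 fw.
by near=> q; rewrite !gtr0_sg //; near: q; exact: nw.
Unshelve. all: by end_near. Qed.

Lemma derive_coords (f : R * R -> space3 R) w v (d : space3 R) :
  (forall i, is_derive w v (fun q => f q i 0) (d i 0)) -> 'D_v f w = d.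
Proof.
move=> df; have dfw : derivable f w v.
  by apply/derivable_mxP => i j; rewrite ord1; have [] := df i.
by apply/colP => i; rewrite derive_mx // mxE; have [_ ->] := df i.
Qed.

Lemma derive_scale_grad F x w v (C : R) : derivable x w v ->
  'D_v (fun q => C *: grad F (x q)) w = C *: (hess F (x w) *m 'D_v x w).
Proof.
move=> dx; apply: derive_coords => i; have dg := is_derive_grad F i dx.
rewrite (_ : (fun q => _) = C *: (fun q => grad F (x q) i 0)); last first.
  by apply/funext => q; rewrite mxE.
rewrite [X in is_derive _ _ _ X]mxE; exact: is_deriveZ.
Qed.

(** The Hessian is invertible and maps both sides to the same normal vector. *)
Lemma tzitzeica_cross H g y a b (m h k : R) : H^T = H -> \det H = h -> h != 0 ->
  m != 0 -> k != 0 -> H *m y = m *: g -> g = k *: cross a b ->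
  cross (H *m a) (H *m b) = (h / (m * k)) *: y.
Proof.
move=> Hs dH h0 m0 k0 Hy gE.
have uH : H \in unitmx by rewrite unitmxE dH unitfE.
apply: (can_inj (mulKmx uH)); rewrite -{1}Hs mulmx_cross dH -scalemxAr Hy gE !scalerA.
by congr (_ *: _); field; rewrite m0 k0.
Qed.

Lemma tzitzeica_normal F P U x w : tzitzeica F P -> local_parametrization (zeros F) U x ->
  U w -> exists2 k, k != 0 & grad F (x w) = k *: normal x w.
Proof.
move=> [m [h [e [m0 h0 e0 star]]]] ch Uw; have [k gE] := chart_normal ch Uw.
exists k => //; have [_ _] := star _ (chart_in ch Uw).
by rewrite gE; apply: contra_eq_neq => ->; rewrite scale0r dot0l eq_sym.
Qed.

(** The determinant of the second fundamental form is a triple product in which two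
   vectors span the direction of p - P, so that only the constants m, h, e and the
   length of the gradient remain. *)
Lemma tzitzeica_curvature F P U x : tzitzeica F P -> local_parametrization (zeros F) U x ->
  exists2 kap, kap != 0 & forall w, U w ->
    gauss_curvature x w = kap / dot (grad F (x w)) (grad F (x w)) ^+ 2.
Proof.
move=> sF ch; have [m [h [e [m0 h0 e0 star]]]] := sF.
exists (h * e / m); first by rewrite !mulf_neq0 // invr_eq0.
move=> w Uw; have [k k0 gE] := tzitzeica_normal sF ch Uw.
have [_ nx _ _] := ch; have n0 : normal x w != 0 by exact: nx.
have [Hy dH gy] := star _ (chart_in ch Uw).
have := curvature_numerator_hess ch Uw gE.
rewrite (tzitzeica_cross (hess_sym F (x w)) dH h0 m0 k0 Hy gE) gauss_curvatureE //.
have : dot (normal x w) (normal x w) != 0 by rewrite dot_eq0.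
move: gy; rewrite gE; move: (normal x w) (curvature_numerator x w) (x w - P) => n K y.
rewrite !dotZl !dotZr => ny nn0 KE.
have ny' : dot n y = e / k by rewrite -ny mulrAC mulfV ?mul1r.
have -> : K = k ^- 2 * (k ^+ 2 * K) by rewrite mulrA mulVf ?mul1r // expf_neq0.
by rewrite KE ny'; field; rewrite nn0 k0 m0.
Qed.

(** By the form of the curvature; the sign is that of the scalar product of the gradient
   and the normal vector of the chart, hence locally constant. *)
Lemma tzitzeica_conormal F P U x w : tzitzeica F P ->
  local_parametrization (zeros F) U x -> U w ->
  exists2 C, C != 0 & \forall q \near w, affine_conormal x q = C *: grad F (x q).
Proof.
move=> sF ch Uw; have [kap kap0 KE] := tzitzeica_curvature sF ch.
have [[oU sx] nx _ _] := ch.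
pose f q := dot (grad F (x q)) (normal x q).
have fE q : U q -> exists2 k, k != 0 & grad F (x q) = k *: normal x q.
  exact: (tzitzeica_normal sF ch).
have f0 : f w != 0.
  have [k k0 gE] := fE w Uw; rewrite /f gE.
  have : normal x w != 0 by exact: nx.
  by move: (normal x w) => n n0; rewrite dotZl mulf_neq0 // dot_eq0.
have rU : regular_piece U x by apply: (chart_regular ch) => //; exists w.
have [_ _ _ _ /(_ w Uw)[_ cn cx]] := rU.
have cf : {for w, continuous f}.
  apply: continuous_dot => // i.
  rewrite (_ : (fun q => _) = (fun q => ev (mderiv i F) (x q))); first exact: continuous_ev.
  by apply/funext => q; rewrite mxE.
exists (Num.sg (f w) * `|kap| `^ (- 4^-1)).
  by rewrite mulf_neq0 ?sgr_eq0 // powR_eq0 negb_and normr_eq0 kap0.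
have sg := near_sg cf f0; near=> q; have Uq : U q.
  by near: q; apply: open_nbhs_nbhs.
have <- : Num.sg (f q) = Num.sg (f w) by near: q; exact: sg.
rewrite /affine_conormal KE //; have [k k0 gE] := fE q Uq.
by apply: conormal_scale gE => //; exact: nx.
Unshelve. all: by end_near. Qed.

Lemma normal_ratio g y a b (C r e : R) : cross a b = r *: y -> dot g y = e ->
  C != 0 -> r != 0 -> e != 0 ->
  (det3 (C *: g) (C *: a) (C *: b))^-1 *: cross (C *: a) (C *: b) = (C * e)^-1 *: y.
Proof.
move=> ab gy C0 r0 e0; rewrite det3E crossZl crossZr ab !dotZl !dotZr gy !scalerA.
by congr (_ *: _); field; rewrite C0 r0 e0.
Qed.

(** Near w the conormal may be differentiated as the gradient of F, that is, by means of
   the Hessian. *)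
Lemma tzitzeica_affine_normal F P U x w : tzitzeica F P ->
  local_parametrization (zeros F) U x -> U w ->
  exists2 r, r != 0 & affine_normal x w = r *: (x w - P).
Proof.
move=> sF ch Uw; have [C C0 nuE] := tzitzeica_conormal sF ch Uw.
have [[oU sx] _ _ _] := ch; have [dx1 dx2 _] := smooth_derivable sx Uw.
have [m [h [e [m0 h0 e0 star]]]] := sF.
have [k k0 gE] := tzitzeica_normal sF ch Uw.
have [Hy dH gy] := star _ (chart_in ch Uw).
have HH := tzitzeica_cross (hess_sym F (x w)) dH h0 m0 k0 Hy gE.
have nuw : affine_conormal x w = C *: grad F (x w) := nbhs_singleton nuE.
have d1 : du (affine_conormal x) w = C *: (hess F (x w) *m du x w).
  by rewrite -(derive_scale_grad F C dx1); apply: near_eq_derive.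
have d2 : dv (affine_conormal x) w = C *: (hess F (x w) *m dv x w).
  by rewrite -(derive_scale_grad F C dx2); apply: near_eq_derive.
exists (C * e)^-1; first by rewrite invr_eq0 mulf_neq0.
rewrite /affine_normal d1 d2 nuw; apply: (normal_ratio HH gy C0 _ e0).
by rewrite mulf_neq0 // invr_eq0 mulf_neq0.
Qed.

(** The derivatives of x would all be parallel to d. *)
Lemma piece_not_in_line U x P d : regular_piece U x -> d != 0 ->
  ~ (forall w, U w -> exists s : R, x w - P = s *: d).
Proof.
move=> rU d0 online; have [_ [w Uw] _ _ /(_ w Uw)[n0 _ _]] := rU.
have key v : dot (cross d v) (du x w) = 0 /\ dot (cross d v) (dv x w) = 0.
  have Gx q : U q -> ev (affine_poly (cross d v) (- dot (cross d v) P)) (x q) = 0.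
    move=> Uq; have [s xE] := online q Uq.
    rewrite ev_affine_poly -mulN1r -dotZr scaleN1r -dotDr xE dotZr dotC dot_crossl.
    by rewrite mulr0.
  by have := grad_tangent rU Gx Uw; rewrite grad_affine_poly.
have par (a : space3 R) : (forall v, dot (cross d v) a = 0) -> exists k, a = k *: d.
  move=> da; apply: (cross_eq0_scale d0); apply/eqP; rewrite -dot_eq0; apply/eqP.
  by rewrite -[RHS](da (cross a d)) !dotE /cross !vecE; ring.
have [k uE] := par _ (fun v => proj1 (key v)).
have [l vE] := par _ (fun v => proj2 (key v)).
by move: n0; rewrite /normal uE vE crossZl crossZr crossv !scaler0 eqxx.
Qed.

Lemma tzitzeica_curved_point F P U x w : tzitzeica F P ->
  local_parametrization (zeros F) U x -> U w -> curved_point (zeros F) U x w.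
Proof.
move=> sF ch Uw; split=> //; have [kap kap0 ->//] := tzitzeica_curvature sF ch.
have [k k0 gE] := tzitzeica_normal sF ch Uw; have [_ nx _ _] := ch.
rewrite mulf_neq0 // invr_eq0 expf_neq0 // dot_eq0 gE scaler_eq0 negb_or k0.
exact: nx.
Qed.

(** A second common point of the affine normal lines would force the surface into the
   line through it and P. *)
Lemma tzitzeica_affine_sphere F P : two_dimensional (zeros F) -> tzitzeica F P ->
  affine_sphere_centered_at (zeros F) P.
Proof.
move=> [U [x [ch [w0 Uw0]]]] sF; apply/seteqP; split=> [q /= qL|_ -> L]; last first.
  move=> [V [z [w [[chz Vw _] ->]]]].
  have [r r0 nE] := tzitzeica_affine_normal sF chz Vw.
  exists (- r^-1) => //; rewrite nE scalerA mulNr mulVf // scaleN1r opprB addrC.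
  by rewrite subrK.
apply: contrapT => /eqP; rewrite -subr_eq0 => qP.
have rU : regular_piece U x.
  by have [[oU _] _ _ _] := ch; apply: (chart_regular ch) => //; exists w0.
apply: (piece_not_in_line (P := P) rU qP) => w Uw.
have [r r0 nE] := tzitzeica_affine_normal sF ch Uw.
have [|t _] := qL (affine_normal_line x w).
  by exists U, x, w; split=> //; apply: tzitzeica_curved_point sF ch Uw.
rewrite nE => qE; exists (1 + t * r)^-1.
have qE' : q - P = (1 + t * r) *: (x w - P).
  by rewrite -qE scalerDl scale1r scalerA addrAC.
rewrite qE' scalerA mulVf ?scale1r //.
by apply: contraNneq qP => tr; rewrite qE' tr scale0r.
Qed.

End Starshaped_surfaces.

(** * The convex side *)

Section Hyperbolic.
Variable R : realType.
Implicit Types (F G : poly3 R) (p y z g n P : space3 R) (W : 'M[R]_3) (k c : R).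
Implicit Types (U : set (R * R)) (x : R * R -> space3 R).

Lemma arithmetic_geometric (a b c : R) : 0 < a -> 0 < b -> 0 < c -> a * b * c = 1 ->
  3 <= a + b + c.
Proof.
move=> a0 b0 c0 abc.
have tangent (u : R) : 0 < u -> 1 + ln u <= u.
  by move=> u0; rewrite -[leRHS](lnK u0) expR_ge1Dx.
have := congr1 (@ln R) abc; rewrite ln1 !lnM ?posrE ?mulr_gt0 //.
by have := tangent _ a0; have := tangent _ b0; have := tangent _ c0; lra.
Qed.

(** In orthonormal coordinates the surface is y0 y1 y2 = c; near a point y of it the
   coordinates keep their signs, so that the arithmetic-geometric inequality puts
   the surface on the side of its tangent plane that does not contain P. *)
Lemma torus_concave F W P k c : W^T *m W = 1%:M -> k != 0 -> c != 0 ->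
  F = mpolyC 3 k * (torus_poly W P - mpolyC 3 c) -> tzitzeica F P ->
  on_concave_side (zeros F) P.
Proof.
move=> WW k0 c0 FE sF U x w [ch Uw _].
have onT q : U q -> ev (torus_poly W P) (x q) = c.
  move=> Uq; have : ev F (x q) = 0 := chart_in ch Uq.
  by rewrite FE evM evB !evC => /eqP; rewrite mulf_eq0 (negPf k0) subr_eq0 => /eqP.
have [l l0 gE] := tzitzeica_normal sF ch Uw.
pose y q := W^T *m (x q - P).
have yc q : U q -> y q i0 0 * y q i1 0 * y q i2 0 = c.
  by move=> /onT; rewrite ev_torus_poly.
pose g := W *m vec (y w i0 0)^-1 (y w i1 0)^-1 (y w i2 0)^-1.
have [[y0 y1] y2] : (y w i0 0 != 0 /\ y w i1 0 != 0) /\ y w i2 0 != 0.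
  by move: c0; rewrite -(yc w Uw) !mulf_eq0 !negb_or => /andP[/andP[]].
have gg : grad F (x w) = (k * c) *: g.
  rewrite FE gradM gradC scaler0 add0r evC grad_subC grad_torus_poly -/(y w).
  rewrite -(yc w Uw) -scalerA; congr (_ *: _); rewrite scalemxAr; congr (_ *m _).
  by apply: vec_ext; rewrite [RHS]mxE !vecE; field; rewrite ?y0 ?y1 ?y2.
have gz (q : space3 R) : dot g (q - P) = (W^T *m (q - P)) i0 0 / y w i0 0 +
    (W^T *m (q - P)) i1 0 / y w i1 0 + (W^T *m (q - P)) i2 0 / y w i2 0.
  rewrite dot_trmx dotE; move: (W^T *m _) => z; rewrite !vecE; ring.
have gw : dot g (x w - P) = 3.
  by rewrite gz -/(y w) !mulfV //; ring.
have g0 : g != 0 by apply: contra_eq_neq gw => ->; rewrite dot0l eq_sym pnatr_eq0.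
have eg0 := enorm_gt0 g0.
exists ((enorm g)^-1 *: g); split; last first.
  by rewrite dotZl -opprB -scaleN1r dotZr gw pmulr_rlt0 ?invr_gt0 // mulN1r oppr_lt0.
split.
  have nE : normal x w = ((k * c) / l) *: g.
    by rewrite mulrC -scalerA -gg gE scalerA mulVf // scale1r.
  have -> : unit_normal x w = Num.sg ((k * c) / l) *: ((enorm g)^-1 *: g).
    rewrite -unit_scale ?mulf_neq0 ?invr_eq0 // -nE; exact: erefl.
  have : (k * c) / l != 0 by rewrite !mulf_neq0 // invr_eq0.
  rewrite neq_lt => /orP[s0|s0]; [right|left].
    by rewrite ltr0_sg // scaleN1r opprK.
  by rewrite gtr0_sg // scale1r.
have [[oU sx] _ _ _] := ch.
have rU : regular_piece U x by apply: (chart_regular ch) => //; exists w.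
have [_ _ _ _ /(_ w Uw)[_ _ cx]] := rU.
have pos i : y w i 0 != 0 -> \forall q \near w, 0 < y q i 0 / y w i 0.
  move=> yi; have cy : {for w, continuous (fun q => ev (coordinate W P i) (x q))}.
    exact: continuous_ev.
  rewrite (_ : (fun q => _) = (fun q => y q i 0)) in cy; last first.
    by apply/funext => q; rewrite ev_coordinate.
  have sg := near_sg cy yi; near=> q.
  have sq : Num.sg (y q i 0) = Num.sg (y w i 0) by near: q; exact: sg.
  by rewrite -sgr_gt0 sgrM sgrV sq -expr2 sqr_sg yi ltr01.
have p0 := pos _ y0; have p1 := pos _ y1; have p2 := pos _ y2.
near=> q; have Uq : U q by near: q; apply: open_nbhs_nbhs.
rewrite (_ : x q - x w = (x q - P) + (-1) *: (x w - P)); last first.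
  by rewrite scaleN1r opprB addrA subrK.
rewrite dotZl; apply: mulr_ge0; first by rewrite invr_ge0 ltW.
rewrite dotDr dotZr gw gz -/(y q) mulN1r subr_ge0.
apply: arithmetic_geometric.
- by near: q; exact: p0.
- by near: q; exact: p1.
- by near: q; exact: p2.
rewrite (_ : _ * _ = (y q i0 0 * y q i1 0 * y q i2 0) / (y w i0 0 * y w i1 0 * y w i2 0)).
  by rewrite !yc // mulfV.
by field; rewrite ?y0 ?y1 ?y2.
Unshelve. all: by end_near. Qed.

End Hyperbolic.

Theorem theorem5 (R : realType) (F : poly3 R) (S : set (space3 R))
    (hF : irreducible3 F) (hS : S = zeros F) (hdim : two_dimensional S)
    (hrot : affine_rotation_surface S)
    (hK : ~ gauss_curvature_identically_zero S)
    (haxes : exists A B : set (space3 R),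
        [/\ axis_of_rotation S A, axis_of_rotation S B & A <> B]) :
  exists P : space3 R,
    [/\ \bigcap_(A in axis_of_rotation S) A = [set P],
        affine_sphere_centered_at S P &
        ~ quadric F -> hyperbolic_affine_sphere S].
Proof.
rewrite {S}hS in hdim hrot hK haxes *.
have [p curv] := exists_curved_point hF hK.
have [U [x [ch Un0]]] := hdim; have [[oU _] _ _ _] := ch.
have rU : regular_piece U x by apply: (chart_regular ch).
have onF w : U w -> ev F (x w) = 0 by exact: (chart_in ch).
have meet A B : axis_of_rotation (zeros F) A -> axis_of_rotation (zeros F) B -> A <> B ->
    exists P, A `&` B = [set P] /\ centered_pair F P.
  move=> [k kA] [l lB] AB.
  have [W [P fA]] := axis_frame hF curv rU onF kA.
  have [W' [P' fB]] := axis_frame hF curv rU onF lB.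
  exact: (axes_meet curv fA fB AB).
have equation P := surface_equation hF curv rU onF (P := P).
have center P : centered_pair F P -> affine_sphere_centered_at (zeros F) P.
  by move=> /equation[sF _]; apply: tzitzeica_affine_sphere.
have [A [B [axA axB AB]]] := haxes.
have [P [ABP cP]] := meet A B axA axB AB.
have sP := center P cP.
exists P; split=> //.
  apply/seteqP; split=> [q qax|_ -> C axC]; first by rewrite -ABP; split; apply: qax.
  have [CA|CA] := pselect (A = C).
    by rewrite -CA; have [] : (A `&` B) P by rewrite ABP.
  have [P' [ACP' cP']] := meet A C axA axC CA.
  have -> : P = P' by have : [set P'] P by rewrite -(center P' cP') sP.
  by have [] : (A `&` C) P' by rewrite ACP'.
move=> nq; exists P; split=> //.
have [sF [//|[W [k [c [WW k0 c0 FE]]]]]] := equation P cP.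
exact: torus_concave FE sF.
Qed.
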